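(* For Schulze elections and for ranked pairs (with any feasible tie-breaking functions), control by adding voters is in FPT with respect to the parameter ''number of candidates'', in both the succinct and nonsuccinct input models, for both constructive and destructive control, and in both the nonunique-winner model and the unique-winner model.
   Context: An election consists of a finite candidate set $C$ and a collection of voters, each casting a tie-free linear order over $C$. WMG: for distinct $c,d$, edge weight $D(c,d)$ = (number preferring $c$ to $d$) minus (number preferring $d$ to $c$); path strength = minimum edge weight on the path. Schulze: $c$ is a winner iff for every other $d$, some simple path from $c$ to $d$ has strength at least that of every simple path from $d$ to $c$. Ranked pairs (with feasible, i.e. polynomial-time computable, tie-breaking linear orders on candidates and on unordered pairs): repeatedly take the not-yet-considered unordered pair $\{a,b\}$ with greatest $\max(D(a,b),D(b,a))$ (ties by the pair order); discard it if its order is already transitively implied by fixed orders, else fix the candidate with positive edge above the other (zero edges: candidate order decides); the top of the resulting linear order is the unique winner. Control by adding voters: given $C$, disjoint voter collections $V$ and $W$, distinguished $p\in C$, and nonnegative integer $k$, is there $Q\subseteq W$ with $\|Q\|\le k$ such that in the election $(C,V\cup Q)$, $p$ is a winner (constructive) / is not a winner (destructive)? Unique-winner model: replace ''a winner'' by ''the unique winner''. Nonsuccinct input: votes listed individually; succinct: each distinct vote listed with its multiplicity in binary. FPT: solvable in time $f(j)\cdot I^{O(1)}$ with $j$ the parameter value, $f$ computable, $I$ input size. *)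

(* Defs.v *)
From HB Require Import structures.
From mathcomp Require Import all_boot all_order all_algebra.
Set Implicit Arguments. Unset Strict Implicit. Unset Printing Implicit Defensive.
Import Order.TTheory GRing.Theory Num.Theory.

(* 1. Model of computation: deterministic one-tape Turing machines     *)
(*    over the alphabet {0,1,blank}.  States are 0..tm_states-1;       *)
(*    0 = start, 1 = accept, 2 = reject (both halting).                *)

Inductive sym := S0 | S1 | Blank.
Inductive move := MoveL | MoveR | Stay.

Record TM := {
  tm_states : nat;
  tm_delta : nat -> sym -> nat * sym * move }.

Definition tm_wf (M : TM) : Prop :=
  3 <= tm_states M /\
  forall q s, q < tm_states M -> ((tm_delta M q s).1.1 < tm_states M)%N.

(* configuration: state, left part (reversed), scanned symbol, right part *)
Definition config := (nat * seq sym * sym * seq sym)%type.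

Definition cstate (c : config) : nat := c.1.1.1.

Definition halted (q : nat) : bool := (q == 1%N) || (q == 2%N).

Definition step (M : TM) (c : config) : config :=
  let: (q, l, h, r) := c in
  if halted q then c else
  let: (q', s', mv) := tm_delta M q h in
  match mv with
  | MoveL => match l with
             | [::] => (q', [::], Blank, s' :: r)
             | x :: l' => (q', l', x, s' :: r)
             end
  | MoveR => match r with
             | [::] => (q', s' :: l, Blank, [::])
             | x :: r' => (q', s' :: l, x, r')
             end
  | Stay => (q', l, s', r)
  end.

Definition bit_sym (b : bool) : sym := if b then S1 else S0.

Definition init (w : seq bool) : config :=
  match map bit_sym w with
  | [::] => (0%N, [::], Blank, [::])
  | x :: r => (0%N, [::], x, r)
  end.

Definition run (M : TM) (t : nat) (w : seq bool) : config :=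
  iter t (step M) (init w).

Fixpoint bits_aux (fuel n : nat) : seq bool :=
  match fuel with
  | 0 => [::]
  | f.+1 => if n == 0%N then [::] else odd n :: bits_aux f n./2
  end.
Definition bits (n : nat) : seq bool := bits_aux n n.

(* self-delimiting binary code: every digit doubled, terminated by 01 *)
Definition enc_nat (n : nat) : seq bool :=
  flatten [seq [:: b; b] | b <- bits n] ++ [:: false; true].

Definition enc_list (T : Type) (e : T -> seq bool) (s : seq T) : seq bool :=
  enc_nat (size s) ++ flatten (map e s).

(* a vote = a linear order over candidates 0..m-1, best first *)
Definition vote := seq nat.
Definition enc_vote (v : vote) : seq bool := enc_list enc_nat v.

Definition computable (f : nat -> nat) : Prop :=
  exists M : TM, tm_wf M /\
    forall n y, exists t,
      cstate (run M t (enc_nat n ++ enc_nat y)) = (if f n == y then 1%N else 2%N).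

Definition FPT (I : Type) (enc : I -> seq bool) (valid : I -> Prop)
    (kappa : I -> nat) (yes : I -> Prop) : Prop :=
  exists (M : TM) (f : nat -> nat) (c : nat),
    tm_wf M /\ computable f /\
    forall x, valid x ->
      let conf := run M (f (kappa x) * (size (enc x)).+1 ^ c) (enc x) in
      halted (cstate conf) /\ (cstate conf = 1%N <-> yes x).

Definition valid_vote (m : nat) (v : vote) : bool := perm_eq v (iota 0 m).

Definition prefers (v : vote) (a b : nat) : bool := index a v < index b v.

Definition Npref (votes : seq vote) (a b : nat) : nat :=
  count (fun v => prefers v a b) votes.

Definition D (votes : seq vote) (a b : nat) : int :=
  ((Npref votes a b)%:Z - (Npref votes b a)%:Z)%R.

(* strength of the path x :: l (minimum edge weight); meaningful for l != [::] *)
Fixpoint strength (votes : seq vote) (x : nat) (l : seq nat) : int :=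
  match l with
  | [::] => 0%R
  | y :: l' => match l' with
               | [::] => D votes x y
               | _ :: _ => Order.min (D votes x y) (strength votes y l')
               end
  end.

Definition spath (m : nat) (c d : nat) (l : seq nat) : Prop :=
  l != [::] /\ last c l = d /\ uniq (c :: l) /\ all (fun x => x < m) (c :: l).

(* winner predicates: m candidates, votes, candidate *)
Definition rule := nat -> seq vote -> nat -> Prop.

Definition schulze_winner : rule := fun m votes c =>
  c < m /\
  forall d, d < m -> d <> c ->
    exists l, spath m c d l /\
      forall l', spath m d c l' -> (strength votes d l' <= strength votes c l)%R.

(* Tie-breaking functions, depending on the candidate set (i.e. on m):
   tc m a b  : a precedes b in the candidate order,
   tp m P Q  : unordered pair P = (a,b), a<b, precedes Q in the pair order. *)
Definition cand_tiebreak := nat -> nat -> nat -> bool.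
Definition pair_tiebreak := nat -> nat * nat -> nat * nat -> bool.

Definition upair (m : nat) (P : nat * nat) : bool := (P.1 < P.2) && (P.2 < m).

Definition strict_linear (T : eqType) (dom : pred T) (r : T -> T -> bool) : Prop :=
  (forall a, dom a -> ~~ r a a) /\
  (forall a b c, dom a -> dom b -> dom c -> r a b -> r b c -> r a c) /\
  (forall a b, dom a -> dom b -> a != b -> r a b || r b a).

Definition feasible_cand_tiebreak (tc : cand_tiebreak) : Prop :=
  (forall m, strict_linear (fun a => a < m) (tc m)) /\
  exists (M : TM) (c : nat), tm_wf M /\
    forall m a b, a < m -> b < m ->
      cstate (run M (m.+1 ^ c) (enc_nat m ++ enc_nat a ++ enc_nat b))
        = (if tc m a b then 1%N else 2%N).

Definition feasible_pair_tiebreak (tp : pair_tiebreak) : Prop :=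
  (forall m, strict_linear (upair m) (tp m)) /\
  exists (M : TM) (c : nat), tm_wf M /\
    forall m P Q, upair m P -> upair m Q ->
      cstate (run M (m.+1 ^ c)
                (enc_nat m ++ enc_nat P.1 ++ enc_nat P.2 ++ enc_nat Q.1 ++ enc_nat Q.2))
        = (if tp m P Q then 1%N else 2%N).

Definition all_upairs (m : nat) : seq (nat * nat) :=
  [seq P <- [seq (a, b) | a <- iota 0 m, b <- iota 0 m] | upair m P].

Definition pair_weight (votes : seq vote) (P : nat * nat) : int :=
  Order.max (D votes P.1 P.2) (D votes P.2 P.1).

Definition rp_before (tp : pair_tiebreak) (m : nat) (votes : seq vote)
    (P Q : nat * nat) : bool :=
  (pair_weight votes Q < pair_weight votes P)%R ||
  ((pair_weight votes P == pair_weight votes Q) && ((P == Q) || tp m P Q)).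

Definition rp_orient (tc : cand_tiebreak) (m : nat) (votes : seq vote)
    (P : nat * nat) : nat * nat :=
  let: (a, b) := P in
  if (0 < D votes a b)%R then (a, b)
  else if (0 < D votes b a)%R then (b, a)
  else if tc m a b then (a, b) else (b, a).

Fixpoint reach (E : seq (nat * nat)) (fuel x y : nat) : bool :=
  match fuel with
  | 0 => false
  | f.+1 => ((x, y) \in E) || has (fun e => (e.1 == x) && reach E f e.2 y) E
  end.

Definition rp_fixed (tc : cand_tiebreak) (tp : pair_tiebreak) (m : nat)
    (votes : seq vote) : seq (nat * nat) :=
  foldl (fun E P =>
           let: (x, y) := rp_orient tc m votes P in
           if reach E m x y || reach E m y x then E else (x, y) :: E)
        [::] (sort (rp_before tp m votes) (all_upairs m)).

(* the winner is the top of the resulting linear order *)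
Definition rp_winner (tc : cand_tiebreak) (tp : pair_tiebreak) : rule :=
  fun m votes p =>
    p < m /\ forall d, d < m -> d != p -> reach (rp_fixed tc tp m votes) m p d.

Definition wins (uniqm : bool) (R : rule) (m : nat) (votes : seq vote) (p : nat)
  : Prop :=
  if uniqm then R m votes p /\ (forall d, R m votes d -> d = p)
  else R m votes p.

Record ninst := NInst {
  n_m : nat; n_V : seq vote; n_W : seq vote; n_p : nat; n_k : nat }.

Record sinst := SInst {
  s_m : nat; s_V : seq (vote * nat); s_W : seq (vote * nat); s_p : nat; s_k : nat }.

Definition valid_ninst (x : ninst) : Prop :=
  all (valid_vote (n_m x)) (n_V x) /\ all (valid_vote (n_m x)) (n_W x) /\
  n_p x < n_m x.

Definition valid_succ_list (m : nat) (s : seq (vote * nat)) : Prop :=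
  all (fun vn => valid_vote m vn.1 && (0 < vn.2)) s /\ uniq (map fst s).

Definition valid_sinst (x : sinst) : Prop :=
  valid_succ_list (s_m x) (s_V x) /\ valid_succ_list (s_m x) (s_W x) /\
  s_p x < s_m x.

Definition enc_ninst (x : ninst) : seq bool :=
  enc_nat (n_m x) ++ enc_list enc_vote (n_V x) ++ enc_list enc_vote (n_W x)
  ++ enc_nat (n_p x) ++ enc_nat (n_k x).

Definition enc_vn (vn : vote * nat) : seq bool := enc_vote vn.1 ++ enc_nat vn.2.

Definition enc_sinst (x : sinst) : seq bool :=
  enc_nat (s_m x) ++ enc_list enc_vn (s_V x) ++ enc_list enc_vn (s_W x)
  ++ enc_nat (s_p x) ++ enc_nat (s_k x).

Definition expand (s : seq (vote * nat)) : seq vote :=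
  flatten [seq nseq vn.2 vn.1 | vn <- s].

Definition expand_inst (x : sinst) : ninst :=
  NInst (s_m x) (expand (s_V x)) (expand (s_W x)) (s_p x) (s_k x).

(* Q ranges over sub-collections of W (sub-multisets, as subsequences) *)
Definition control_yes (R : rule) (uniqm constructive : bool) (x : ninst) : Prop :=
  exists Q : seq vote, subseq Q (n_W x) /\ size Q <= n_k x /\
    (if constructive then wins uniqm R (n_m x) (n_V x ++ Q) (n_p x)
     else ~ wins uniqm R (n_m x) (n_V x ++ Q) (n_p x)).

Definition control_FPT (R : rule) (uniqm constructive succinct : bool) : Prop :=
  if succinct then
    FPT enc_sinst valid_sinst s_m
        (fun x => control_yes R uniqm constructive (expand_inst x))
  else
    FPT enc_ninst valid_ninst n_m (control_yes R uniqm constructive).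

(* Main.v *)
(* For votes that are linear orders D(P) <= D(Q) holds iff N(P) <= N(Q), where N(a,b) counts the voters
   preferring a to b; hence both rules depend only on the order of the pairwise counts N. Let x_t be the
   number of added votes of type t. For a fixed number m of candidates, control is then an integer
   program in the x_t whose coefficients are bounded in m: x_t <= w_t, sum x_t <= k, and the signs of
   N(Q) - N(P) must form a sign pattern for which p wins (or does not win). Reading all numbers bit by
   bit, least significant bit first, and guessing the bits of the x_t, it suffices to remember one bounded
   carry per linear form: this is a nondeterministic finite automaton whose transition table depends
   on m only. Its set of reachable states is updated once per bit position.
   The table is computed without any concern for time. As time bound the function f(m) = 2^s(m) is used,
   s(m) being the exact number of steps of that computation, which also bounds the size of the table;
   the rest is polynomial in the table and the input. Programs are written as functions on binary
   trees, which are compiled to programs on stacks of bits and these to one-tape Turing machines. *)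
Require Import Defs.
From HB Require Import structures.
From mathcomp Require Import all_boot all_order all_algebra.
From mathcomp Require Import zify.
From Stdlib Require Import FunctionalExtensionality IndefiniteDescription.
Set Implicit Arguments. Unset Strict Implicit. Unset Printing Implicit Defensive.

(** * Stack programs and their simulation by one-tape machines *)

(** The machine must not depend on the number m of candidates, so it has to build the table itself,
    and the time spent on this has to be covered by f(m). An explicit bound is avoided: [computable]
    only asks to decide whether f m = y, so f may be defined from the running time itself, provided
    that this time can be reproduced by running the program. For this reason time statements give an
    exact number of steps that depends on the argument alone, not on what else lies on the stacks.
    The time allowed is linear in f(m), whereas the simulation is polynomial in s(m) and the input
    length n. The exponential 2 ^ s(m) absorbs every fixed power of s(m), at the price of a larger
    power of n. The tie-breaking machines are simulated only while the table is built. The candidate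
    p belongs to the input and not to the parameter, so acceptance is tabulated for every candidate.
    Constructive and destructive control, and the two winner models, differ only in the Boolean test
    applied to a sign pattern. *)

Definition stacks := nat -> seq bool.
Definition upd (s : stacks) j v : stacks := fun i => if i == j then v else s i.

Inductive cmd :=
  | Skip | Push of nat & bool | CSeq of cmd & cmd | Case of nat & cmd & cmd & cmd
  | Loop of nat & cmd & cmd | Halt of bool.

Lemma cmd_dec (x y : cmd) : {x = y} + {x <> y}.
Proof. by decide equality; try (exact: PeanoNat.Nat.eq_dec); decide equality. Qed.
HB.instance Definition _ := hasDecEq.Build cmd (compareP cmd_dec).

Lemma sym_dec (x y : sym) : {x = y} + {x <> y}.
Proof. by decide equality. Defined.
HB.instance Definition _ := hasDecEq.Build sym (compareP sym_dec).

(* Programs run on a list of pending commands; the lists that can occur form a finite set (resid), which provides the states of the Turing machine. *)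
Inductive action :=
  | AStay of seq cmd
  | APush of nat & bool & seq cmd
  | APop of nat & (option bool -> seq cmd).

(** The first pending command, described without the contents of the stacks, so that one definition
    serves [kstep], the list of possible successors and the Turing machine. [Halt] stays in place,
    which makes halting a property of the continuation. *)
Definition act (k : seq cmd) : action :=
  match k with
  | [::] => AStay [::]
  | Skip :: k => AStay k
  | CSeq a b :: k => AStay (a :: b :: k)
  | Push j b :: k => APush j b k
  | Case j c0 c1 ce :: k => APop j (fun o =>
      match o with None => ce :: k | Some b => (if b then c1 else c0) :: k end)
  | Loop j c0 c1 :: k => APop j (fun o =>
      match o with None => k | Some b => (if b then c1 else c0) :: Loop j c0 c1 :: k end)
  | Halt b :: k => AStay (Halt b :: k)
  end.

Definition kstep (x : seq cmd * stacks) : seq cmd * stacks :=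
  let: (k, s) := x in
  match act k with
  | AStay k' => (k', s)
  | APush j b k' => (k', upd s j (b :: s j))
  | APop j F => match s j with
                | [::] => (F None, s)
                | b :: v => (F (Some b), upd s j v)
                end
  end.

(** A loop body is entered with the loop itself as the next pending command, so a second turn meets
    the same continuations as the first. This is why finitely many suffice. *)
Fixpoint resid (c : cmd) (k : seq cmd) : seq (seq cmd) :=
  (c :: k) :: match c with
  | CSeq a b => resid a (b :: k) ++ resid b k
  | Case _ c0 c1 ce => resid c0 k ++ resid c1 k ++ resid ce k
  | Loop _ c0 c1 => resid c0 (c :: k) ++ resid c1 (c :: k)
  | _ => [::]
  end.

Fixpoint width (c : cmd) : nat :=
  match c with
  | Push j _ => j.+1
  | CSeq a b => maxn (width a) (width b)
  | Case j c0 c1 ce => maxn j.+1 (maxn (width c0) (maxn (width c1) (width ce)))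
  | Loop j c0 c1 => maxn j.+1 (maxn (width c0) (width c1))
  | _ => 0
  end.

Definition succs (k : seq cmd) : seq (seq cmd) :=
  match act k with
  | AStay k' => [:: k']
  | APush _ _ k' => [:: k']
  | APop _ F => [:: F None; F (Some false); F (Some true)]
  end.

Definition awidth (k : seq cmd) : nat :=
  match act k with AStay _ => 0 | APush j _ _ => j.+1 | APop j _ => j.+1 end.

Lemma resid_head c k : c :: k \in resid c k.
Proof. by case: c => *; rewrite /= inE eqxx. Qed.

(** A command leaves its own residuals only by finishing, and then exactly [k] is pending; with this
    exit as a separate case the induction on [c] goes through for every [k]. *)
Lemma resid_closed c k x y : x \in resid c k -> y \in succs x ->
  (y \in resid c k) || (y == k).
Proof.
elim: c k x => [|j b|a IHa b IHb|j c0 IH0 c1 IH1 ce IHe|j c0 IH0 c1 IH1|b] k x /=.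
- by rewrite inE => /eqP->; rewrite /succs /= inE => /eqP->; rewrite eqxx orbT.
- by rewrite inE => /eqP->; rewrite /succs /= inE => /eqP->; rewrite eqxx orbT.
- rewrite inE mem_cat => /orP[/eqP->|/orP[Hx|Hx]] Hy.
  + move: Hy; rewrite /succs /= inE => /eqP->. by rewrite inE mem_cat resid_head !orbT.
  + case/orP: (IHa _ _ Hx Hy) => [H|/eqP->]; rewrite inE mem_cat ?H ?orbT //.
    by rewrite resid_head !orbT.
  + by case/orP: (IHb _ _ Hx Hy) => [H|/eqP->]; rewrite ?inE ?mem_cat ?H ?eqxx ?orbT.
- rewrite inE !mem_cat => /orP[/eqP->|/or3P[Hx|Hx|Hx]] Hy.
  + move: Hy; rewrite /succs /= !inE => /or3P[] /eqP->; by rewrite ?inE !mem_cat resid_head !orbT.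
  + by case/orP: (IH0 _ _ Hx Hy) => [H|/eqP->]; rewrite ?inE ?mem_cat ?H ?eqxx ?orbT.
  + by case/orP: (IH1 _ _ Hx Hy) => [H|/eqP->]; rewrite ?inE ?mem_cat ?H ?eqxx ?orbT.
  + by case/orP: (IHe _ _ Hx Hy) => [H|/eqP->]; rewrite ?inE ?mem_cat ?H ?eqxx ?orbT.
- rewrite inE !mem_cat => /orP[/eqP->|/orP[Hx|Hx]] Hy.
  + move: Hy; rewrite /succs /= !inE => /or3P[] /eqP->; by rewrite ?inE ?eqxx ?mem_cat ?resid_head ?orbT.
  + by case/orP: (IH0 _ _ Hx Hy) => [H|/eqP->]; rewrite ?inE ?mem_cat ?H ?eqxx ?orbT.
  + by case/orP: (IH1 _ _ Hx Hy) => [H|/eqP->]; rewrite ?inE ?mem_cat ?H ?eqxx ?orbT.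
- by rewrite inE => /eqP->; rewrite /succs /= !inE => ->.
Qed.

Lemma resid_width c k x : x \in resid c k -> awidth x <= width c.
Proof.
elim: c k x => [|j b|a IHa b IHb|j c0 IH0 c1 IH1 ce IHe|j c0 IH0 c1 IH1|b] k x /=;
  rewrite inE ?mem_cat.
- by move/eqP->.
- by move/eqP->.
- by case/orP=> [/eqP->//|/orP[/IHa|/IHb]]; lia.
- by case/orP=> [/eqP->//|/or3P[/IH0|/IH1|/IHe]]; rewrite /awidth /=; lia.
- by case/orP=> [/eqP->//|/orP[/IH0|/IH1]]; rewrite /awidth /=; lia.
- by move/eqP->.
Qed.

(* Tapes are compared up to trailing blanks. *)
Definition eqB (a b : seq sym) := forall n, nth Blank a n = nth Blank b n.

Lemma eqB_cons x a y b : eqB (x :: a) (y :: b) -> x = y /\ eqB a b.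
Proof. by move=> H; split; [exact: (H 0)|move=> n; exact: (H n.+1)]. Qed.

Lemma eqB_consI x a b : eqB a b -> eqB (x :: a) (x :: b).
Proof. by move=> H [|n] //=. Qed.

Section Sim.
Variables (c0 : cmd) (w : nat).
Hypothesis (Hw : width c0 <= w).

Definition conts : seq (seq cmd) := [::] :: resid c0 [::].

Lemma conts_closed x y : x \in conts -> y \in succs x -> y \in conts.
Proof.
rewrite !(inE, in_cons) => /orP[/eqP->|Hx Hy]; first by rewrite inE => /eqP->.
by rewrite orbC; apply: resid_closed Hx Hy.
Qed.

Lemma conts_width x : x \in conts -> awidth x <= w.
Proof.
rewrite inE => /orP[/eqP->//|/resid_width H]; exact: leq_trans H Hw.
Qed.

(* With the stacks S_0, S_1, ... (tops first) the tape is S_0 Blank S_1 Blank ... and the head rests on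
   its first cell. A push moves everything left of the new cell one cell to the left, and a pop moves it
   to the right; so the rest position drifts and only blanks have to be counted. A state is a continuation with a micro-state (tag, number of separators still to cross, carried symbol). *)
Definition mst := (seq cmd * (nat * nat * sym))%type.

Notation tGo := 0.
Notation tSeek := 1.
Notation tWalk := 2.
Notation tRet := 3.
Notation tDel := 4.
Notation tDelL := 5.
Notation tDelR := 6.
Notation tSkip := 7.

Definition Go k : mst := (k, (tGo, 0, Blank)).

Definition dec n (h : sym) : nat := n - (h == Blank).

Lemma dec_count n h c : (h == Blank) + c = n -> dec n h = c.
Proof. by rewrite /dec => <-; rewrite addKn. Qed.

Lemma dec_le n h m : n <= m -> dec n h <= m.
Proof. by move=> H; apply: leq_trans H; apply: leq_subr. Qed.

Definition sym_bit (h : sym) : option bool :=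
  match h with S0 => Some false | S1 => Some true | Blank => None end.

(** [tSeek] goes right to the top of the stack concerned. On the way back, [tWalk] shifts every
    symbol one cell left to make room for a push; [tRet] changes nothing, after a pop from an empty
    stack; [tDelL], [tDelR] and [tDel] move every symbol one cell right into the gap made by a pop,
    and [tSkip] steps over the last gap. A blank met on the way back with counter 0 is the cell left
    of the tape. *)
Definition delta (q : mst) (h : sym) : mst * sym * move :=
  let: (k, (t, n, c)) := q in
  match t with
  | tGo => match act k with
           | AStay k' => (Go k', h, Stay)
           | APush j _ _ => ((k, (tSeek, j, Blank)), h, Stay)
           | APop j _ => ((k, (tSeek, j, Blank)), h, Stay)
           end
  | tSeek =>
      if 0 < n then ((k, (tSeek, dec n h, Blank)), h, MoveR) else
      match act k with
      | AStay k' => (Go k', h, Stay)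
      | APush j b k' => ((k', (tWalk, j, bit_sym b)), h, MoveL)
      | APop j F =>
          if h == Blank then ((F None, (tRet, j, Blank)), h, MoveL)
          else ((F (sym_bit h), (tDelL, j, Blank)), Blank, MoveL)
      end
  | tWalk =>
      if (h == Blank) && (n == 0) then (Go k, c, Stay)
      else ((k, (tWalk, dec n h, h)), c, MoveL)
  | tRet =>
      if (h == Blank) && (n == 0) then (Go k, h, MoveR)
      else ((k, (tRet, dec n h, Blank)), h, MoveL)
  | tDel => ((k, (tDelL, n, Blank)), h, MoveL)
  | tDelL =>
      if (h == Blank) && (n == 0) then ((k, (tSkip, 0, Blank)), h, MoveR)
      else ((k, (tDelR, dec n h, h)), Blank, MoveR)
  | tDelR => ((k, (tDel, n, Blank)), c, MoveL)
  | _ => (Go k, h, MoveR)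
  end.

Definition micros : seq (nat * nat * sym) :=
  [seq (tn, c) | tn <- [seq (t, n) | t <- iota 0 8, n <- iota 0 w.+1], c <- [:: S0; S1; Blank]].

Definition msts : seq mst := [seq (k, u) | k <- conts, u <- micros].

Lemma micros_mem t n c : ((t, n, c) \in micros) = (t < 8) && (n <= w).
Proof.
apply/idP/idP.
- case/allpairsP => -[tn1 c1] [H _ [E _]]; move: H; rewrite -{}E.
  case/allpairsP => -[t2 n2] [H1 H2 [-> ->]].
  by move: H1 H2; rewrite !mem_iota /= => H1 H2; lia.
- move=> H; apply/allpairsP; exists (t, n, c); split => //.
    by apply/allpairsP; exists (t, n); split; rewrite ?mem_iota /=; first [done|lia].
  by case: c.
Qed.

Lemma msts_mem k t n c : ((k, (t, n, c)) \in msts) = [&& k \in conts, t < 8 & n <= w].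
Proof.
rewrite -(micros_mem t n c); apply/idP/idP.
- by case/allpairsP => -[k1 u1] /= [? ? [-> ->]]; apply/andP.
- by case/andP => H1 H2; apply/allpairsP; exists (k, (t, n, c)).
Qed.

Lemma delta_closed q h : q \in msts -> (delta q h).1.1 \in msts.
Proof.
case: q => k [[t n] c]; rewrite msts_mem => /and3P[Hk Ht Hn].
have Hs y : y \in succs k -> y \in conts by exact: conts_closed Hk.
have Hk' := conts_width Hk.
have Hd x : dec n x <= w by rewrite /dec; lia.
case: t Ht => [|[|[|[|[|[|[|t]]]]]]] Ht; rewrite /delta.
- move: Hs Hk'; rewrite /succs /awidth; case: (act k) => [k'|j b k'|j F] Hs Hj.
  + by rewrite msts_mem Hs ?inE ?eqxx.
  + by rewrite msts_mem Hk; lia.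
  + by rewrite msts_mem Hk; lia.
- case: ifP => _; first by rewrite msts_mem Hk Hd.
  move: Hs Hk'; rewrite /succs /awidth; case: (act k) => [k'|j b k'|j F] Hs Hj.
  + by rewrite msts_mem Hs ?inE ?eqxx.
  + by rewrite msts_mem Hs ?inE ?eqxx //=; lia.
  + by case: h => /=; rewrite msts_mem Hs ?inE ?eqxx ?orbT //=; lia.
- by case: ifP => _; rewrite msts_mem Hk ?Hd.
- by case: ifP => _; rewrite msts_mem Hk ?Hd.
- by rewrite msts_mem Hk.
- by case: ifP => _; rewrite msts_mem Hk ?Hd.
- by rewrite msts_mem Hk.
- by rewrite msts_mem Hk.
Qed.

Definition fin (q : mst) : option bool :=
  match q with (Halt b :: _, (tGo, _, _)) => Some b | _ => None end.

(* State 0 only enters the initial state, states 1 and 2 stand for all halted states. *)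
Definition code_st (q : mst) : nat :=
  match fin q with Some true => 1 | Some false => 2 | None => 3 + index q msts end.

Definition mach : TM :=
  {| tm_states := 3 + size msts;
     tm_delta := fun n s =>
       if n == 0 then (code_st (Go [:: c0]), s, Stay)
       else if n < 3 then (0, s, Stay)
       else let: (q, s', mv) := delta (nth (Go [::]) msts (n - 3)) s in (code_st q, s', mv) |}.

Lemma Go_mem k : k \in conts -> Go k \in msts.
Proof. by rewrite msts_mem => ->. Qed.

Lemma code_st_lt q : q \in msts -> code_st q < 3 + size msts.
Proof. by rewrite /code_st -index_mem; move=> H; case: fin => [[]|] //; rewrite ltn_add2l. Qed.

Lemma mach_wf : tm_wf mach.
Proof.
have Hnil : Go [::] \in msts by apply: Go_mem; rewrite inE.
split => [//|n s] /= Hn.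
case: ifP => _; first by apply/code_st_lt/Go_mem; rewrite inE resid_head orbT.
case: ifP => // H3; case E: (delta _ s) => [[q s'] mv] /=.
apply: code_st_lt; have -> : q = (delta (nth (Go [::]) msts (n - 3)) s).1.1 by rewrite E.
by apply/delta_closed/mem_nth; rewrite ltn_subLR // leqNgt H3.
Qed.

Definition teq (c : config) (q : mst) (l s : seq sym) :=
  let: (q0, l0, h0, r0) := c in [/\ q0 = code_st q, eqB l0 l & eqB (h0 :: r0) s].

Definition live q := (q \in msts) && (fin q == None).

Lemma mach_delta q h : live q -> tm_delta mach (code_st q) h =
  (code_st (delta q h).1.1, (delta q h).1.2, (delta q h).2).
Proof.
case/andP => Hq /eqP Hf; rewrite /code_st Hf /= addKn nth_index //.
by case: (delta q h) => [[q' s'] mv].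
Qed.

Lemma live_halted q : live q -> halted (code_st q) = false.
Proof. by case/andP => _ /eqP Hf; rewrite /code_st Hf. Qed.

Lemma teq_step c q l x s q' y mv : live q -> teq c q l (x :: s) ->
  delta q x = (q', y, mv) ->
  match mv with
  | MoveR => teq (step mach c) q' (y :: l) s
  | MoveL => teq (step mach c) q' (behead l) (head Blank l :: y :: s)
  | Stay => teq (step mach c) q' l (y :: s)
  end.
Proof.
case: c => [[[q0 l0] h0] r0] Hl [-> El Er] Hd.
have [E1 {}Er] := eqB_cons Er; subst h0.
rewrite /step (live_halted Hl) (mach_delta _ Hl) Hd /=.
case: mv Hd => _.
- case: l0 El => [|a l0] El.
    split => //; first by move=> n; rewrite nth_nil nth_behead -El nth_nil.
    by move=> [|n] /=; [rewrite -nth0 -El | case: n => [|n] //=].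
  split => //; first by move=> n; rewrite nth_behead -El.
  by move=> [|n] /=; [rewrite -nth0 -El | case: n => [|n] //=].
- case: r0 Er => [|b r0] Er.
    split => //; first exact: eqB_consI.
    by move=> n; rewrite -Er; case: n => [|[|n]].
  by split => //; apply: eqB_consI.
- by split => //; apply: eqB_consI.
Qed.

Lemma teq_eqB c q l s l' s' : teq c q l s -> eqB l l' -> eqB s s' -> teq c q l' s'.
Proof.
case: c => [[[q0 l0] h0] r0] [-> El Er] H1 H2.
by split => // n; rewrite ?El ?Er.
Qed.

Lemma live_micro k t n c : k \in conts -> 0 < t < 8 -> n <= w -> live (k, (t, n, c)).
Proof.
move=> Hk Ht Hn; rewrite /live msts_mem Hk Hn /=; case/andP: Ht.
by case: t => //= t _ ->; case: k {Hk} => [|[]].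
Qed.

Definition runs (n : nat) (q q' : mst) l s l' s' :=
  forall c, teq c q l s -> teq (iter n (step mach) c) q' l' s'.

Lemma runs_trans n1 n2 q1 q2 q3 l1 s1 l2 s2 l3 s3 :
  runs n1 q1 q2 l1 s1 l2 s2 -> runs n2 q2 q3 l2 s2 l3 s3 ->
  runs (n1 + n2) q1 q3 l1 s1 l3 s3.
Proof. by move=> H1 H2 c Hc; rewrite addnC iterD; apply/H2/H1. Qed.

Lemma runsS n q1 q2 q3 y mv l1 x s l3 s3 : live q1 -> delta q1 x = (q2, y, mv) ->
  match mv with
  | MoveR => runs n q2 q3 (y :: l1) s l3 s3
  | MoveL => runs n q2 q3 (behead l1) (head Blank l1 :: y :: s) l3 s3
  | Stay => runs n q2 q3 l1 (y :: s) l3 s3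
  end -> runs n.+1 q1 q3 l1 (x :: s) l3 s3.
Proof.
move=> Hl Hd Hr c Hc; have := teq_step Hl Hc Hd; rewrite iterSr.
by case: mv Hd Hr => _ Hr; apply: Hr.
Qed.

Lemma runs0 q l s : runs 0 q q l s l s.
Proof. by []. Qed.

Lemma runs_eqB n q q' l s l' s' l2 s2 : runs n q q' l s l' s' -> eqB l' l2 -> eqB s' s2 ->
  runs n q q' l s l2 s2.
Proof. by move=> H H1 H2 c /H /teq_eqB; apply. Qed.

Lemma runs_eqBl n q q' l s l' s' l2 s2 : runs n q q' l2 s2 l' s' -> eqB l l2 -> eqB s s2 ->
  runs n q q' l s l' s'.
Proof. by move=> H H1 H2 c /teq_eqB Hc; apply/H/Hc. Qed.

Lemma seek_runs k n pre l s : k \in conts -> count_mem Blank pre = n -> n <= w ->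
  last Blank pre = Blank ->
  runs (size pre) (k, (tSeek, n, Blank)) (k, (tSeek, 0, Blank)) l (pre ++ s) (rev pre ++ l) s.
Proof.
move=> Hk; elim: pre n l => [|x pre IH] n l /=; first by move=> <- _ _; apply: runs0.
move=> Hn Hw' Hlast; have n0 : 0 < n.
  have : Blank \in x :: pre by rewrite -Hlast mem_last.
  by rewrite -has_pred1 has_count -Hn.
apply: (@runsS _ _ (k, (tSeek, dec n x, Blank)) _ x MoveR).
- exact: live_micro.
- by rewrite /= n0.
- rewrite rev_cons cat_rcons; apply: IH.
  + by rewrite (dec_count Hn).
  + exact: dec_le.
  + by move: Hlast; case: (pre).
Qed.

Lemma walk_runs k n c l s : k \in conts -> count_mem Blank l = n -> n <= w ->
  runs (size l).+1 (k, (tWalk, n, c)) (Go k) (behead (rcons l Blank))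
    (head Blank (rcons l Blank) :: s) [::] (rev l ++ c :: s).
Proof.
move=> Hk; elim: l n c s => [|x l IH] n c s /=.
  move=> Hn _; subst n; apply: (@runsS _ _ (Go k) _ c Stay) => //.
  exact: live_micro.
move=> Hn Hw'; apply: (@runsS _ _ (k, (tWalk, dec n x, x)) _ c MoveL).
- exact: live_micro.
- by rewrite /=; case: ifP => // /andP[/eqP E /eqP E2]; rewrite E E2 in Hn.
- rewrite rev_cons cat_rcons; apply: IH; [by rewrite (dec_count Hn)|exact: dec_le].
Qed.

Lemma ret_runs k n l s : k \in conts -> count_mem Blank l = n -> n <= w ->
  runs (size l).+1 (k, (tRet, n, Blank)) (Go k) (behead (rcons l Blank))
    (head Blank (rcons l Blank) :: s) [::] (rev l ++ s).
Proof.
move=> Hk; elim: l n s => [|x l IH] n s /=.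
  move=> Hn _; subst n; apply: (@runsS _ _ (Go k) _ Blank MoveR) => //.
    exact: live_micro.
  by apply: (runs_eqB (@runs0 _ _ _)) => // -[|[|]].
move=> Hn Hw'; apply: (@runsS _ _ (k, (tRet, dec n x, Blank)) _ x MoveL).
- exact: live_micro.
- by rewrite /=; case: ifP => // /andP[/eqP E /eqP E2]; rewrite E E2 in Hn.
- rewrite rev_cons cat_rcons; apply: IH; [by rewrite (dec_count Hn)|exact: dec_le].
Qed.

Lemma del_runs k n l s : k \in conts -> count_mem Blank l = n -> n <= w ->
  runs (3 * size l).+2 (k, (tDelL, n, Blank)) (Go k) (behead (rcons l Blank))
    (head Blank (rcons l Blank) :: Blank :: s) [::] (rev l ++ s).
Proof.
move=> Hk; elim: l n s => [|x l IH] n s /=.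
  move=> Hn _; subst n; apply: (@runsS _ _ (k, (tSkip, 0, Blank)) _ Blank MoveR) => //.
    exact: live_micro.
  apply: (@runsS _ _ (Go k) _ Blank MoveR) => //.
    exact: live_micro.
  by apply: (runs_eqB (@runs0 _ _ _)) => // -[|[|[|]]].
move=> Hn Hw'; have -> : (3 * (size l).+1).+2 = (3 * size l).+2.+3 by lia.
have Hd : dec n x <= w by exact: dec_le.
apply: (@runsS _ _ (k, (tDelR, dec n x, x)) _ Blank MoveR).
- exact: live_micro.
- by rewrite /=; case: ifP => // /andP[/eqP E /eqP E2]; rewrite E E2 in Hn.
apply: (@runsS _ _ (k, (tDel, dec n x, Blank)) _ x MoveL) => //.
  exact: live_micro.
apply: (@runsS _ _ (k, (tDelL, dec n x, Blank)) _ Blank MoveL) => //.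
  exact: live_micro.
by rewrite rev_cons cat_rcons /=; apply: IH; [by rewrite (dec_count Hn)|exact: dec_le].
Qed.

Definition tape (lo n : nat) (s : stacks) : seq sym :=
  flatten [seq rcons (map bit_sym (s i)) Blank | i <- iota lo n].

Lemma tape_split s j v : j < w ->
  tape 0 w (upd s j v) = tape 0 j s ++ map bit_sym v ++ Blank :: tape j.+1 (w - j.+1) s.
Proof.
move=> Hj; rewrite /tape -{1}(subnKC Hj) -addn1 -addnA iotaD iotaD !map_cat !flatten_cat /= add0n.
rewrite /upd eqxx cats0 cat_rcons addn1; congr (_ ++ _ ++ _ :: _).
- congr flatten; apply/eq_in_map => i; rewrite mem_iota /= add0n => Hi.
  by rewrite ltn_eqF.
- congr flatten; apply/eq_in_map => i; rewrite mem_iota => /andP[Hi _].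
  by rewrite gtn_eqF.
Qed.

Lemma upd_id s j : upd s j (s j) = s.
Proof. by apply: functional_extensionality => i; rewrite /upd; case: eqP => [->|]. Qed.

Lemma tape_split_id s j : j < w ->
  tape 0 w s = tape 0 j s ++ map bit_sym (s j) ++ Blank :: tape j.+1 (w - j.+1) s.
Proof. by move=> Hj; rewrite -{1}(upd_id s j) tape_split. Qed.

Lemma tape_count s j : count_mem Blank (tape 0 j s) = j.
Proof.
elim: j => [|j IH] //; rewrite /tape -addn1 iotaD map_cat flatten_cat count_cat IH /=.
rewrite cats0 -cats1 count_cat /= (_ : count _ _ = 0) //; apply/eqP.
by rewrite -leqn0 leqNgt -has_count; apply/hasPn => x /mapP[[] _ ->].
Qed.

Lemma tape_last s j : last Blank (tape 0 j s) = Blank.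
Proof.
case: j => // j; rewrite /tape -addn1 iotaD map_cat flatten_cat last_cat /= cats0.
by rewrite last_rcons.
Qed.

Definition tape_len (s : stacks) := size (tape 0 w s).

Lemma tape_size s j : j < w -> size (tape 0 j s) <= tape_len s.
Proof. by move=> Hj; rewrite /tape_len (tape_split_id s Hj) size_cat leq_addr. Qed.

Lemma eqB_rcons l : eqB l (rcons l Blank).
Proof.
move=> n; rewrite nth_rcons; case: ltnP => // H.
by rewrite nth_default //; case: ifP.
Qed.

Lemma eqB_behead l : eqB (behead l) (behead (rcons l Blank)).
Proof. by move=> n; rewrite !nth_behead; apply: eqB_rcons. Qed.

Lemma head_rcons l : head Blank (rcons l Blank) = head Blank l.
Proof. by case: l. Qed.

Lemma runs_left q1 q2 n l s l' s' :
  runs n q1 q2 (behead (rcons l Blank)) (head Blank (rcons l Blank) :: s) l' s' ->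
  runs n q1 q2 (behead l) (head Blank l :: s) l' s'.
Proof.
by move/runs_eqBl; apply; [exact: eqB_behead|rewrite head_rcons].
Qed.

(** A pop from a nonempty stack costs most: one move per cell to reach the stack and three per cell
    on the way back. *)
Lemma kstep_sim k s : k \in conts -> fin (Go k) = None -> 0 < w ->
  exists2 n, n <= 4 * tape_len s + 6 &
    runs n (Go k) (Go (kstep (k, s)).1) [::] (tape 0 w s) [::] (tape 0 w (kstep (k, s)).2).
Proof.
move=> Hk Hf w0; have Hlive : live (Go k) by rewrite /live Go_mem // Hf.
have Hs y : y \in succs k -> y \in conts by exact: conts_closed Hk.
have Hwd := conts_width Hk.
case Et: (tape 0 w s) => [|x t].
  by move: Et; rewrite (tape_split_id s w0) => /eqP; rewrite -size_eq0 !size_cat /=; lia.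
move: Hs Hwd; rewrite /succs /awidth /=; case Ea: (act k) => [k'|j b k'|j F] Hs Hwd.
- exists 1; first by lia.
  by rewrite Et; apply: (@runsS _ _ (Go k') _ x Stay) => //; rewrite /= Ea.
- have Hsz := tape_size s Hwd.
  have Hw' := ltnW Hwd.
  exists (1 + (size (tape 0 j s) + (size (tape 0 j s)).+2)); first by lia.
  rewrite add1n; apply: (@runsS _ _ (k, (tSeek, j, Blank)) _ x Stay) => //.
    by rewrite /= Ea.
  rewrite /= -Et (tape_split_id s Hwd); apply: runs_trans.
    apply: seek_runs => //; [exact: tape_count|exact: tape_last].
  case Er: (map bit_sym (s j) ++ _) => [|y u]; first by case: (s j) Er.
  rewrite cats0; apply: (@runsS _ _ (k', (tWalk, j, bit_sym b)) _ y MoveL).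
  + exact: live_micro.
  + by rewrite /= Ea.
  apply: runs_left; rewrite -(size_rev (tape 0 j s)) tape_split //= Er -{4}(revK (tape 0 j s)).
  apply: walk_runs => //; last by rewrite count_rev tape_count.
  by apply: Hs; rewrite inE.
- have Hsz := tape_size s Hwd.
  have Hw' := ltnW Hwd.
  case Esj: (s j) => [|b v].
  + exists (1 + (size (tape 0 j s) + (size (tape 0 j s)).+2)); first by lia.
    rewrite add1n; apply: (@runsS _ _ (k, (tSeek, j, Blank)) _ x Stay) => //.
      by rewrite /= Ea.
    rewrite /= -Et (tape_split_id s Hwd) Esj /=; apply: runs_trans.
      apply: seek_runs => //; [exact: tape_count|exact: tape_last].
    rewrite cats0; apply: (@runsS _ _ (F None, (tRet, j, Blank)) _ Blank MoveL).
    * exact: live_micro.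
    * by rewrite /= Ea.
    apply: runs_left; rewrite -(size_rev (tape 0 j s)) -{4}(revK (tape 0 j s)).
    apply: ret_runs => //; last by rewrite count_rev tape_count.
    by apply: Hs; rewrite !inE eqxx.
  + exists (1 + (size (tape 0 j s) + (3 * size (tape 0 j s)).+3)); first by lia.
    rewrite add1n; apply: (@runsS _ _ (k, (tSeek, j, Blank)) _ x Stay) => //.
      by rewrite /= Ea.
    rewrite /= -Et (tape_split_id s Hwd) Esj /=; apply: runs_trans.
      apply: seek_runs => //; [exact: tape_count|exact: tape_last].
    rewrite cats0; apply: (@runsS _ _ (F (Some b), (tDelL, j, Blank)) _ Blank MoveL).
    * exact: live_micro.
    * by rewrite /= Ea; case: (b).
    apply: runs_left; rewrite -(size_rev (tape 0 j s)) tape_split //= -{4}(revK (tape 0 j s)).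
    apply: del_runs => //; last by rewrite count_rev tape_count.
    by apply: Hs; case: (b); rewrite !inE eqxx ?orbT.
Qed.

Lemma tape_len_upd s j v : j < w -> tape_len (upd s j v) + size (s j) = tape_len s + size v.
Proof.
move=> Hj; rewrite /tape_len tape_split // (tape_split_id s Hj) !size_cat /= !size_map; lia.
Qed.

Lemma kstep_tape_len k s : k \in conts -> tape_len (kstep (k, s)).2 <= (tape_len s).+1.
Proof.
move/conts_width; rewrite /awidth /kstep; case: act => [k'|j b k'|j F] //= Hj.
- by move: (tape_len_upd s (b :: s j) Hj) => /=; lia.
- case E: (s j) => [|b v] //=.
  by move: (tape_len_upd s v Hj); rewrite E /=; lia.
Qed.

Lemma kstep_conts k s : k \in conts -> (kstep (k, s)).1 \in conts.
Proof.
move=> Hk; apply: conts_closed (Hk) _; rewrite /succs /kstep.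
case: act => [k'|j b k'|j F]; rewrite ?inE //.
by case: (s j) => [|[] v]; rewrite ?inE eqxx ?orbT.
Qed.

Lemma step_halted M c : halted (cstate c) -> step M c = c.
Proof. by case: c => [[[q l] h] r]; rewrite /cstate /= => ->. Qed.

Lemma iter_halted M n c : halted (cstate c) -> iter n (step M) c = c.
Proof. by move=> H; elim: n => //= n ->; rewrite step_halted. Qed.

Lemma kstep_fin k s b : fin (Go k) = Some b -> kstep (k, s) = (k, s).
Proof. by case: k => [|[]]. Qed.

Lemma teq_fin c k l s b : teq c (Go k) l s -> fin (Go k) = Some b ->
  halted (cstate c) /\ (cstate c == 1) = b.
Proof.
case: c => [[[q l0] h] r] [-> _ _] Hb; rewrite /cstate /code_st Hb.
by case: b {Hb}.
Qed.

(** A simulated step lengthens the tape by at most one cell, so each of the [t] steps costs at most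
    4 ([tape_len s] + t) + 6 moves. Any larger [T] serves as well, because a halted machine no
    longer changes. *)
Lemma iter_sim t k s b c T : k \in conts -> 0 < w ->
  fin (Go (iter t kstep (k, s)).1) = Some b ->
  teq c (Go k) [::] (tape 0 w s) -> t * (4 * (tape_len s + t) + 6) <= T ->
  let c' := iter T (step mach) c in halted (cstate c') /\ (cstate c' == 1) = b.
Proof.
move=> + w0; elim: t k s c T => [|t IH] k s c T Hk Hb Hc HT /=.
  have [Hh Hq] := teq_fin Hc Hb; by rewrite iter_halted.
case Hf: (fin (Go k)) => [b'|].
  have Hb' : b' = b.
    suff E : forall n, iter n kstep (k, s) = (k, s) by move: Hb; rewrite E [fin _]Hf => -[].
    by elim=> //= n ->; rewrite (kstep_fin _ Hf).
  by subst b'; have [Hh Hq] := teq_fin Hc Hf; rewrite iter_halted.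
have [n Hn Hr] := kstep_sim s Hk Hf w0.
have Ht := kstep_tape_len s Hk; have Hk' := kstep_conts s Hk.
have HnT : n <= T by apply: leq_trans HT; apply: leq_trans Hn _; nia.
rewrite -(subnK HnT) iterD.
move: (Hr _ Hc) Hb Ht Hk'; rewrite iterSr; case: (kstep (k, s)) => k' s' /= Hc' Hb Ht Hk'.
apply: (IH k' s') => //.
rewrite leq_subRL //; apply: leq_trans HT; nia.
Qed.

Lemma tape_len0 v : 0 < w -> tape_len (upd (fun => [::]) 0 v) = size v + w.
Proof.
move=> w0; rewrite /tape_len tape_split // size_cat size_cat size_map /=.
suff H lo n : size (tape lo n (fun=> [::])) = n by rewrite H; lia.
by rewrite /tape; elim: n lo => //= n IH lo; rewrite IH.
Qed.

Lemma tape_blank lo n : eqB [::] (tape lo n (fun=> [::])).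
Proof.
move=> i; rewrite nth_nil /tape; elim: n lo i => [|n IH] lo [|i] //=; exact: IH.
Qed.

Lemma eqB_cat a b b' : eqB b b' -> eqB (a ++ b) (a ++ b').
Proof. by move=> H n; rewrite !nth_cat H. Qed.

(** The tape needs no preparation: the input followed by blanks already is the tape with the input
    on stack 0 and all other stacks empty. The strict inequality pays for the move out of state
    0. *)
Theorem mach_run v t b : 0 < w ->
  fin (Go (iter t kstep ([:: c0], upd (fun => [::]) 0 v)).1) = Some b ->
  forall T, t * (4 * (size v + w + t) + 6) < T ->
  halted (cstate (run mach T v)) /\ (cstate (run mach T v) == 1) = b.
Proof.
move=> w0 Hb [//|T] HT; rewrite /run iterSr.
have Hc : [:: c0] \in conts by rewrite in_cons resid_head orbT.
apply: (iter_sim Hc w0 Hb); last by rewrite tape_len0.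
have E : eqB (map bit_sym v) (tape 0 w (upd (fun => [::]) 0 v)).
  rewrite tape_split //= -{1}(cats0 (map _ _)); apply: eqB_cat => -[|i] //=.
  by have := tape_blank 1 (w - 1) i; rewrite nth_nil.
rewrite /init; case: (map bit_sym v) E => [|x r] E; rewrite /step /=; split => //.
by move=> n; rewrite -E; case: n => [|[|n]].
Qed.
End Sim.

(** * Exact running times of stack programs *)

Inductive exec : cmd -> stacks -> stacks -> nat -> Prop :=
| ex_skip s : exec Skip s s 1
| ex_push j b s : exec (Push j b) s (upd s j (b :: s j)) 1
| ex_seq a b s1 s2 s3 t1 t2 : exec a s1 s2 t1 -> exec b s2 s3 t2 ->
    exec (CSeq a b) s1 s3 (t1 + t2).+1
| ex_case0 j c0 c1 ce s s' t : s j = [::] -> exec ce s s' t ->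
    exec (Case j c0 c1 ce) s s' t.+1
| ex_case j c0 c1 ce s s' t b v : s j = b :: v ->
    exec (if b then c1 else c0) (upd s j v) s' t -> exec (Case j c0 c1 ce) s s' t.+1
| ex_loop0 j c0 c1 s : s j = [::] -> exec (Loop j c0 c1) s s 1
| ex_loop j c0 c1 s s' s'' t t' b v : s j = b :: v ->
    exec (if b then c1 else c0) (upd s j v) s' t -> exec (Loop j c0 c1) s' s'' t' ->
    exec (Loop j c0 c1) s s'' (t + t').+1.

Lemma exec_kstep c s s' t : exec c s s' t ->
  forall k, iter t kstep (c :: k, s) = (k, s').
Proof.
elim=> {c s s' t} //.
- move=> a b s1 s2 s3 t1 t2 _ IH1 _ IH2 k.
  by rewrite iterSr /= addnC iterD IH1 IH2.
- by move=> j c0 c1 ce s s' t E _ IH k; rewrite iterSr /= E IH.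
- by move=> j c0 c1 ce s s' t b v E _ IH k; rewrite iterSr /= E IH.
- by move=> j c0 c1 s E k /=; rewrite E.
- move=> j c0 c1 s s' s'' t t' b v E _ IH _ IH' k.
  by rewrite iterSr /= E addnC iterD IH IH'.
Qed.

Lemma exec_size c s s' t : exec c s s' t -> forall j, size (s' j) <= size (s j) + t.
Proof.
elim=> {c s s' t} //.
- by move=> s j; lia.
- by move=> j b s i; rewrite /upd; case: eqP => [->|_] /=; lia.
- by move=> a b s1 s2 s3 t1 t2 _ IH1 _ IH2 j; move: (IH1 j) (IH2 j); lia.
- by move=> j c0 c1 ce s s' t _ _ IH i; move: (IH i); lia.
- move=> j c0 c1 ce s s' t b v E _ IH i; move: (IH i).
  by rewrite /upd; case: eqP => [->|_]; rewrite ?E /=; lia.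
- by move=> j c0 c1 s _ i; lia.
- move=> j c0 c1 s s' s'' t t' b v E _ IH _ IH' i; move: (IH i) (IH' i).
  by rewrite /upd; case: eqP => [->|_]; rewrite ?E /=; lia.
Qed.

(* Every step of the program also pushes a bit on stack kt. *)
Fixpoint tick (kt : nat) (c : cmd) : cmd :=
  let p := CSeq (Push kt true) in
  match c with
  | CSeq a b => p (CSeq (tick kt a) (tick kt b))
  | Case j c0 c1 ce => p (Case j (tick kt c0) (tick kt c1) (tick kt ce))
  | Loop j c0 c1 => p (Loop j (p (tick kt c0)) (p (tick kt c1)))
  | c => p c
  end.

Lemma exec_conv c s1 s2 s1' s2' t : exec c s1 s2 t -> s1 = s1' -> s2 = s2' ->
  exec c s1' s2' t.
Proof. by move=> H <- <-. Qed.

Ltac st := apply: functional_extensionality => ?; rewrite /upd;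
  repeat (case: eqP => ?; subst; try (by []); try (exfalso; lia)); try (by []).

Lemma ticks_cat t1 t2 (v : seq bool) :
  nseq t2 true ++ nseq t1 true ++ v = nseq (t1 + t2) true ++ v.
Proof. by rewrite catA -nseqD addnC. Qed.

Lemma ticks_cons t (v : seq bool) : nseq t true ++ true :: v = true :: nseq t true ++ v.
Proof. by rewrite (ticks_cat 1 t). Qed.

Lemma upd_neq s j v i : i <> j -> upd s j v i = s i.
Proof. by rewrite /upd; case: eqP. Qed.

Lemma upd_eq s j v : upd s j v j = v.
Proof. by rewrite /upd eqxx. Qed.

Ltac rd := repeat first [rewrite upd_eq | rewrite upd_neq; [|by lia]].
Ltac rdc Hc := rd; repeat (rewrite Hc; [|by lia]); rewrite ?cats0 ?revK.

Lemma upd_comm s i j u v : i <> j -> upd (upd s i u) j v = upd (upd s j v) i u.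
Proof. by move=> H; st. Qed.

(** Each rule of [exec] adds one step and each ticked construct one push. For a loop, the push in
    front of it pays for the final test, and the push in front of each body for that turn. *)
Lemma exec_tick kt c s s' t : exec c s s' t -> width c <= kt ->
  forall v, exists t', exec (tick kt c) (upd s kt v) (upd s' kt (nseq t true ++ v)) t'.
Proof.
have pushE v s0 : exec (Push kt true) (upd s0 kt v) (upd s0 kt (true :: v)) 1.
  by apply: (exec_conv (ex_push kt true (upd s0 kt v))) => //; st; rewrite /= eqxx.
elim=> {c s s' t}.
- move=> s _ v; exists 3; apply: (@ex_seq _ _ _ _ _ 1 1); first exact: pushE.
  exact: ex_skip.
- move=> j b s /= Hj v; exists 3; apply: (@ex_seq _ _ _ _ _ 1 1); first exact: pushE.
  apply: (exec_conv (ex_push j b _)) => //.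
  by rewrite upd_neq 1?upd_comm //; lia.
- move=> a b s1 s2 s3 t1 t2 _ IH1 _ IH2 /= Hw v.
  have [t1' H1] := IH1 ltac:(lia) (true :: v).
  have [t2' H2] := IH2 ltac:(lia) (nseq t1 true ++ true :: v).
  exists (1 + (t1' + t2').+1).+1; apply: ex_seq; first exact: (pushE v).
  by rewrite -ticks_cons -ticks_cat; apply: (ex_seq H1).
- move=> j c0 c1 ce s s' t E _ IH /= Hw v.
  have [t1 H1] := IH ltac:(lia) (true :: v).
  exists (1 + t1.+1).+1; apply: ex_seq; first exact: (pushE v).
  by rewrite -ticks_cons; apply: ex_case0 => //; rewrite upd_neq //; lia.
- move=> j c0 c1 ce s s' t b u E _ IH /= Hw v.
  have [t1 H1] := IH ltac:(case: (b); lia) (true :: v).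
  exists (1 + t1.+1).+1; apply: ex_seq; first exact: (pushE v).
  rewrite -ticks_cons; apply: (@ex_case _ _ _ _ _ _ _ b u).
    by rewrite upd_neq //; lia.
  by rewrite upd_comm; [case: (b) H1 | lia].
- move=> j c0 c1 s E /= Hw v.
  exists (1 + 1).+1; apply: ex_seq; first exact: (pushE v).
  by apply: ex_loop0; rewrite upd_neq //; lia.
- move=> j c0 c1 s s' s'' t t' b u E _ IH _ IH' /= Hw v.
  have [t1 H1] := IH ltac:(case: (b); lia) (true :: true :: v).
  have {IH'} [t2 H2] := IH' Hw (nseq t true ++ true :: v).
  (* [H2] runs the ticked rest of the loop including its leading push. Inversion exposes the bare
     ticked loop, and that leading push stands for the one made in front of the present body. *)
  inversion H2 as [| |a' b' r1 r2 r3 t3 t4 Hp Hl| | | |]; subst.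
  inversion Hp; subst; move: Hl => {H2 Hp} Hl.
  exists (1 + ((1 + t1).+1 + t4).+1).+1; apply: ex_seq; first exact: (pushE v).
  apply: (@ex_loop _ _ _ _ (upd s' kt (nseq t true ++ [:: true, true & v])) _ _ _ b u).
  + by rewrite upd_neq //; lia.
  + rewrite upd_comm; last by lia.
    have Hx : exec (CSeq (Push kt true) (tick kt (if b then c1 else c0)))
      (upd (upd s j u) kt (true :: v)) (upd s' kt (nseq t true ++ true :: true :: v)) (1 + t1).+1.
      by apply: ex_seq H1; apply: pushE.
    by case: (b) Hx => Hx; apply: Hx.
  + apply: (exec_conv Hl).
      by st; rewrite /= ?eqxx !ticks_cons.
    by rewrite -ticks_cons ticks_cat.
Qed.

Lemma exec_to c s s2 s2' t : exec c s s2 t -> s2 = s2' -> exec c s s2' t.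
Proof. by move=> H <-. Qed.

(** * Stack macros *)

Definition mv j j' := Loop j (Push j' false) (Push j' true).

Lemma exec_mv j j' s : j <> j' ->
  exec (mv j j') s (upd (upd s j [::]) j' (rev (s j) ++ s j')) (2 * size (s j)).+1.
Proof.
move=> Hj; move Ev: (s j) => v; elim: v s Ev => [|b v IH] s E /=.
  by apply: (exec_conv (ex_loop0 _ _ E)) => //; st.
have -> : (2 * (size v).+1).+1 = (1 + (2 * size v).+1).+1 by lia.
apply: (@ex_loop _ _ _ _ _ _ _ _ b v) => //.
  by case: b {E}; apply: ex_push.
apply: (exec_conv (IH (upd (upd s j v) j' (b :: upd s j v j')) _)) => //.
  by rewrite upd_neq ?upd_eq.
have Hj' : j' <> j by lia.
by rewrite upd_eq (upd_neq _ _ Hj') rev_cons cat_rcons; st.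
Qed.

Definition clr j := Loop j Skip Skip.

Lemma exec_clr j s : exec (clr j) s (upd s j [::]) (2 * size (s j)).+1.
Proof.
move Ev: (s j) => v; elim: v s Ev => [|b v IH] s E /=.
  by apply: (exec_conv (ex_loop0 _ _ E)) => //; st.
have -> : (2 * (size v).+1).+1 = (1 + (2 * size v).+1).+1 by lia.
apply: (@ex_loop _ _ _ _ _ _ _ _ b v) => //.
  by case: b {E}; apply: ex_skip.
by apply: (exec_conv (IH (upd s j v) _)); rewrite ?upd_eq //; st.
Qed.

Definition cp j j' t :=
  CSeq (mv j t) (Loop t (CSeq (Push j false) (Push j' false)) (CSeq (Push j true) (Push j' true))).

Lemma exec_cp_loop j j' t s : j <> j' -> j <> t -> j' <> t ->
  exec (Loop t (CSeq (Push j false) (Push j' false)) (CSeq (Push j true) (Push j' true))) s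
    (upd (upd (upd s t [::]) j (rev (s t) ++ s j)) j' (rev (s t) ++ s j')) (4 * size (s t)).+1.
Proof.
move=> H1 H2 H3; move Ev: (s t) => v; elim: v s Ev => [|b v IH] s E /=.
  by apply: (exec_conv (ex_loop0 _ _ E)) => //; st.
have -> : (4 * (size v).+1).+1 = ((1 + 1).+1 + (4 * size v).+1).+1 by lia.
apply: (@ex_loop _ _ _ _ _ _ _ _ b v) => //.
  have H b' : exec (CSeq (Push j b') (Push j' b')) (upd s t v)
    (upd (upd (upd s t v) j (b' :: s j)) j' (b' :: s j')) (1 + 1).+1.
    apply: ex_seq; first exact: ex_push.
    by apply: (exec_to (ex_push _ _ _)) => //; st; rewrite ?eqxx.
  by case: b {E}; apply: H.
apply: (exec_conv (IH (upd (upd (upd s t v) j (b :: s j)) j' (b :: s j')) _)) => //.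
  by rd.
by st; rewrite rev_cons cat_rcons.
Qed.

Lemma exec_convt c s1 s2 s1' s2' t t' : exec c s1 s2 t -> s1 = s1' -> s2 = s2' -> t = t' ->
  exec c s1' s2' t'.
Proof. by move=> H <- <- <-. Qed.

Lemma exec_cp j j' t s : j <> j' -> j <> t -> j' <> t -> s j' = [::] -> s t = [::] ->
  exec (cp j j' t) s (upd s j' (s j)) (6 * size (s j) + 3).
Proof.
move=> H1 H2 H3 E1 E2.
have -> : 6 * size (s j) + 3 = ((2 * size (s j)).+1 + (4 * size (s j)).+1).+1 by lia.
apply: ex_seq; first exact: exec_mv.
apply: (exec_convt (exec_cp_loop _ H1 H2 H3)) => //.
  by rd; rewrite E1 E2 !cats0 revK; st.
by rewrite upd_eq E2 cats0 size_rev.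
Qed.

Definition app j j' t := CSeq (mv j t) (mv t j').

Lemma exec_app j j' t s : j <> j' -> j <> t -> j' <> t -> s t = [::] ->
  exec (app j j' t) s (upd (upd s j [::]) j' (s j ++ s j')) (4 * size (s j) + 3).
Proof.
move=> H1 H2 H3 E2.
have -> : 4 * size (s j) + 3 = ((2 * size (s j)).+1 + (2 * size (s j)).+1).+1 by lia.
apply: ex_seq; first exact: exec_mv.
have H32 : t <> j' by move=> E; rewrite E in H3.
apply: (exec_convt (exec_mv _ H32)) => //; rewrite upd_eq E2 cats0 ?size_rev //.
by rewrite revK; st.
Qed.

Fixpoint pushes j (v : seq bool) :=
  if v is b :: v' then CSeq (pushes j v') (Push j b) else Skip.

Lemma exec_pushes j v s : exec (pushes j v) s (upd s j (v ++ s j)) (2 * size v).+1.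
Proof.
elim: v s => [|b v IH] s /=; first by apply: (exec_conv (ex_skip s)) => //; st.
have -> : (2 * (size v).+1).+1 = ((2 * size v).+1 + 1).+1 by lia.
apply: ex_seq; first exact: IH.
by apply: (exec_to (ex_push _ _ _)) => //; st; rewrite ?eqxx.
Qed.

Inductive tree := Lf | Nd of tree & tree.

(** A prefix code: the end of a tree is recognised while reading, so several values can lie on one
    stack without separators, and pairing is one bit followed by two codes. *)
Fixpoint code (t : tree) : seq bool :=
  match t with Lf => [:: false] | Nd a b => true :: code a ++ code b end.

Lemma code_cat_inj a b u v : code a ++ u = code b ++ v -> a = b /\ u = v.
Proof.
elim: a b u v => [|a1 IH1 a2 IH2] [|b1 b2] u v //= -[] //.
by rewrite -!catA => /IH1[-> /IH2[-> ->]].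
Qed.

Lemma code_inj : injective code.
Proof. by move=> a b E; case: (@code_cat_inj a b [::] [::]); rewrite ?cats0. Qed.

(* Moves the first tree of stack j, reversed, to stack j'; stack jc counts the subtrees that remain to be read. *)
Definition split j j' jc :=
  CSeq (Push jc true)
  (Loop jc Skip (Case j (Push j' false) (CSeq (Push j' true) (CSeq (Push jc true) (Push jc true))) Skip)).

Fixpoint scost t := match t with Lf => 3 | Nd a b => 7 + scost a + scost b end.

Lemma scost_le t : scost t <= 7 * size (code t).
Proof. by elim: t => //= a IHa b IHb; rewrite size_cat; lia. Qed.

(** Stated backwards, from a run after the tree has been read to a run before it, with the times
    added. In this form the two subtrees of a node are handled by chaining the induction
    hypotheses. *)
Lemma split_loop j j' jc t n r acc s s' T : j <> j' -> j <> jc -> j' <> jc ->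
  let L := Loop jc Skip (Case j (Push j' false) (CSeq (Push j' true) (CSeq (Push jc true) (Push jc true))) Skip) in
  exec L (upd (upd (upd s j r) j' (rev (code t) ++ acc)) jc (nseq n true)) s' T ->
  exec L (upd (upd (upd s j (code t ++ r)) j' acc) jc (nseq n.+1 true)) s' (scost t + T).
Proof.
move=> H1 H2 H3 L; elim: t n r acc T => [|a IHa b IHb] n r acc T /= H.
  have -> : 3 + T = (2 + T).+1 by [].
  apply: (@ex_loop _ _ _ _ _ _ _ _ true (nseq n true)); first by rewrite upd_eq.
    apply: (@ex_case _ _ _ _ _ _ _ false r).
      by rd.
    exact: ex_push.
  apply: (exec_conv H) => //; st; rewrite /= ?eqxx //.
have -> : 7 + scost a + scost b + T = (6 + (scost a + (scost b + T))).+1 by lia.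
apply: (@ex_loop _ _ _ _ _ _ _ _ true (nseq n true)); first by rewrite upd_eq.
  apply: (@ex_case _ _ _ _ _ _ 5 true (code a ++ code b ++ r)).
    by rd; rewrite ?catA.
  apply: (@ex_seq _ _ _ _ _ 1 3); first exact: ex_push.
  apply: (@ex_seq _ _ _ _ _ 1 1); exact: ex_push.
set s1 := (X in exec _ X _ _).
have -> : s1 = upd (upd (upd s j (code a ++ (code b ++ r))) j' (true :: acc)) jc (nseq n.+2 true).
  by rewrite /s1; st; rewrite /= ?eqxx //.
apply: IHa; apply: IHb; apply: (exec_conv H) => //.
by st; rewrite rev_cons rev_cat cat_rcons catA.
Qed.

Lemma exec_split j j' jc t r s : j <> j' -> j <> jc -> j' <> jc ->
  s j = code t ++ r -> s jc = [::] ->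
  exec (split j j' jc) s (upd (upd s j r) j' (rev (code t) ++ s j')) (scost t + 3).
Proof.
move=> H1 H2 H3 E Ec; have -> : scost t + 3 = (1 + (scost t + 1)).+1 by lia.
apply: ex_seq; first exact: ex_push.
apply: (exec_conv (@split_loop j j' jc t 0 r (s j') s
  (upd (upd (upd s j r) j' (rev (code t) ++ s j')) jc [::]) 1 H1 H2 H3 _)).
- by apply: ex_loop0; rewrite upd_eq.
- by st; rewrite ?Ec.
- by st.
Qed.

Lemma exec_tot c s s2 s2' t t' : exec c s s2 t -> s2 = s2' -> t = t' -> exec c s s2' t'.
Proof. by move=> H <- <-. Qed.

(** * Functions computed by stack programs *)

Class Enc (A : Type) := { E : A -> tree; E_inj : injective E }.

Definition sz A {e : Enc A} (a : A) := size (code (E a)).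

Definition clean i (s : stacks) := forall j, i < j -> s j = [::].

(* The time may depend on the argument only: neither on the stacks below i nor on i. *)
Definition ccomp A B {eA : Enc A} {eB : Enc B} (f : A -> B) (bd : A -> nat) :=
  exists P : nat -> cmd, forall a, exists2 t, t <= bd a & forall i s,
    s i = code (E a) -> clean i s -> exec (P i) s (upd s i (code (E (f a)))) t.

Lemma ccomp_eq A B {eA : Enc A} {eB : Enc B} (f g : A -> B) bd : f =1 g -> ccomp f bd -> ccomp g bd.
Proof. by move=> H [P HP]; exists P => a; have [t ? Ht] := HP a; exists t; rewrite -?H. Qed.

(** A step writes at most one cell, so a time bound also bounds the size of the result; this
    controls the intermediate values of compositions. *)
Lemma ccomp_size A B {eA : Enc A} {eB : Enc B} (f : A -> B) bd a : ccomp f bd ->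
  sz (f a) <= sz a + bd a.
Proof.
case=> P HP; have [t Ht Hx] := HP a.
have Hc : clean 0 (upd (fun=> [::]) 0 (code (E a))) by case.
have := exec_size (Hx 0 _ (upd_eq _ _ _) Hc) 0; rewrite !upd_eq /sz; lia.
Qed.

Ltac st2 Hc := apply: functional_extensionality => ?; rewrite /upd;
  repeat (case: eqP => ?; subst; try (by []); try (exfalso; lia));
  try (by []); try (by rewrite Hc //; lia); try (by symmetry; rewrite Hc //; lia).

Lemma clean_upd i j s v : clean i s -> j <= i -> clean i (upd s j v).
Proof. by move=> H Hj k Hk; rewrite upd_neq ?H //; lia. Qed.

Lemma cleanS i s : clean i s -> clean i.+1 s.
Proof. by move=> H j Hj; apply: H; lia. Qed.

Lemma clean_updS i s v : clean i s -> clean i.+1 (upd s i.+1 v).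
Proof. by move=> H; apply: clean_upd => //; apply: cleanS. Qed.

Lemma ccomp_id A {eA : Enc A} : ccomp (fun a : A => a) (fun => 1).
Proof.
exists (fun => Skip) => a; exists 1 => // i s Hi _.
by apply: (exec_conv (ex_skip _)) => //; st.
Qed.

Lemma ccomp_coerce A B {eA : Enc A} {eB : Enc B} (f : A -> B) :
  (forall a, E (f a) = E a) -> ccomp f (fun => 1).
Proof.
move=> H; exists (fun => Skip) => a; exists 1 => // i s Hi _.
by apply: (exec_conv (ex_skip _)) => //; st; rewrite H.
Qed.

Lemma ccomp_comp A B C {eA : Enc A} {eB : Enc B} {eC : Enc C} (f : A -> B) (g : B -> C) bf bg :
  ccomp f bf -> ccomp g bg -> ccomp (fun a => g (f a)) (fun a => (bf a + bg (f a)).+1).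
Proof.
move=> [P HP] [Q HQ]; exists (fun i => CSeq (P i) (Q i)) => a.
have [t1 L1 H1] := HP a; have [t2 L2 H2] := HQ (f a).
exists (t1 + t2).+1 => [|i s Hi Hc]; first by lia.
apply: ex_seq; first exact: H1.
apply: (exec_to (H2 i _ _ _)) => //; first by rewrite upd_eq.
  exact: clean_upd.
by st.
Qed.

Lemma ccomp_const A B {eA : Enc A} {eB : Enc B} (b : B) :
  ccomp (fun _ : A => b) (fun a => 2 * sz a + 2 * sz b + 3).
Proof.
exists (fun i => CSeq (clr i) (pushes i (code (E b)))) => a.
eexists; last first.
  move=> i s Hi Hc; apply: (@ex_seq _ _ _ (upd s i [::]) _ (2 * sz a).+1).
    by rewrite /sz -Hi; apply: exec_clr.
  apply: (exec_conv (exec_pushes _ _ _)) => //.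
  by rewrite upd_eq cats0; st.
by rewrite /sz; lia.
Qed.

#[global] Instance enc_pair A B {eA : Enc A} {eB : Enc B} : Enc (A * B).
Proof.
exists (fun p => Nd (E p.1) (E p.2)).
by move=> [a b] [c d] /= [Ha Hb]; rewrite (E_inj Ha) (E_inj Hb).
Defined.

Lemma sz_pair A B {eA : Enc A} {eB : Enc B} (a : A) (b : B) : sz (a, b) = (sz a + sz b).+1.
Proof. by rewrite /sz /= size_cat. Qed.

Lemma ccomp_pair A B C {eA : Enc A} {eB : Enc B} {eC : Enc C} (f : A -> B) (g : A -> C) bf bg :
  ccomp f bf -> ccomp g bg ->
  ccomp (fun a => (f a, g a)) (fun a => bf a + bg a + 14 * sz a + 4 * sz (f a) + 4 * sz (g a) + 30).
Proof.
move=> [P HP] [Q HQ].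
exists (fun i => CSeq (cp i i.+1 i.+2) (CSeq (P i.+1) (CSeq (cp i i.+2 i.+3)
  (CSeq (Q i.+2) (CSeq (clr i) (CSeq (app i.+2 i i.+3) (CSeq (app i.+1 i i.+2) (Push i true)))))))) => a.
have [t1 L1 H1] := HP a; have [t2 L2 H2] := HQ a.
eexists; last first.
  move=> i s Hi Hc.
  apply: (@ex_seq _ _ _ (upd s i.+1 (code (E a))) _ (6 * sz a + 3)).
    rewrite /sz -Hi; apply: exec_cp; try lia; apply: Hc; lia.
  apply: (@ex_seq _ _ _ (upd s i.+1 (code (E (f a))))).
    apply: (exec_to (H1 i.+1 _ _ _)) => //; [by rewrite upd_eq|exact: clean_updS|by st].
  apply: (@ex_seq _ _ _ (upd (upd s i.+1 (code (E (f a)))) i.+2 (code (E a))) _ (6 * sz a + 3)).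
    have Ei : upd s i.+1 (code (E (f a))) i = code (E a) by rd.
    rewrite /sz -Ei; apply: exec_cp; try lia; by rdc Hc.
  apply: (@ex_seq _ _ _ (upd (upd s i.+1 (code (E (f a)))) i.+2 (code (E (g a))))).
    apply: (exec_to (H2 i.+2 _ _ _)) => //; [by rewrite upd_eq| |by st].
    by apply/clean_updS/clean_updS.
  apply: (@ex_seq _ _ _ (upd (upd (upd s i [::]) i.+1 (code (E (f a)))) i.+2 (code (E (g a)))) _ (2 * sz a).+1).
    by rewrite /sz -Hi; apply: (exec_tot (exec_clr _ _)) => //; [st|rd].
  apply: (@ex_seq _ _ _ (upd (upd s i (code (E (g a)))) i.+1 (code (E (f a)))) _ (4 * sz (g a) + 3)).
    apply: (exec_tot (exec_app _ _ _ _)) => //; try lia.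
    + by rdc Hc.
    + by rdc Hc; st2 Hc.
    + by rewrite upd_eq.
  apply: (@ex_seq _ _ _ (upd s i (code (E (f a)) ++ code (E (g a)))) _ (4 * sz (f a) + 3)).
    apply: (exec_tot (exec_app _ _ _ _)) => //; try lia.
    + by rdc Hc.
    + by rdc Hc; st2 Hc.
    + by rewrite upd_eq.
  by apply: (exec_to (ex_push _ _ _)) => //; st; rewrite eqxx.
rewrite /=; lia.
Qed.

Lemma ccomp_fst A B {eA : Enc A} {eB : Enc B} :
  ccomp (fun p : A * B => p.1) (fun p => 15 * sz p + 10).
Proof.
exists (fun i => Case i Skip (CSeq (split i i.+1 i.+2) (CSeq (clr i) (mv i.+1 i))) Skip) => -[a b].
eexists; last first.
  move=> i s Hi Hc.
  apply: (@ex_case _ _ _ _ _ _ _ true (code (E a) ++ code (E b))) => //.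
  apply: ex_seq.
    apply: (@exec_split _ _ _ (E a) (code (E b))); try lia; first by rewrite upd_eq.
    by rdc Hc.
  apply: (@ex_seq _ _ _ (upd (upd s i [::]) i.+1 (rev (code (E a)))) _ (2 * sz b).+1).
    apply: (exec_tot (exec_clr _ _)) => //.
      by rdc Hc; st2 Hc.
    by rd.
  have Hne : i.+1 <> i by lia.
  apply: (exec_tot (t' := (2 * sz a).+1) (exec_mv _ Hne)) => //.
    by rdc Hc; st2 Hc.
  by rewrite upd_eq size_rev.
have := scost_le (@E _ eA a); rewrite sz_pair -/(sz a); lia.
Qed.

Lemma ccomp_snd A B {eA : Enc A} {eB : Enc B} :
  ccomp (fun p : A * B => p.2) (fun p => 15 * sz p + 10).
Proof.
exists (fun i => Case i Skip (CSeq (split i i.+1 i.+2) (clr i.+1)) Skip) => -[a b].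
eexists; last first.
  move=> i s Hi Hc.
  apply: (@ex_case _ _ _ _ _ _ _ true (code (E a) ++ code (E b))) => //.
  apply: ex_seq.
    apply: (@exec_split _ _ _ (E a) (code (E b))); try lia; first by rewrite upd_eq.
    by rdc Hc.
  apply: (@exec_tot _ _ _ _ _ (2 * sz a).+1 (exec_clr _ _)) => //.
    by st2 Hc.
  by rdc Hc; rewrite size_rev.
have := scost_le (@E _ eA a); rewrite sz_pair -/(sz a); lia.
Qed.

#[global] Instance enc_bool : Enc bool.
Proof. by exists (fun b : bool => if b then Nd Lf Lf else Lf); case; case. Defined.

#[global] Instance enc_seq A {eA : Enc A} : Enc (seq A).
Proof.
exists (fix F s := if s is a :: s' then Nd (E a) (F s') else Lf).
by elim=> [|a s IH] [|b t] //= [Ha H]; rewrite (E_inj Ha) (IH t).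
Defined.

(** A unary code. It makes arithmetic easy where time is not bounded; in the polynomial part the
    numbers of the input remain lists of bits. *)
#[global] Instance enc_nat_ : Enc nat.
Proof.
exists (fix F n := if n is n'.+1 then Nd Lf (F n') else Lf).
by elim=> [|n IH] [|m] //= [H]; rewrite (IH m).
Defined.

Lemma sz_cons A {eA : Enc A} (a : A) s : sz (a :: s) = (sz a + sz s).+1.
Proof. by rewrite /sz /= size_cat. Qed.

Lemma sz_nil A {eA : Enc A} : sz (@nil A) = 1.
Proof. by []. Qed.

Lemma ccomp_if A B {eA : Enc A} {eB : Enc B} (c : A -> bool) (f g : A -> B) bc bf bg :
  ccomp c bc -> ccomp f bf -> ccomp g bg ->
  ccomp (fun a => if c a then f a else g a) (fun a => bc a + bf a + bg a + 6 * sz a + 20).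
Proof.
move=> [P HP] [Q HQ] [R HR].
exists (fun i => CSeq (cp i i.+1 i.+2) (CSeq (P i.+1)
  (Case i.+1 (R i) (CSeq (clr i.+1) (Q i)) Skip))) => a.
have [t1 L1 H1] := HP a; have [t2 L2 H2] := HQ a; have [t3 L3 H3] := HR a.
exists ((6 * sz a + 3) + (t1 + (if c a then (5 + t2).+1 else t3).+1).+1).+1.
  by case: (c a); lia.
move=> i s Hi Hc.
apply: (@ex_seq _ _ _ (upd s i.+1 (code (E a))) _ (6 * sz a + 3)).
  rewrite /sz -Hi; apply: exec_cp; try lia; apply: Hc; lia.
apply: (@ex_seq _ _ _ (upd s i.+1 (code (E (c a))))).
  apply: (exec_to (H1 i.+1 _ _ _)) => //; [by rewrite upd_eq|exact: clean_updS|by st].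
case Ec: (c a).
  apply: (@ex_case _ _ _ _ _ _ _ true [:: false; false]); first by rewrite upd_eq.
  apply: (@ex_seq _ _ _ s); last by apply: H2.
  apply: (exec_tot (exec_clr _ _)) => //; first by st2 Hc.
  by rewrite upd_eq.
apply: (@ex_case _ _ _ _ _ _ _ false [::]); first by rewrite upd_eq.
apply: (exec_conv (H3 i s _ _)) => //; first by st2 Hc.
Qed.

Lemma ccomp_case A B C {eA : Enc A} {eB : Enc B} {eC : Enc C} (f : A -> seq B) (g : A -> C)
    (h : A * (B * seq B) -> C) bf bg bh :
  ccomp f bf -> ccomp g bg -> ccomp h bh ->
  ccomp (fun a => if f a is b :: s then h (a, (b, s)) else g a)
    (fun a => bf a + bg a + (if f a is b :: s then bh (a, (b, s)) else 0) + 10 * sz a + 4 * sz (f a) + 30).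
Proof.
move=> [P HP] [Q HQ] [R HR].
exists (fun i => CSeq (cp i i.+1 i.+2) (CSeq (P i.+1)
  (Case i.+1 (Q i) (CSeq (Push i.+1 true) (CSeq (mv i i.+2) (CSeq (app i.+1 i i.+3)
    (CSeq (mv i.+2 i) (CSeq (Push i true) (R i)))))) Skip))) => a.
have [t1 L1 H1] := HP a; have [t2 L2 H2] := HQ a.
case Ef: (f a) => [|b v].
  exists ((6 * sz a + 3) + (t1 + t2.+1).+1).+1; first by lia.
  move=> i s Hi Hc.
  apply: (@ex_seq _ _ _ (upd s i.+1 (code (E a))) _ (6 * sz a + 3)).
    rewrite /sz -Hi; apply: exec_cp; try lia; apply: Hc; lia.
  apply: (@ex_seq _ _ _ (upd s i.+1 (code (E (f a))))).
    apply: (exec_to (H1 i.+1 _ _ _)) => //; [by rewrite upd_eq|exact: clean_updS|by st].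
  apply: (@ex_case _ _ _ _ _ _ _ false [::]); first by rewrite upd_eq Ef.
  by apply: (exec_conv (H2 i s _ _)) => //; st2 Hc.
have [t3 L3 H3] := HR (a, (b, v)).
eexists; last first.
  move=> i s Hi Hc.
  apply: (@ex_seq _ _ _ (upd s i.+1 (code (E a))) _ (6 * sz a + 3)).
    rewrite /sz -Hi; apply: exec_cp; try lia; apply: Hc; lia.
  apply: (@ex_seq _ _ _ (upd s i.+1 (code (E (f a))))).
    apply: (exec_to (H1 i.+1 _ _ _)) => //; [by rewrite upd_eq|exact: clean_updS|by st].
  apply: (@ex_case _ _ _ _ _ _ _ true (code (E b) ++ code (E v))); first by rewrite upd_eq Ef.
  apply: (@ex_seq _ _ _ (upd s i.+1 (code (E (b, v))))).
    by apply: (exec_to (ex_push _ _ _)) => //; st; rewrite eqxx.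
  apply: (@ex_seq _ _ _ (upd (upd (upd s i [::]) i.+1 (code (E (b, v)))) i.+2 (rev (code (E a)))) _ (2 * sz a).+1).
    apply: (exec_tot (exec_mv _ _)) => //; try lia.
      by rd; rewrite ?Hi; rdc Hc; st2 Hc.
    by rd; rewrite ?Hi.
  apply: (@ex_seq _ _ _ (upd (upd s i (code (E (b, v)))) i.+2 (rev (code (E a)))) _ (4 * sz (b, v) + 3)).
    apply: (exec_tot (exec_app _ _ _ _)) => //; try lia.
    + by rdc Hc.
    + by rdc Hc; st2 Hc.
    + by rd.
  apply: (@ex_seq _ _ _ (upd s i (code (E a) ++ code (E (b, v)))) _ (2 * sz a).+1).
    apply: (exec_tot (exec_mv _ _)) => //; try lia.
      by rdc Hc; st2 Hc.
    by rewrite upd_eq size_rev.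
  apply: (@ex_seq _ _ _ (upd s i (code (E (a, (b, v)))))).
    by apply: (exec_to (ex_push _ _ _)) => //; st; rewrite eqxx.
  apply: (exec_to (H3 i _ _ _)) => //; [by rewrite upd_eq|exact: clean_upd|by st].
by rewrite sz_cons sz_pair; lia.
Qed.

Fixpoint fcost S B {eS : Enc S} {eB : Enc B} (g : B * S -> S) (bg : B * S -> nat) s (l : seq B) :=
  if l is b :: l' then 9 * sz b + bg (b, s) + 30 + fcost g bg (g (b, s)) l' else 0.

(** In the code of a list a bit [true] announces an element and a last [false] ends the list. A
    [Loop] on the stack of the list thus pops the announcing bit, and its body removes the
    element. *)
Definition fbody Q i := CSeq (split i i.+2 i.+3)
     (CSeq (mv i.+2 i.+1) (CSeq (Push i.+1 true) (Q i.+1))).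

Lemma foldl_loop S B {eS : Enc S} {eB : Enc B} (g : B * S -> S) bg Q :
  (forall a, exists2 t, t <= bg a & forall i s,
    s i = code (E a) -> clean i s -> exec (Q i) s (upd s i (code (E (g a)))) t) ->
  forall (l : seq B) (s0 : S), exists2 t, t <= fcost g bg s0 l + 3 & forall i s,
    s i = code (E l) -> s i.+1 = code (E s0) -> clean i.+1 s ->
    exec (Loop i Skip (fbody Q i)) s
      (upd (upd s i [::]) i.+1 (code (E (foldl (fun s b => g (b, s)) s0 l)))) t.
Proof.
move=> HQ; elim=> [|b l IH] s0.
  exists (1 + 1).+1 => // i s Hi Hi1 Hc.
  apply: (@ex_loop _ _ _ _ _ _ _ _ false [::]) => //; first exact: ex_skip.
  apply: (exec_conv (@ex_loop0 i _ _ (upd s i [::]) _)); rewrite ?upd_eq //.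
  by rewrite /= -Hi1; st.
have [t1 L1 H1] := IH (g (b, s0)); have [t2 L2 H2] := HQ (b, s0).
eexists; last first.
  move=> i s Hi Hi1 Hc.
  apply: (@ex_loop _ _ _ _ _ _ _ _ true (code (E b) ++ code (E l))) => //.
    apply: ex_seq.
      apply: (@exec_split _ _ _ (E b) (code (E l))); try lia; first by rewrite upd_eq.
      by rdc Hc.
    apply: (@ex_seq _ _ _ (upd (upd s i (code (E l))) i.+1 (code (E b) ++ code (E s0))) _ (2 * sz b).+1).
      apply: (exec_tot (exec_mv _ _)) => //; try lia.
        by rd; rewrite ?Hi1; rdc Hc; st2 Hc.
      by rdc Hc; rewrite size_rev.
    apply: (@ex_seq _ _ _ (upd (upd s i (code (E l))) i.+1 (code (E (b, s0))))).
      by apply: (exec_to (ex_push _ _ _)) => //; st; rewrite eqxx.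
    apply: (exec_to (H2 i.+1 _ _ _)) => //; first by rewrite upd_eq.
    by apply: clean_upd => //; apply: clean_upd.
  apply: (exec_to (H1 i _ _ _ _)) => //; last by st.
  - by rd.
  - by rewrite upd_eq.
  - by do 3 (apply: clean_upd => //).
have := scost_le (@E _ eB b); rewrite /= -/(sz b); lia.
Qed.

Lemma ccomp_foldl S B {eS : Enc S} {eB : Enc B} (g : B * S -> S) bg :
  ccomp g bg ->
  ccomp (fun x : S * seq B => foldl (fun s b => g (b, s)) x.1 x.2)
   (fun x => fcost g bg x.1 x.2 + 20 * sz x + 20 * sz (foldl (fun s b => g (b, s)) x.1 x.2) + 30).
Proof.
move=> [Q HQ].
exists (fun i => Case i Skip (CSeq (split i i.+2 i.+3) (CSeq (mv i.+2 i.+1)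
   (CSeq (Loop i Skip (fbody Q i)) (app i.+1 i i.+2)))) Skip) => -[s0 l].
have [t L H] := foldl_loop HQ l s0.
eexists; last first.
  move=> i s Hi Hc.
  apply: (@ex_case _ _ _ _ _ _ _ true (code (E s0) ++ code (E l))) => //.
  apply: ex_seq.
    apply: (@exec_split _ _ _ (E s0) (code (E l))); try lia; first by rewrite upd_eq.
    by rdc Hc.
  apply: (@ex_seq _ _ _ (upd (upd s i (code (E l))) i.+1 (code (E s0))) _ (2 * sz s0).+1).
    apply: (exec_tot (exec_mv _ _)) => //; try lia.
      by rdc Hc; st2 Hc.
    by rdc Hc; rewrite size_rev.
  apply: ex_seq.
    apply: H; rewrite ?upd_eq //; first by rd.
    by do 2 (apply: clean_upd; last by lia); apply: cleanS.
  set r := foldl _ _ _.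
  apply: (exec_tot (exec_app _ _ _ _) (t' := 4 * sz r + 3)) => //; try lia.
  + by rdc Hc.
  + by rdc Hc; st2 Hc.
  + by rewrite upd_eq.
by have := scost_le (@E _ eS s0); rewrite sz_pair /= -/(sz s0); lia.
Qed.

(** A loop cannot be left early, so every mismatch leaves a mark on stack [i.+3]; the strings are
    equal iff that stack stays empty. [ndiff] is the number of marks. *)
Definition cmpb i := CSeq
  (Loop i.+1 (Case i.+2 Skip (Push i.+3 true) (Push i.+3 true))
             (Case i.+2 (Push i.+3 true) Skip (Push i.+3 true)))
  (Loop i.+2 (Push i.+3 true) (Push i.+3 true)).

Fixpoint ndiff (u v : seq bool) : nat :=
  match u, v with
  | [::], _ => size v
  | _ :: u', [::] => (ndiff u' [::]).+1
  | a :: u', b :: v' => (a != b) + ndiff u' v'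
  end.

Lemma ndiff_nil u : ndiff u [::] = size u.
Proof. by elim: u => //= a u ->. Qed.

Lemma ndiff_eq u v : (ndiff u v == 0) = (u == v).
Proof.
elim: u v => [|a u IH] [|b v] //=.
by rewrite addn_eq0 IH eqseq_cons; case: a; case: b.
Qed.

Lemma ndiff_le u v : ndiff u v <= size u + size v.
Proof. by elim: u v => [|a u IH] [|b v] //=; [rewrite ndiff_nil addn0|have := IH v; case: eqP; lia]. Qed.

Lemma exec_cmpb u v : exists2 t, t <= 5 * (size u + size v) + 6 & forall i s n,
  s i.+1 = u -> s i.+2 = v -> s i.+3 = nseq n true ->
  exec (cmpb i) s (upd (upd (upd s i.+1 [::]) i.+2 [::]) i.+3 (nseq (ndiff u v + n) true)) t.
Proof.
have H2 w : exists2 t, t <= 2 * size w + 1 & forall i s n,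
    s i.+2 = w -> s i.+3 = nseq n true ->
    exec (Loop i.+2 (Push i.+3 true) (Push i.+3 true)) s
     (upd (upd s i.+2 [::]) i.+3 (nseq (size w + n) true)) t.
  elim: w => [|b w [t L IH]].
    exists 1 => // i s n E1 E2; apply: (exec_conv (ex_loop0 _ _ E1)) => //.
    by rewrite /= -E2 -E1; st.
  exists (1 + t).+1; first by rewrite /=; lia.
  move=> i s n E1 E2; apply: (@ex_loop _ _ _ _ _ _ _ _ b w) => //.
    by rewrite if_same; apply: ex_push.
  apply: (exec_conv (IH i _ n.+1 _ _)) => //.
  - by rd.
  - by rd; rewrite E2.
  - by rewrite /= -addSnnS; st.
have H1 : exists2 t, t <= 3 * (size u + size v) + 1 & forall i s n,
    s i.+1 = u -> s i.+2 = v -> s i.+3 = nseq n true ->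
    exists n', n' + size (drop (size u) v) = ndiff u v + n /\
    exec (Loop i.+1 (Case i.+2 Skip (Push i.+3 true) (Push i.+3 true))
             (Case i.+2 (Push i.+3 true) Skip (Push i.+3 true))) s
     (upd (upd (upd s i.+1 [::]) i.+2 (drop (size u) v)) i.+3 (nseq n' true)) t.
  elim: u v => [|a u IH] v.
    exists 1 => [|i s n E1 E2 E3]; first by lia.
    exists n; split; first by rewrite drop0 /= addnC.
    apply: (exec_conv (ex_loop0 _ _ E1)) => //.
    by rewrite drop0 -E1 -E2 -E3; st.
  have [t L {}IH] := IH (behead v).
  exists (2 + t).+1; first by rewrite size_behead in L; rewrite /=; lia.
  move=> i s n E1 E2 E3; case: v E2 IH L => [|b v] E2 /= IH L.
    have [|||n' [Hn' He]] := IH i (upd (upd s i.+1 u) i.+3 (nseq n.+1 true)) n.+1.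
    + by rd.
    + by rd; rewrite E2.
    + by rewrite upd_eq.
    exists n'; split; first by rewrite Hn'; lia.
    apply: (@ex_loop _ _ _ _ (upd (upd s i.+1 u) i.+3 (nseq n.+1 true)) _ _ _ a u) => //.
      have Hp : exec (Push i.+3 true) (upd s i.+1 u) (upd (upd s i.+1 u) i.+3 (nseq n.+1 true)) 1.
        by apply: (exec_to (ex_push _ _ _)); rd; rewrite E3.
      by case: (a); apply: ex_case0 Hp; rd; rewrite E2.
    by apply: (exec_conv He) => //; st.
  have [|||n' [Hn' He]] := IH i (upd (upd (upd s i.+1 u) i.+2 v) i.+3 (nseq ((a != b) + n) true)) ((a != b) + n).
  + by rd.
  + by rd.
  + by rewrite upd_eq.
  exists n'; split; first by rewrite Hn'; lia.
  apply: (@ex_loop _ _ _ _ (upd (upd (upd s i.+1 u) i.+2 v) i.+3 (nseq ((a != b) + n) true)) _ _ _ a u) => //.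
    have Hp : exec (if a == b then Skip else Push i.+3 true) (upd (upd s i.+1 u) i.+2 v)
        (upd (upd (upd s i.+1 u) i.+2 v) i.+3 (nseq ((a != b) + n) true)) 1.
      case: eqP => _; first by apply: (exec_to (ex_skip _)); st; rewrite E3.
      by apply: (exec_to (ex_push _ _ _)); rd; rewrite E3.
    by case: (a) Hp => Hp; apply: (@ex_case _ _ _ _ _ _ _ b v); [rd; rewrite E2| |rd; rewrite E2|]; case: (b) Hp.
  by apply: (exec_conv He) => //; st.
have [t1 L1 {}H1] := H1; have [t2 L2 {}H2] := H2 (drop (size u) v).
exists (t1 + t2).+1; first by move: L2; rewrite size_drop; lia.
move=> i s n E1 E2 E3; have [n' [Hn' He]] := H1 i s n E1 E2 E3.
apply: (ex_seq He); apply: (exec_to (H2 i _ n' _ _)) => //.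
- by rd.
- by rewrite upd_eq.
- by rewrite addnC Hn'; st.
Qed.

Lemma ccomp_eqE A {eA : Enc A} (f : A * A -> bool) :
  (forall a b, f (a, b) <-> a = b) -> ccomp f (fun x => 40 * sz x + 40).
Proof.
move=> Hf.
exists (fun i => Case i Skip (CSeq (split i i.+1 i.+2) (CSeq (mv i i.+2) (CSeq (cmpb i)
  (CSeq (Push i false) (Case i.+3 Skip (clr i.+3) (CSeq (Push i false) (Push i true))))))) Skip) => -[a b].
have [t L H] := exec_cmpb (rev (code (E a))) (rev (code (E b))).
have Ef : f (a, b) = (ndiff (rev (code (E a))) (rev (code (E b))) == 0).
  rewrite ndiff_eq; apply/idP/eqP => [Hab|Hab]; first by rewrite (proj1 (Hf a b) Hab).
  by apply/(proj2 (Hf a b))/E_inj/code_inj/(can_inj revK).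
have Hnd := ndiff_le (rev (code (@E _ eA a))) (rev (code (@E _ eA b))).
rewrite !size_rev in L Hnd.
eexists; last first.
  move=> i s Hi Hc.
  apply: (@ex_case _ _ _ _ _ _ _ true (code (E a) ++ code (E b))) => //.
  apply: ex_seq.
    apply: (@exec_split _ _ _ (E a) (code (E b))); try lia; first by rewrite upd_eq.
    by rdc Hc.
  apply: (@ex_seq _ _ _ (upd (upd (upd s i [::]) i.+1 (rev (code (E a)))) i.+2 (rev (code (E b)))) _ (2 * sz b).+1).
    apply: (exec_tot (exec_mv _ _)) => //; try lia.
      by rdc Hc; st2 Hc.
    by rd.
  apply: ex_seq.
    apply: (H i _ 0); rewrite ?upd_eq //; first by rd.
    by rdc Hc.
  rewrite addn0; set d := ndiff _ _.
  apply: (@ex_seq _ _ _ (upd (upd s i [:: false]) i.+3 (nseq d true))).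
    by apply: (exec_to (ex_push _ _ _)) => //; rdc Hc; st2 Hc.
  have : exec (Case i.+3 Skip (clr i.+3) (CSeq (Push i false) (Push i true)))
     (upd (upd s i [:: false]) i.+3 (nseq d true)) (upd s i (code (E (f (a, b)))))
     (if d is d'.+1 then (2 * d').+2 else 4).
    rewrite Ef -/d; case: (d) => [|d'] /=.
      apply: ex_case0; first by rewrite upd_eq.
      apply: (@ex_seq _ _ _ _ _ 1 1); first exact: ex_push.
      apply: (exec_to (ex_push _ _ _)) => //.
      by rdc Hc; st2 Hc.
    apply: (@ex_case _ _ _ _ _ _ _ true (nseq d' true)); first by rewrite upd_eq.
    apply: (exec_tot (exec_clr _ _)) => //; first by st2 Hc.
    by rewrite upd_eq size_nseq.
  exact.
have := scost_le (@E _ eA a); move: L Hnd; rewrite sz_pair -/(sz a) -/(sz b); case: (ndiff _ _) => [|d] /=; lia.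
Qed.

(** * Polynomially bounded costs *)

(** With a base of at least 2 a single exponent is enough: constants, sums and products are absorbed
    by raising it. *)
Definition PB A {eA : Enc A} (h : A -> nat) := exists c, forall a, h a <= (sz a + 2) ^ c.

Section PB.
Context (A : Type) {eA : Enc A}.
Implicit Types h : A -> nat.

Lemma PB_le h1 h2 : (forall a, h1 a <= h2 a) -> PB h2 -> PB h1.
Proof. by move=> H [c Hc]; exists c => a; apply: leq_trans (Hc a). Qed.

Lemma PB_const n : PB (fun _ : A => n).
Proof.
exists n => a; apply: (@leq_trans (2 ^ n)); first exact/ltnW/ltn_expl.
by case: n => // n; rewrite leq_exp2r //; lia.
Qed.

Lemma PB_sz : PB (fun a : A => sz a).
Proof. by exists 1 => a; rewrite expn1; lia. Qed.

Lemma PB_mul h1 h2 : PB h1 -> PB h2 -> PB (fun a => h1 a * h2 a).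
Proof. by move=> [c H] [d K]; exists (c + d) => a; rewrite expnD leq_mul. Qed.

Lemma PB_add h1 h2 : PB h1 -> PB h2 -> PB (fun a => h1 a + h2 a).
Proof.
move=> [c H] [d K]; exists (c + d).+1 => a; move: (H a) (K a).
have Hp e : 0 < (sz a + 2) ^ e by rewrite expn_gt0 addn2.
have h1le : (sz a + 2) ^ c <= (sz a + 2) ^ (c + d) by rewrite expnD leq_pmulr.
have h2le : (sz a + 2) ^ d <= (sz a + 2) ^ (c + d) by rewrite expnD leq_pmull.
rewrite expnS; nia.
Qed.

Lemma PB_exp h c : PB h -> PB (fun a => h a ^ c).
Proof.
move=> H; elim: c => [|c IH]; first exact: (PB_le (h2 := fun => 1)) (PB_const 1).
by apply: PB_le (PB_mul H IH) => a; rewrite expnS.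
Qed.

Lemma PB_S h : PB h -> PB (fun a => (h a).+1).
Proof. by move=> H; apply: PB_le (PB_add (PB_const 1) H) => a. Qed.
End PB.

Lemma PB_comp A B {eA : Enc A} {eB : Enc B} (f : A -> B) (h : B -> nat) :
  PB h -> PB (fun a => sz (f a)) -> PB (fun a => h (f a)).
Proof.
move=> [c H] Hf; apply: PB_le (PB_exp c (PB_add Hf (PB_const 2))) => a; exact: H.
Qed.

Ltac pb := cbv beta; match goal with
  | |- PB _ => assumption
  | |- PB (fun a => (@?f a).+1) => apply (@PB_S _ _ f); pb
  | |- PB (fun a => @?f a + @?g a) => apply (@PB_add _ _ f g); pb
  | |- PB (fun a => @?f a * @?g a) => apply (@PB_mul _ _ f g); pb
  | |- PB (fun a => @?f a ^ ?c) => apply (@PB_exp _ _ f c); pb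
  | |- PB (fun a => sz a) => exact: PB_sz
  | |- PB (fun _ => ?n) => exact: PB_const
  | _ => idtac end.

(* [FC true f]: f is computed in polynomial time; [FC false f]: f is computed, with no time bound. *)
Definition FC (p : bool) A B {eA : Enc A} {eB : Enc B} (f : A -> B) :=
  exists bd, ccomp f bd /\ (p -> PB bd).

Lemma FC_eq p A B {eA : Enc A} {eB : Enc B} (f g : A -> B) : f =1 g -> FC p f -> FC p g.
Proof. by move=> H [bd [Hc Hp]]; exists bd; split => //; apply: ccomp_eq Hc. Qed.

Lemma FC_out p A B {eA : Enc A} {eB : Enc B} (f : A -> B) : FC p f -> p -> PB (fun a => sz (f a)).
Proof.
move=> [bd [Hc Hp]] /Hp Hb; apply: PB_le (PB_add (PB_sz (A := A)) Hb) => a.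
exact: ccomp_size.
Qed.

Section Closure.
Context (p : bool) (A B C S : Type) {eA : Enc A} {eB : Enc B} {eC : Enc C} {eS : Enc S}.

Lemma FC_id : FC p (fun a : A => a).
Proof. by exists (fun => 1); split; [exact: ccomp_id|move=> _; exact: PB_const]. Qed.

Lemma FC_coerce (f : A -> B) : (forall a, E (f a) = E a) -> FC p f.
Proof. by move=> H; exists (fun => 1); split; [exact: ccomp_coerce|move=> _; exact: PB_const]. Qed.

Lemma FC_comp (f : A -> B) (g : B -> C) : FC p f -> FC p g -> FC p (fun a => g (f a)).
Proof.
move=> Hf [bg [Hg Pg]]; have Ho := FC_out Hf; case: Hf => bf [Hf Pf].
eexists; split; first exact: ccomp_comp Hf Hg.
by move=> Hp; apply/PB_S/PB_add; [exact: Pf|apply: PB_comp; [exact: Pg|exact: Ho]].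
Qed.

Lemma FC_const (b : B) : FC p (fun _ : A => b).
Proof. by eexists; split; [exact: ccomp_const|move=> _; pb]. Qed.

Lemma FC_pair (f : A -> B) (g : A -> C) : FC p f -> FC p g -> FC p (fun a => (f a, g a)).
Proof.
move=> Hf Hg; have Of := FC_out Hf; have Og := FC_out Hg.
case: Hf Hg => bf [Hf Pf] [bg [Hg Pg]]; eexists; split; first exact: ccomp_pair Hf Hg.
by move=> Hp; have := (Pf Hp, Pg Hp, Of Hp, Og Hp) => -[[[? ?] ?] ?]; pb.
Qed.

Lemma FC_fst (f : A -> B * C) : FC p f -> FC p (fun a => (f a).1).
Proof.
move=> [bf [Hf Pf]]; have Of := FC_out (ex_intro _ bf (conj Hf Pf)).
eexists; split; first exact: (ccomp_comp Hf (@ccomp_fst B C _ _)).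
by move=> Hp; have := (Pf Hp, Of Hp) => -[? ?]; pb.
Qed.

Lemma FC_snd (f : A -> B * C) : FC p f -> FC p (fun a => (f a).2).
Proof.
move=> [bf [Hf Pf]]; have Of := FC_out (ex_intro _ bf (conj Hf Pf)).
eexists; split; first exact: (ccomp_comp Hf (@ccomp_snd B C _ _)).
by move=> Hp; have := (Pf Hp, Of Hp) => -[? ?]; pb.
Qed.

Lemma FC_if (c : A -> bool) (f g : A -> B) : FC p c -> FC p f -> FC p g ->
  FC p (fun a => if c a then f a else g a).
Proof.
move=> [bc [Hc Pc]] [bf [Hf Pf]] [bg [Hg Pg]]; eexists; split; first exact: ccomp_if Hc Hf Hg.
by move=> Hp; have := (Pf Hp, Pg Hp, Pc Hp) => -[[? ?] ?]; pb.
Qed.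

End Closure.

Section Closure2.
Context (p : bool) (A B C S : Type) {eA : Enc A} {eB : Enc B} {eC : Enc C} {eS : Enc S}.

Lemma FC_eqb (T : eqType) {eT : Enc T} (f g : A -> T) : FC p f -> FC p g ->
  FC p (fun a => f a == g a).
Proof.
move=> Hf Hg; have H : FC p (fun x : T * T => x.1 == x.2).
  eexists; split; first by apply: ccomp_eqE => a b /=; split=> /eqP.
  by move=> _; pb.
exact: (FC_comp (FC_pair Hf Hg) H).
Qed.

Lemma FC2 (f : A -> B) (g : A -> C) (F : B -> C -> S) :
  FC p (fun x : B * C => F x.1 x.2) -> FC p f -> FC p g -> FC p (fun a => F (f a) (g a)).
Proof. by move=> HF Hf Hg; apply: (FC_comp (FC_pair Hf Hg) HF). Qed.

Lemma FC_case (f : A -> seq B) (g : A -> C) (h : A -> B -> seq B -> C) :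
  FC p f -> FC p g -> FC p (fun x : A * (B * seq B) => h x.1 x.2.1 x.2.2) ->
  FC p (fun a => if f a is b :: s then h a b s else g a).
Proof.
move=> Hf [bg [Hg Pg]] [bh [Hh Ph]]; have Of := FC_out Hf; case: Hf => [bf [Hf Pf]].
eexists; split; first exact: ccomp_case Hf Hg Hh.
move=> Hp; have := (Pf Hp, Pg Hp, Of Hp) => -[[? ?] ?]; have [c Hc] := Ph Hp.
pb; apply: (PB_le (h2 := fun a => (sz a + sz (f a) + 3) ^ c)); last by pb.
move=> a; case E: (f a) => [|b s] //; apply: leq_trans (Hc _) _.
case: (c) => // n; rewrite leq_exp2r // sz_pair sz_pair sz_cons; lia.
Qed.

Lemma fcost_le (g : A -> S -> B -> S) (bG : B * (A * S) -> nat) a N M Q :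
  (forall b s, sz b <= N -> sz s <= Q -> bG (b, (a, s)) <= M) ->
  forall l s, sz l <= N -> (forall k, sz (foldl (g a) s (take k l)) <= Q) ->
  fcost (fun x => (x.2.1, g x.2.1 x.2.2 x.1)) bG (a, s) l <= size l * (9 * N + M + 30).
Proof.
move=> HM; elim=> [|b l IH] s //= HN HQ.
have Hb : sz b <= N by move: HN; rewrite sz_cons; lia.
have Hl : sz l <= N by move: HN; rewrite sz_cons; lia.
have := IH (g a s b) Hl (fun k => HQ k.+1).
by have := HM b s Hb (HQ 0); rewrite mulSn; lia.
Qed.

Lemma size_sz (l : seq B) : size l <= sz l.
Proof. by elim: l => //= b l IH; rewrite sz_cons; lia. Qed.

Lemma foldl_state (g : A -> S -> B -> S) a s l :
  foldl (fun s b => (s.1, g s.1 s.2 b)) (a, s) l = (a, foldl (g a) s l).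
Proof. by elim: l s => //= b l IH s; rewrite IH. Qed.
End Closure2.

Section Closure3.
Context (p : bool) (A B C S : Type) {eA : Enc A} {eB : Enc B} {eC : Enc C} {eS : Enc S}.

(** A polynomial step may square the size of the state, so iterating it need not be polynomial.
    Therefore, in the polynomial mode, a common polynomial bound on all intermediate states is
    required. *)
Lemma FC_foldl (g : A -> S -> B -> S) (i : A -> S) (l : A -> seq B) :
  FC p (fun x : A * S * B => g x.1.1 x.1.2 x.2) -> FC p i -> FC p l ->
  (p -> exists2 q : A -> nat, PB q & forall a k, sz (foldl (g a) (i a) (take k (l a))) <= q a) ->
  FC p (fun a => foldl (g a) (i a) (l a)).
Proof.
move=> Hg Hi Hl Hq.
(* [ccomp_foldl] passes only the state to its step function, so the parameter [a] travels as a
   component of the state. *)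
pose G (x : B * (A * S)) := (x.2.1, g x.2.1 x.2.2 x.1).
have HG : FC p G.
  have I : FC p (fun x : B * (A * S) => x) by apply: FC_id.
  apply: FC_pair; first exact: FC_fst (FC_snd I).
  apply: (FC_comp (f := fun x : B * (A * S) => (x.2, x.1)) _ Hg).
  by apply: FC_pair; [exact: FC_snd I|exact: FC_fst I].
case: HG => bG [HG PG].
have Hin : FC p (fun a => ((a, i a), l a)).
  by apply: FC_pair => //; apply: FC_pair => //; apply: FC_id.
have Oin := FC_out Hin; have Ol := FC_out Hl; case: Hin => bin [Hin Pin].
apply: (FC_eq (f := fun a => (foldl (fun s b => G (b, s)) (a, i a) (l a)).2)).
  by move=> a; rewrite [foldl _ _ _]foldl_state.
apply: FC_snd; eexists; split; first exact: ccomp_comp Hin (ccomp_foldl HG).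
move=> Hp; have [q Pq Hqa] := Hq Hp; have [c Hc] := PG Hp.
have := (Pin Hp, Oin Hp, Ol Hp) => -[[? ?] ?].
pb.
- apply: (PB_le (h2 := fun a => sz (l a) * (9 * sz (l a) + (sz (l a) + sz a + q a + 4) ^ c + 30))); last by pb.
  move=> a /=; set M := (_ + 4) ^ c.
  have HM b s : sz b <= sz (l a) -> sz s <= q a -> bG (b, (a, s)) <= M.
    move=> Hb Hs; apply: leq_trans (Hc _) _; rewrite /M.
    by case: (c) => // n; rewrite leq_exp2r // !sz_pair; lia.
  apply: leq_trans (fcost_le HM (leqnn _) (Hqa a)) _.
  by rewrite leq_mul2r size_sz orbT.
- apply: (PB_le (h2 := fun a => sz a + q a + 1)); last by pb.
  move=> a /=; rewrite [foldl _ _ _]foldl_state sz_pair.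
  by have := Hqa a (size (l a)); rewrite take_size; lia.
Qed.
End Closure3.

(** A hook for [fc], redefined whenever further closure lemmas are available, so that computability
    proofs follow the syntax of the function. *)
Ltac fc_ext := fail.

Ltac fc_step := cbv beta; match goal with
  | |- FC _ _ => assumption
  | |- FC _ (fun a => a) => apply: FC_id
  | |- @FC ?p ?A ?B ?eA ?eB (@fst ?X ?Y) => change (@FC p A B eA eB (fun a => @fst X Y a))
  | |- @FC ?p ?A ?B ?eA ?eB (@snd ?X ?Y) => change (@FC p A B eA eB (fun a => @snd X Y a))
  | |- FC _ (fun _ => ?c) => apply: FC_const
  | |- @FC ?p ?A ?B ?eA ?eB (@pair ?X ?Y ?c) => change (@FC p A B eA eB (fun a => @pair X Y c a))
  | |- FC _ (fun a => (@?f a, @?g a)) => apply (@FC_pair _ _ _ _ _ _ _ f g)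
  | |- FC _ (fun a => (@?f a).1) => apply (@FC_fst _ _ _ _ _ _ _ f)
  | |- FC _ (fun a => (@?f a).2) => apply (@FC_snd _ _ _ _ _ _ _ f)
  | |- FC _ (fun a => @eq_op ?T (@?f a) (@?g a)) => apply (@FC_eqb _ _ _ T _ f g)
  | _ => first [fc_ext | apply: FC_if]
  end.
Ltac fc := repeat fc_step.

(** * Closure under operations on lists *)

Section Lib.
Context (p : bool) (A B C : Type) {eA : Enc A} {eB : Enc B} {eC : Enc C}.

Lemma FC_cons (f : A -> B) (g : A -> seq B) : FC p f -> FC p g -> FC p (fun a => f a :: g a).
Proof.
move=> Hf Hg; apply: (FC2 (F := fun b s => b :: s) _ Hf Hg).
exact: FC_coerce.
Qed.

End Lib.

#[global] Instance enc_tree : Enc tree. Proof. by exists id. Defined.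

Section Lib2.
Context (p : bool) (A B C : Type) {eA : Enc A} {eB : Enc B} {eC : Enc C}.

Lemma FC_negb (f : A -> bool) : FC p f -> FC p (fun a => ~~ f a).
Proof. by move=> H; apply: (FC_eq (f := fun a => if f a then false else true)) => //; fc. Qed.

Lemma FC_andb (f g : A -> bool) : FC p f -> FC p g -> FC p (fun a => f a && g a).
Proof. by move=> H K; apply: (FC_eq (f := fun a => if f a then g a else false)) => //; fc. Qed.

Lemma FC_orb (f g : A -> bool) : FC p f -> FC p g -> FC p (fun a => f a || g a).
Proof. by move=> H K; apply: (FC_eq (f := fun a => if f a then true else g a)) => //; fc. Qed.

Lemma FC_addb (f g : A -> bool) : FC p f -> FC p g -> FC p (fun a => f a (+) g a).
Proof.
move=> H K; have N := FC_negb K.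
apply: (FC_eq (f := fun a => if f a then ~~ g a else g a)).
  by move=> a; case: (f a).
by fc.
Qed.

Lemma FC_behead (f : A -> seq B) : FC p f -> FC p (fun a => behead (f a)).
Proof.
move=> H; apply: (FC_eq (f := fun a => if f a is b :: s then s else [::])).
  by move=> a; case: (f a).
by apply: FC_case; fc.
Qed.

Lemma FC_head (x0 : B) (f : A -> seq B) : FC p f -> FC p (fun a => head x0 (f a)).
Proof.
move=> H; apply: (FC_eq (f := fun a => if f a is b :: s then b else x0)).
  by move=> a; case: (f a).
by apply: FC_case; fc.
Qed.

Lemma sz_catrev (s t : seq B) : sz (catrev s t) < sz s + sz t.
Proof. by elim: s t => [|b s IH] t /=; rewrite ?sz_nil // sz_cons; have := IH (b :: t); rewrite sz_cons; lia. Qed.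

Lemma sz_take n (s : seq B) : sz (take n s) <= sz s.
Proof. by elim: s n => [|b s IH] [|n] //=; rewrite ?sz_cons ?sz_nil; have := IH n; lia. Qed.

Lemma foldl_cons (s t : seq B) : foldl (fun s b => b :: s) t s = catrev s t.
Proof. by elim: s t => //= b s IH t; rewrite IH. Qed.
End Lib2.

Section Lib3.
Context (p : bool) (A B C : Type) {eA : Enc A} {eB : Enc B} {eC : Enc C}.

Lemma FC_catrev (f g : A -> seq B) : FC p f -> FC p g -> FC p (fun a => catrev (f a) (g a)).
Proof.
move=> Hf Hg; apply: (FC_eq (f := fun a => foldl (fun s b => b :: s) (g a) (f a))).
  by move=> a; rewrite foldl_cons.
apply: (FC_foldl (g := fun a s b => b :: s)) => //.
  by apply: FC_cons; fc.
move=> Hp; exists (fun a => sz (f a) + sz (g a)).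
  by have := (FC_out Hf Hp, FC_out Hg Hp) => -[? ?]; pb.
move=> a k; rewrite foldl_cons.
by apply: leq_trans (ltnW (sz_catrev _ _)) _; rewrite leq_add2r; apply: sz_take.
Qed.

Lemma FC_rev (f : A -> seq B) : FC p f -> FC p (fun a => rev (f a)).
Proof. by move=> H; apply: FC_catrev => //; fc. Qed.

Lemma FC_cat (f g : A -> seq B) : FC p f -> FC p g -> FC p (fun a => f a ++ g a).
Proof.
move=> Hf Hg; apply: (FC_eq (f := fun a => catrev (rev (f a)) (g a))).
  by move=> a; rewrite catrevE revK.
by apply: FC_catrev => //; apply: FC_rev.
Qed.

Lemma sz_map (h : B -> C) N M l : (forall b, sz b <= N -> sz (h b) <= M) -> sz l <= N ->
  sz (map h l) <= size l * M.+1 + 1.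
Proof.
move=> H; elim: l => [|b l IH] //=; rewrite !sz_cons => Hl.
have Hb : sz (h b) <= M by apply: H; lia.
have Hl' : sz l <= N by lia.
by have := IH Hl'; lia.
Qed.

Lemma sz_filter (h : B -> bool) l : sz (filter h l) <= sz l.
Proof. by elim: l => //= b l IH; case: ifP => _; rewrite !sz_cons; lia. Qed.

Lemma foldl_map_rev (h : B -> C) l t :
  foldl (fun s b => h b :: s) t l = catrev (map h l) t.
Proof. by elim: l t => //= b l IH t; rewrite IH. Qed.

Lemma foldl_filter_rev (h : B -> bool) l t :
  foldl (fun s b => if h b then b :: s else s) t l = catrev (filter h l) t.
Proof. by elim: l t => //= b l IH t; rewrite IH; case: ifP. Qed.
End Lib3.

Section Lib4.
Context (p : bool) (A B C : Type) {eA : Enc A} {eB : Enc B} {eC : Enc C}.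

Lemma FC_map (h : A -> B -> C) (l : A -> seq B) :
  FC p (fun x : A * B => h x.1 x.2) -> FC p l -> FC p (fun a => map (h a) (l a)).
Proof.
move=> Hh Hl; apply: (FC_eq (f := fun a => rev (foldl (fun s b => h a b :: s) [::] (l a)))).
  by move=> a; rewrite foldl_map_rev -/(rev _) revK.
apply/FC_rev/(FC_foldl (g := fun a s b => h a b :: s)) => //.
- apply: FC_cons; last by fc.
  by apply: (FC_comp (f := fun x : A * seq C * B => (x.1.1, x.2)) _ Hh); fc.
- exact: FC_const.
move=> Hp; have [c Hc] := FC_out Hh Hp; have Ol := FC_out Hl Hp.
exists (fun a => 1 + (sz (l a) * ((sz a + sz (l a) + 3) ^ c).+1 + 1)); first by pb.
move=> a k; rewrite foldl_map_rev; apply: leq_trans (ltnW (sz_catrev _ _)) _.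
rewrite addnC leq_add2l.
set M := (_ + 3) ^ c; have HM b : sz b <= sz (l a) -> sz (h a b) <= M.
  move=> Hb; apply: leq_trans (Hc (a, b)) _; rewrite /M.
  by case: (c) => // n; rewrite leq_exp2r // !sz_pair; lia.
apply: leq_trans (sz_map HM (sz_take _ _)) _.
rewrite leq_add2r leq_mul2r; apply/orP; right.
by apply: leq_trans (sz_take k _); apply: size_sz.
Qed.

Lemma FC_filter (h : A -> B -> bool) (l : A -> seq B) :
  FC p (fun x : A * B => h x.1 x.2) -> FC p l -> FC p (fun a => filter (h a) (l a)).
Proof.
move=> Hh Hl.
apply: (FC_eq (f := fun a => rev (foldl (fun s b => if h a b then b :: s else s) [::] (l a)))).
  by move=> a; rewrite foldl_filter_rev -/(rev _) revK.
apply/FC_rev/(FC_foldl (g := fun a s b => if h a b then b :: s else s)) => //.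
- apply: FC_if; [|apply: FC_cons; fc|fc].
  by apply: (FC_comp (f := fun x : A * seq B * B => (x.1.1, x.2)) _ Hh); fc.
- exact: FC_const.
move=> Hp; have Ol := FC_out Hl Hp.
exists (fun a => 1 + sz (l a)); first by pb.
move=> a k; rewrite foldl_filter_rev; apply: leq_trans (ltnW (sz_catrev _ _)) _.
rewrite addnC leq_add2l; apply: leq_trans (sz_filter _ _) _; exact: sz_take.
Qed.

Lemma FC_has (h : A -> B -> bool) (l : A -> seq B) :
  FC p (fun x : A * B => h x.1 x.2) -> FC p l -> FC p (fun a => has (h a) (l a)).
Proof.
move=> Hh Hl; apply: (FC_eq (f := fun a => foldl (fun s b => if s then true else h a b) false (l a))).
  move=> a; elim: (l a) => //= b s IH; case: (h a b) => //=.
  by elim: (s).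
apply: (FC_foldl (g := fun a s b => if s then true else h a b)) => //.
- apply: FC_if; [fc|fc|].
  by apply: (FC_comp (f := fun x : A * bool * B => (x.1.1, x.2)) _ Hh); fc.
- exact: FC_const.
move=> _; exists (fun => 3); first by pb.
by move=> a k; case: foldl.
Qed.

Lemma FC_all (h : A -> B -> bool) (l : A -> seq B) :
  FC p (fun x : A * B => h x.1 x.2) -> FC p l -> FC p (fun a => all (h a) (l a)).
Proof.
move=> Hh Hl; apply: (FC_eq (f := fun a => ~~ has (fun b => ~~ h a b) (l a))).
  by move=> a; rewrite -all_predC; apply: eq_all => b /=; rewrite negbK.
by apply/FC_negb/(FC_has (h := fun a b => ~~ h a b)) => //; apply: FC_negb.
Qed.
End Lib4.

Section Lib5.
Context (p : bool) (A : Type) {eA : Enc A}.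

Lemma FC_mem (T : eqType) {eT : Enc T} (f : A -> T) (l : A -> seq T) :
  FC p f -> FC p l -> FC p (fun a => f a \in l a).
Proof.
move=> Hf Hl; apply: (FC_eq (f := fun a => has (fun b => b == f a) (l a))).
  by move=> a; apply: has_pred1.
apply: (FC_has (h := fun a b => b == f a)) => //.
apply: FC_eqb; first by fc.
by apply: (FC_comp (f := fun x : A * T => x.1) _ Hf); fc.
Qed.
End Lib5.

#[global] Instance enc_unit : Enc unit.
Proof. by exists (fun => Lf); case; case. Defined.

(** The rule for [foldl] is confined to the mode without time bound, where no bound on the states
    has to be supplied; polynomial folds are treated one by one. *)
Ltac fc_ext0 := match goal with
  | |- FC _ (fun a => @?f a :: @?g a) => apply (@FC_cons _ _ _ _ _ f g)
  | |- FC _ (fun a => negb (@?f a)) => apply (@FC_negb _ _ _ f)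
  | |- FC _ (fun a => andb (@?f a) (@?g a)) => apply (@FC_andb _ _ _ f g)
  | |- FC _ (fun a => orb (@?f a) (@?g a)) => apply (@FC_orb _ _ _ f g)
  | |- FC _ (fun a => addb (@?f a) (@?g a)) => apply (@FC_addb _ _ _ f g)
  | |- FC _ (fun a => behead (@?f a)) => apply (@FC_behead _ _ _ _ _ f)
  | |- FC _ (fun a => head ?x (@?f a)) => apply (@FC_head _ _ _ _ _ x f)
  | |- FC _ (fun a => rev (@?f a)) => apply (@FC_rev _ _ _ _ _ f)
  | |- FC _ (fun a => @?f a ++ @?g a) => apply (@FC_cat _ _ _ _ _ f g)
  | |- FC _ (fun a => map (@?h a) (@?l a)) => apply (@FC_map _ _ _ _ _ _ _ h l)
  | |- FC _ (fun a => filter (@?h a) (@?l a)) => apply (@FC_filter _ _ _ _ _ h l)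
  | |- FC _ (fun a => has (@?h a) (@?l a)) => apply (@FC_has _ _ _ _ _ h l)
  | |- FC _ (fun a => all (@?h a) (@?l a)) => apply (@FC_all _ _ _ _ _ h l)
  | |- FC _ (fun a => in_mem (@?f a) (mem (@?l a))) => apply (@FC_mem _ _ _ _ _ f l)
  | |- FC false (fun a => foldl (@?g a) (@?i a) (@?l a)) =>
       apply (@FC_foldl false _ _ _ _ _ _ g i l); last by []
  end.
Ltac fc_ext ::= fc_ext0.

(** * Arithmetic on unary numbers *)

Section Nat.
Context (A B C : Type) {eA : Enc A} {eB : Enc B} {eC : Enc C}.

(** A unary number and a list of units have the same code, so the conversion is free and list
    operations become arithmetic. *)
Lemma FC_units (f : A -> nat) p : FC p f -> FC p (fun a => nseq (f a) tt).
Proof.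
move=> H; apply: (FC_comp (g := fun n => nseq n tt) H); apply: FC_coerce.
by elim=> //= n ->.
Qed.

Lemma FC_ofunits (f : A -> seq unit) p : FC p f -> FC p (fun a => size (f a)).
Proof.
move=> H; apply: (FC_comp (g := fun n : seq unit => size n) H); apply: FC_coerce.
by elim=> //= -[] s ->.
Qed.

Lemma FC_S (f : A -> nat) p : FC p f -> FC p (fun a => (f a).+1).
Proof.
move=> H; apply: (FC_eq (f := fun a => size (tt :: nseq (f a) tt))) => [a|].
  by rewrite /= size_nseq.
by apply/FC_ofunits; fc; apply: FC_units.
Qed.

Lemma FC_pred (f : A -> nat) p : FC p f -> FC p (fun a => (f a).-1).
Proof.
move=> H; apply: (FC_eq (f := fun a => size (behead (nseq (f a) tt)))) => [a|].
  by rewrite size_behead size_nseq.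
by apply/FC_ofunits; fc; apply: FC_units.
Qed.

Lemma FC_iter (n : A -> nat) (g : A -> B -> B) (i : A -> B) :
  FC false n -> FC false (fun x : A * B => g x.1 x.2) -> FC false i ->
  FC false (fun a => iter (n a) (g a) (i a)).
Proof.
move=> Hn Hg Hi.
apply: (FC_eq (f := fun a => foldl (fun s _ => g a s) (i a) (nseq (n a) tt))).
  by move=> a; elim: (n a) (i a) => // m IH s; rewrite iterSr -IH.
have Hu := FC_units Hn; fc.
by apply: (FC_comp (f := fun x : A * B * unit => x.1) _ Hg); fc.
Qed.

End Nat.

Section Size.
Context (A B : Type) {eA : Enc A} {eB : Enc B}.

Lemma FC_size (f : A -> seq B) : FC false f -> FC false (fun a => size (f a)).
Proof.
move=> H; apply: (FC_eq (f := fun a => foldl (fun n _ => n.+1) 0 (f a))).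
  move=> a; rewrite -[RHS]addn0; elim: (f a) 0 => //= b s IH n; rewrite IH; lia.
by fc; apply: FC_S; fc.
Qed.
End Size.

Ltac fc_ext1 := match goal with
  | |- FC _ (fun a => (@?f a).+1) => apply (@FC_S _ _ f)
  | |- FC _ (fun a => (@?f a).-1) => apply (@FC_pred _ _ f)
  | |- FC _ (fun a => iter (@?n a) (@?g a) (@?i a)) => apply (@FC_iter _ _ _ _ n g i)
  | |- FC _ (fun a => size (@?f a)) => apply (@FC_size _ _ _ _ f)
  | _ => fc_ext0
  end.
Ltac fc_ext ::= fc_ext1.

Section Arith.
Context (A B C : Type) {eA : Enc A} {eB : Enc B} {eC : Enc C}.

Lemma FC_add (f g : A -> nat) : FC false f -> FC false g -> FC false (fun a => f a + g a).
Proof.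
move=> Hf Hg; apply: (FC_eq (f := fun a => iter (f a) S (g a))).
  by move=> a; rewrite iter_succn addnC.
by fc.
Qed.

Lemma FC_sub (f g : A -> nat) : FC false f -> FC false g -> FC false (fun a => f a - g a).
Proof.
move=> Hf Hg; apply: (FC_eq (f := fun a => iter (g a) predn (f a))).
  by move=> a; rewrite iter_predn.
by fc.
Qed.

End Arith.

Section Arith2.
Context (A B C : Type) {eA : Enc A} {eB : Enc B} {eC : Enc C}.

Lemma FC_leq (f g : A -> nat) : FC false f -> FC false g -> FC false (fun a => f a <= g a).
Proof. by move=> Hf Hg; have H := FC_sub Hf Hg; rewrite /leq; fc. Qed.

Lemma FC_mul (f g : A -> nat) : FC false f -> FC false g -> FC false (fun a => f a * g a).
Proof.
move=> Hf Hg; apply: (FC_eq (f := fun a => iter (f a) (addn (g a)) 0)).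
  by move=> a; rewrite iter_addn_0 mulnC.
by fc; apply: FC_add; fc; apply: (FC_comp _ Hg); fc.
Qed.

Lemma FC_expn (f : A -> nat) c : FC false f -> FC false (fun a => f a ^ c).
Proof.
move=> Hf; elim: c => [|c IH].
  by apply: (FC_eq (f := fun => 1)) => //; fc.
by apply: (FC_eq (f := fun a => f a * f a ^ c)); [move=> a; rewrite expnS|apply: FC_mul].
Qed.

Lemma FC_odd (f : A -> nat) : FC false f -> FC false (fun a => odd (f a)).
Proof.
move=> Hf; apply: (FC_eq (f := fun a => iter (f a) negb false)); last by fc.
by move=> a; elim: (f a) => //= n ->.
Qed.

Lemma FC_half (f : A -> nat) : FC false f -> FC false (fun a => (f a)./2).
Proof.
move=> Hf; apply: (FC_eq (f := fun a =>
  (iter (f a) (fun x : bool * nat => (~~ x.1, if x.1 then x.2.+1 else x.2)) (false, 0)).2)).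
  move=> a; suff -> : iter (f a) (fun x : bool * nat => (~~ x.1, if x.1 then x.2.+1 else x.2))
    (false, 0) = (odd (f a), (f a)./2) by [].
  elim: (f a) => // n IH; rewrite iterS IH /= uphalf_half.
  by case: (odd n).
by fc.
Qed.

Lemma FC_iota (f g : A -> nat) : FC false f -> FC false g -> FC false (fun a => iota (f a) (g a)).
Proof.
move=> Hf Hg; apply: (FC_eq (f := fun a =>
  rev (iter (g a) (fun x : nat * seq nat => (x.1.+1, x.1 :: x.2)) (f a, [::])).2)).
  move=> a; suff -> : iter (g a) (fun x : nat * seq nat => (x.1.+1, x.1 :: x.2)) (f a, [::]) =
    (f a + g a, rev (iota (f a) (g a))) by rewrite /= revK.
  elim: (g a) => [|n IH]; first by rewrite addn0.
  have -> : iota (f a) n.+1 = rcons (iota (f a) n) (f a + n) by rewrite -addn1 iotaD cats1.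
  by rewrite iterS IH rev_rcons addnS.
by fc.
Qed.

Lemma FC_nseq (n : A -> nat) (f : A -> B) : FC false n -> FC false f ->
  FC false (fun a => nseq (n a) (f a)).
Proof.
move=> Hn Hf; apply: (FC_eq (f := fun a => iter (n a) (cons (f a)) [::])).
  by move=> a; elim: (n a) => //= m ->.
by fc; apply: (FC_comp _ Hf); fc.
Qed.

Lemma FC_flatten (f : A -> seq (seq B)) : FC false f -> FC false (fun a => flatten (f a)).
Proof.
move=> Hf; apply: (FC_eq (f := fun a => foldl cat [::] (f a))); last by fc.
move=> a; rewrite -[RHS]/([::] ++ _); elim: (f a) [::] => [|b s IH] t /=; rewrite ?cats0 //.
by rewrite IH catA.
Qed.

Lemma FC_sumn (f : A -> seq nat) : FC false f -> FC false (fun a => sumn (f a)).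
Proof.
move=> Hf; apply: (FC_eq (f := fun a => foldl addn 0 (f a))).
  by move=> a; rewrite -[RHS]addn0; elim: (f a) 0 => //= n s IH m; rewrite IH; lia.
by fc; apply: FC_add; fc.
Qed.
End Arith2.

Ltac fc_ext2 := match goal with
  | |- FC _ (fun a => @?f a + @?g a) => apply (@FC_add _ _ f g)
  | |- FC _ (fun a => @?f a - @?g a) => apply (@FC_sub _ _ f g)
  | |- FC _ (fun a => @?f a * @?g a) => apply (@FC_mul _ _ f g)
  | |- FC _ (fun a => @?f a ^ ?c) => apply (@FC_expn _ _ f c)
  | |- FC _ (fun a => @?f a <= @?g a) => apply (@FC_leq _ _ f g)
  | |- FC _ (fun a => odd (@?f a)) => apply (@FC_odd _ _ f)
  | |- FC _ (fun a => (@?f a)./2) => apply (@FC_half _ _ f)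
  | |- FC _ (fun a => iota (@?f a) (@?g a)) => apply (@FC_iota _ _ f g)
  | |- FC _ (fun a => nseq (@?f a) (@?g a)) => apply (@FC_nseq _ _ _ _ f g)
  | |- FC _ (fun a => flatten (@?f a)) => apply (@FC_flatten _ _ _ _ f)
  | |- FC _ (fun a => sumn (@?f a)) => apply (@FC_sumn _ _ f)
  | _ => fc_ext1
  end.
Ltac fc_ext ::= fc_ext2.

Fixpoint words (B : Type) (s : seq B) n : seq (seq B) :=
  if n is n'.+1 then [seq x :: w | x <- s, w <- words s n'] else [:: [::]].

Lemma wordsP (B : eqType) (s : seq B) n w : (w \in words s n) = (size w == n) && all (mem s) w.
Proof.
elim: n w => [|n IH] w /=; first by rewrite inE; case: w.
apply/allpairsP/idP => [[[x v] /= [Hx Hv ->]]|].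
  by move: Hv; rewrite IH /= eqSS Hx => /andP[-> ->].
case: w => // x w /=; rewrite eqSS => /and3P[Hs Hx Hw].
by exists (x, w); rewrite IH Hs Hw.
Qed.

Section Lists.
Context (A B C D : Type) {eA : Enc A} {eB : Enc B} {eC : Enc C} {eD : Enc D}.

Lemma FC_words (f : A -> seq B) (n : A -> nat) : FC false f -> FC false n ->
  FC false (fun a => words (f a) (n a)).
Proof.
move=> Hf Hn; apply: (FC_eq (f := fun a => iter (n a)
  (fun ws => flatten (map (fun x => map (fun w => x :: w) ws) (f a))) [:: [::]])).
  by move=> a; elim: (n a) => // m IH; rewrite iterS IH.
by fc; apply: (FC_comp _ Hf); fc.
Qed.

Lemma FC_nth (x0 : B) (f : A -> seq B) (n : A -> nat) : FC false f -> FC false n ->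
  FC false (fun a => nth x0 (f a) (n a)).
Proof.
move=> Hf Hn; apply: (FC_eq (f := fun a => head x0 (iter (n a) behead (f a)))); last by fc.
move=> a; have -> m (s : seq B) : iter m behead s = drop m s.
  by elim: m s => [|m IH] s; rewrite ?drop0 // iterSr IH; case: s.
by rewrite -nth0 nth_drop addn0.
Qed.

Lemma FC_zip (f : A -> seq B) (g : A -> seq C) : FC false f -> FC false g ->
  FC false (fun a => zip (f a) (g a)).
Proof.
move=> Hf Hg; pose st (x : seq C * seq (B * C)) b := 
  if x.1 is y :: t then (t, (b, y) :: x.2) else x.
apply: (FC_eq (f := fun a => rev (foldl st (g a, [::]) (f a)).2)).
  move=> a; suff H s t r : (foldl st (t, r) s).2 = rev (zip s t) ++ r.
    by rewrite H cats0 revK.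
  elim: s t r => [|b s IH] [|c t] r //=; first by rewrite IH; case: (s).
  by rewrite IH rev_cons cat_rcons.
fc; apply: FC_case; fc.
Qed.

End Lists.

(** * Linear inequalities read bit by bit *)

Definition dot (c u : seq nat) := sumn [seq x.1 * x.2 | x <- zip c u].

Definition lform := (seq nat * seq nat)%type.

(* A form (pos, neg) stands for pos.u - neg.u. The carry is the quotient of the part of the form
   read so far, shifted by K so as to stay nonnegative. *)
Definition nxt (FL : seq lform) K (c u : seq nat) : seq nat :=
  [seq (x.1 + dot x.2.1 u + (K - dot x.2.2 u))./2 | x <- zip c FL].

Definition bitn (e : seq bool) : seq nat := map nat_of_bool e.

Definition transition := (seq nat * seq bool * seq nat)%type.

(** The label keeps only the bits [e.1] read from the input. The bits [e.2] of the unknowns are left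
    out of it, and this is what makes the automaton nondeterministic. Carries range over 0, ..., 2
    K. *)
Definition trans_table FL K n1 n2 : seq transition :=
  [seq ((c, e.1), nxt FL K c (bitn e.1 ++ bitn e.2))
    | c <- words (iota 0 (2 * K).+1) (size FL),
      e <- [seq (e1, e2) | e1 <- words [:: false; true] n1, e2 <- words [:: false; true] n2]].

Definition stepS (tt : seq transition) (S : seq (seq nat)) (e : seq bool) : seq (seq nat) :=
  [seq t.2 | t <- tt & (t.1.1 \in S) && (t.1.2 == e)].

(** [fuel] supplies the number of rounds through its length; counters with fewer bits are padded
    with zeros by [head false]. *)
Definition runS (tt : seq transition) S (cnts : seq (seq bool)) (fuel : seq bool) :=
  foldl (fun st _ => (stepS tt st.1 (map (head false) st.2), map behead st.2)) (S, cnts) fuel.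

Fixpoint bval (b : seq bool) : nat := if b is x :: b' then x + (bval b').*2 else 0.

Definition lin2 (u v : seq nat) := [seq x.1 + x.2.*2 | x <- zip u v].

(** Closed form of [T] rounds of [nxt]: the shift K added in round i has weight 2 ^ i, and these
    shifts sum to K (2 ^ T - 1). *)
Definition carry FL K T (c u : seq nat) : seq nat :=
  [seq (x.1 + dot x.2.1 u + (K * (2 ^ T).-1 - dot x.2.2 u)) %/ 2 ^ T | x <- zip c FL].

Lemma dot_lin2 c u v : size u = size v -> dot c (lin2 u v) = dot c u + (dot c v).*2.
Proof.
rewrite /dot /lin2; elim: u v c => [|x u IH] [|y v] [|z c] //= [Hs].
by rewrite IH //; lia.
Qed.

Lemma dot_le c u M : all (fun x => x <= M) u -> dot c u <= sumn c * M.
Proof.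
rewrite /dot; elim: c u => [|x c IH] [|y u] //= /andP[Hy /IH]; nia.
Qed.

Lemma dot_cat c1 c2 u1 u2 : size c1 = size u1 -> dot (c1 ++ c2) (u1 ++ u2) = dot c1 u1 + dot c2 u2.
Proof. by move=> H; rewrite /dot zip_cat // map_cat sumn_cat. Qed.

Lemma lin2_cat u1 u2 v1 v2 : size u1 = size v1 ->
  lin2 (u1 ++ u2) (v1 ++ v2) = lin2 u1 v1 ++ lin2 u2 v2.
Proof. by move=> H; rewrite /lin2 zip_cat // map_cat. Qed.

Lemma size_lin2 u v : size u = size v -> size (lin2 u v) = size u.
Proof. by move=> H; rewrite size_map size1_zip // H. Qed.

Lemma bitn_le1 e : all (fun x => x <= 1) (bitn e).
Proof. by elim: e => //= -[]. Qed.

(** Halving and then dividing by 2 ^ T is dividing by 2 ^ (T + 1). The hypotheses make the truncated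
    subtractions exact, and K + 2 K (2 ^ T - 1) = K (2 ^ (T + 1) - 1). *)
Lemma carry_step c dp dn dp' dn' K T : dn <= K -> dn' <= K * (2 ^ T).-1 ->
  ((c + dp + (K - dn))./2 + dp' + (K * (2 ^ T).-1 - dn')) %/ 2 ^ T =
  (c + (dp + dp'.*2) + (K * (2 ^ T.+1).-1 - (dn + dn'.*2))) %/ 2 ^ T.+1.
Proof.
move=> H1 H2; have Hp : 0 < 2 ^ T by rewrite expn_gt0.
rewrite expnS divnMA; congr (_ %/ _).
have -> : K * (2 * 2 ^ T).-1 = K + (K * (2 ^ T).-1).*2 by nia.
move: (K * _) H2 => M H2.
have -> : c + (dp + dp'.*2) + (K + M.*2 - (dn + dn'.*2)) =
  (dp' + (M - dn')) * 2 + (c + dp + (K - dn)) by lia.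
by rewrite divnMDl // divn2; lia.
Qed.

Lemma pow2_pred_lin x y T : x <= 1 -> y <= (2 ^ T).-1 -> x + y.*2 <= (2 ^ T.+1).-1.
Proof. have Hp : 0 < 2 ^ T by rewrite expn_gt0. by rewrite expnS; lia. Qed.

(** The range ends at 2 K because (2 K + K + K) / 2 = 2 K. *)
Lemma carry_range c d d' K : c < (2 * K).+1 -> d <= K -> (c + d + (K - d'))./2 < (2 * K).+1.
Proof. by lia. Qed.

Section NFA.
Variables (FL : seq lform) (K n1 n2 : nat).
Hypothesis HK : all (fun f : lform => (sumn f.1 <= K) && (sumn f.2 <= K)) FL.

Definition okc (c : seq nat) := (size c == size FL) && all (fun x => x < (2 * K).+1) c.

Lemma okc_words c : (c \in words (iota 0 (2 * K).+1) (size FL)) = okc c.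
Proof.
rewrite wordsP /okc; congr (_ && _); apply: eq_all => x.
by rewrite -[LHS]/(x \in iota 0 (2 * K).+1) mem_iota.
Qed.

Lemma bits_words n (e : seq bool) : (e \in words [:: false; true] n) = (size e == n).
Proof.
rewrite wordsP andb_idr // => _; apply/allP => -[] _; by rewrite !inE.
Qed.

Lemma zip_mem (T1 T2 : eqType) (c : seq T1) (s : seq T2) x :
  x \in zip c s -> x.1 \in c /\ x.2 \in s.
Proof.
elim: s c => [|y s IH] [|z c] //=; rewrite !inE => /orP[/eqP->|/IH[H1 H2]] /=.
  by rewrite !eqxx.
by rewrite H1 H2 !orbT.
Qed.

Lemma okc_nxt c e : okc c -> okc (nxt FL K c (bitn e)).
Proof.
move=> /andP[/eqP Hs Ha]; rewrite /okc size_map size1_zip ?Hs // eqxx /=.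
apply/allP => _ /mapP[x /zip_mem[Hx1 Hx2] ->].
have /andP[H1 _] := allP HK _ Hx2.
apply: carry_range; first exact: (allP Ha _ Hx1).
by apply: leq_trans H1; have := dot_le x.2.1 (bitn_le1 e); rewrite muln1.
Qed.

Lemma stepSP S e c1 : size e = n1 -> all okc S ->
  (c1 \in stepS (trans_table FL K n1 n2) S e) <->
  exists2 c, c \in S & exists2 xi, size xi = n2 & c1 = nxt FL K c (bitn e ++ bitn xi).
Proof.
move=> He HS; split.
- case/mapP => t; rewrite mem_filter => /andP[/andP[Ht1 /eqP Ht2]].
  case/allpairsP => -[c [e1 e2]] /= [Hc He12 Et] ->; subst t; simpl in *; subst e1.
  exists c => //; exists e2 => //.
  by case/allpairsP: He12 => -[a b] /= [_ Hb [_ ->]]; apply/eqP; rewrite -bits_words.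
- case=> c Hc [xi Hxi ->]; apply/mapP; exists (c, e, nxt FL K c (bitn e ++ bitn xi)) => //.
  rewrite mem_filter /= Hc eqxx /=; apply/allpairsP; exists (c, (e, xi)); split => //=.
    by rewrite okc_words; apply: (allP HS).
  by apply/allpairsP; exists (e, xi); rewrite /= !bits_words He Hxi !eqxx.
Qed.

Lemma carry_nxt c T e xi (u' x' : seq nat) :
  size e = size u' -> size xi = size x' ->
  all (fun x => x <= (2 ^ T).-1) u' -> all (fun x => x <= (2 ^ T).-1) x' ->
  carry FL K T (nxt FL K c (bitn e ++ bitn xi)) (u' ++ x') =
  carry FL K T.+1 c (lin2 (bitn e) u' ++ lin2 (bitn xi) x').
Proof.
move=> H1 H2 H3 H4; rewrite -lin2_cat ?size_map //.
have Hall : all (fun x => x <= (2 ^ T).-1) (u' ++ x') by rewrite all_cat H3.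
have Hb := bitn_le1 (e ++ xi); rewrite /bitn map_cat -!/(bitn _) in Hb.
have Hs : size (bitn e ++ bitn xi) = size (u' ++ x') by rewrite !size_cat !size_map H1 H2.
rewrite /carry /nxt; elim: (FL) HK c => [|f l IH] /=; first by move=> _ [].
move=> /andP[/andP[_ Hf] Hl] [|y c] //=; rewrite IH //; congr (_ :: _).
rewrite !dot_lin2 // carry_step //.
- by apply: leq_trans (dot_le _ Hb) _; rewrite muln1.
- by apply: leq_trans (dot_le _ Hall) _; rewrite leq_mul2r Hf orbT.
Qed.

Definition low T (cnts : seq (seq bool)) := map (fun b => bval (take T b)) cnts.

Lemma bval_take_le T b : bval (take T b) <= (2 ^ T).-1.
Proof.
elim: T b => [|T IH] [|x b] //=; apply: pow2_pred_lin => //; exact: leq_b1.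
Qed.

Lemma low_lin2 T cnts : low T.+1 cnts = lin2 (bitn (map (head false) cnts)) (low T (map behead cnts)).
Proof.
by elim: cnts => //= b cnts IH; rewrite IH; congr (_ :: _); case: b => //=.
Qed.

Lemma nat_lin2 T (x : seq nat) : all (fun y => y <= (2 ^ T.+1).-1) x ->
  exists xi x', [/\ size xi = size x, size x' = size x, all (fun y => y <= (2 ^ T).-1) x' &
    x = lin2 (bitn xi) x'].
Proof.
move=> Hx; exists (map odd x), (map half x); rewrite !size_map; split => //.
- apply/allP => _ /mapP[y /(allP Hx) Hy ->]; move: Hy.
  have : 0 < 2 ^ T by rewrite expn_gt0. rewrite expnS; lia.
- by elim: x {Hx} => //= y x IH; rewrite {1}IH /lin2 /= odd_double_half.
Qed.

(** Each round guesses the lowest bits of the unknowns and leaves their halves to the remaining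
    rounds, just as the counters lose their lowest bits. The induction on [fuel] therefore ranges
    over all start sets and counters, and the guesses assemble to one vector [x]. *)
Lemma runSP fuel S cnts c' : size cnts = n1 -> all okc S ->
  (c' \in (runS (trans_table FL K n1 n2) S cnts fuel).1) <->
  exists2 c, c \in S & exists x, [/\ size x = n2, all (fun y => y <= (2 ^ size fuel).-1) x &
    c' = carry FL K (size fuel) c (low (size fuel) cnts ++ x)].
Proof.
rewrite /runS; elim: fuel S cnts => [|b fuel IH] S cnts Hs HS /=.
  (* Without rounds every coordinate is at most 2 ^ 0 - 1 = 0, so [carry] returns its start
     vector. *)
  have Hc c x : okc c -> size x = n2 -> all (fun y => y <= (2 ^ 0).-1) x ->
     carry FL K 0 c (low 0 cnts ++ x) = c.
    move=> /andP[/eqP Hc _] _ Hx.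
    have H0 f : dot f (low 0 cnts ++ x) = 0.
      have := @dot_le f (low 0 cnts ++ x) 0; rewrite muln0 leqn0 => H.
      apply/eqP/H; rewrite all_cat Hx andbT.
      by apply/allP => _ /mapP[y _ ->]; rewrite take0.
    rewrite /carry; elim: (FL) c Hc => [|f l IHl] [|y c] //= [Hc].
    by rewrite IHl // !H0 muln0 !addn0 divn1.
  split=> [H|[c H [x [H1 H2 ->]]]]; last by rewrite Hc //; apply: (allP HS).
  exists c' => //; exists (nseq n2 0); rewrite size_nseq; split => //.
    by apply/allP => y; rewrite mem_nseq => /andP[_ /eqP->].
  by rewrite Hc ?size_nseq //; [apply: (allP HS)|apply/allP => y; rewrite mem_nseq => /andP[_ /eqP->]].
set e := map (head false) cnts; have He : size e = n1 by rewrite size_map.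
rewrite IH ?size_map //; last first.
  apply/allP => c1 /(stepSP _ He HS)[c Hc [xi _ ->]].
  by rewrite /bitn -map_cat; apply: okc_nxt; apply: (allP HS).
split.
- case=> c1 /(stepSP _ He HS)[c Hc [xi Hxi ->]] [x' [Hx' Hx'2 ->]].
  exists c => //; exists (lin2 (bitn xi) x'); split.
  + by rewrite size_lin2 size_map ?Hxi.
  + apply/allP => _ /mapP[y /zip_mem[Hy1 Hy2] ->]; apply: pow2_pred_lin.
      by apply: (allP (bitn_le1 xi)).
    exact: (allP Hx'2).
  + rewrite low_lin2 carry_nxt //; first by rewrite !size_map.
    * by rewrite Hxi.
    * by apply/allP => _ /mapP[y _ ->]; apply: bval_take_le.
- case=> c Hc [x [Hx1 Hx2 ->]].
  have [xi [x' [H1 H2 H3 Ex]]] := nat_lin2 Hx2.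
  exists (nxt FL K c (bitn e ++ bitn xi)).
    by apply/(stepSP _ He HS); exists c => //; exists xi => //; rewrite H1.
  exists x'; split => //; first by rewrite H2.
  rewrite low_lin2 {1}Ex carry_nxt //; first by rewrite !size_map.
  + by rewrite H1 H2.
  + by apply/allP => _ /mapP[y _ ->]; apply: bval_take_le.
Qed.

(** Started at K, the final carry is K plus the quotient of pos.u - neg.u by 2 ^ T rounded down,
    which is at least K iff the form is nonnegative. The bound on [u] keeps the subtraction
    exact. *)
Lemma carry_sign T u : all (fun y => y <= (2 ^ T).-1) u ->
  map (leq K) (carry FL K T (nseq (size FL) K) u) = [seq dot f.2 u <= dot f.1 u | f <- FL].
Proof.
move=> Hu; rewrite /carry; elim: (FL) HK => //= f l IH /andP[/andP[_ Hf] /IH ->]; congr (_ :: _).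
have Hp : 0 < 2 ^ T by rewrite expn_gt0.
rewrite leq_divRL //.
have Hd : dot f.2 u <= K * (2 ^ T).-1.
  by apply: leq_trans (dot_le _ Hu) _; rewrite leq_mul2r Hf orbT.
have -> : K * 2 ^ T = K + K * (2 ^ T).-1 by nia.
move: (K * _) Hd => M Hd; lia.
Qed.

Theorem nfaP fuel (cnts : seq (seq bool)) g : size cnts = n1 ->
  all (fun b => size b <= size fuel) cnts ->
  (exists2 c, c \in (runS (trans_table FL K n1 n2) [:: nseq (size FL) K] cnts fuel).1 &
     map (leq K) c = g) <->
  exists x, [/\ size x = n2, all (fun y => y <= (2 ^ size fuel).-1) x &
    [seq dot f.2 (map bval cnts ++ x) <= dot f.1 (map bval cnts ++ x) | f <- FL] = g].
Proof.
move=> Hs Hb; have Hok : all okc [:: nseq (size FL) K].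
  rewrite /= andbT /okc size_nseq eqxx; apply/allP => y; rewrite mem_nseq => /andP[_ /eqP->]; lia.
have El : low (size fuel) cnts = map bval cnts.
  by apply/eq_in_map => b /(allP Hb) H; rewrite take_oversize.
have Hlow : all (fun y => y <= (2 ^ size fuel).-1) (map bval cnts).
  by rewrite -El; apply/allP => _ /mapP[y _ ->]; apply: bval_take_le.
split.
- case=> c /(runSP _ _ Hs Hok)[c0]; rewrite inE => /eqP-> [x [Hx1 Hx2 ->]] <-.
  exists x; split => //; rewrite El carry_sign //.
  by rewrite all_cat Hlow.
- case=> x [Hx1 Hx2 <-]; exists (carry FL K (size fuel) (nseq (size FL) K) (low (size fuel) cnts ++ x)).
    by apply/(runSP _ _ Hs Hok); exists (nseq (size FL) K); rewrite ?inE //; exists x.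
  by rewrite El carry_sign // all_cat Hlow.
Qed.
End NFA.

Import Order.TTheory GRing.Theory Num.Theory.

(** * Winners as functions of the order of the pairwise counts *)

Definition npair := (nat * nat)%type.

Definition cpairs m : seq npair := [seq (a, b) | a <- iota 0 m, b <- iota 0 m].

(* L lists the pairs (P, Q) of ordered pairs of candidates such that P is preferred at most as often as Q. *)
Definition LEspec m votes (L : seq (npair * npair)) :=
  forall P Q, P \in cpairs m -> Q \in cpairs m ->
    ((P, Q) \in L) = (Npref votes P.1 P.2 <= Npref votes Q.1 Q.2).

Lemma cpairsE m P : (P \in cpairs m) = (P.1 < m) && (P.2 < m).
Proof.
apply/allpairsP/idP => [[[a b] /= [Ha Hb ->]]|/andP[H1 H2]].
  by move: Ha Hb; rewrite !mem_iota !add0n => /andP[_ ->] /andP[_ ->].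
by exists P; rewrite !mem_iota /= H1 H2; case: P {H1 H2}.
Qed.

Lemma Npref_compl m votes a b : all (valid_vote m) votes -> a < m -> b < m -> a != b ->
  Npref votes a b + Npref votes b a = size votes.
Proof.
move=> Hv Ha Hb Hab; rewrite /Npref -(count_predC (fun v => prefers v a b)); congr (_ + _).
apply/eq_in_count => v /(allP Hv) Hp; rewrite /prefers /= -leqNgt [LHS]ltn_neqAle.
case: eqP => //= E; case/eqP: Hab.
have Hin x : x < m -> x \in v by move=> Hx; rewrite (perm_mem Hp) mem_iota.
by rewrite -(nth_index 0 (Hin a Ha)) -(nth_index 0 (Hin b Hb)) E.
Qed.

(** For distinct a and b, [Npref_compl] gives D(a, b) = 2 N(a, b) - n, where n is the number of
    voters. *)
Lemma D_le m votes P Q : all (valid_vote m) votes -> P \in cpairs m -> Q \in cpairs m ->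
  P.1 != P.2 -> Q.1 != Q.2 ->
  (D votes P.1 P.2 <= D votes Q.1 Q.2)%R = (Npref votes P.1 P.2 <= Npref votes Q.1 Q.2).
Proof.
rewrite !cpairsE => Hv /andP[H1 H2] /andP[H3 H4] H5 H6.
have := Npref_compl Hv H1 H2 H5; have := Npref_compl Hv H3 H4 H6.
rewrite /D; lia.
Qed.

(** * Schulze winners through comparisons of edges *)

Definition edges (c : nat) (l : seq nat) : seq npair := zip (c :: l) l.

Lemma edges_ok m c l : all (fun x => x < m) (c :: l) -> uniq (c :: l) ->
  forall e, e \in edges c l -> (e \in cpairs m) && (e.1 != e.2).
Proof.
elim: l c => [|d l IH] c //= /and3P[Hc Hd Hl] /andP[Hcl Hu] e.
rewrite inE => /orP[/eqP->|He]; last by apply: (IH d) => //=; rewrite Hd.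
by rewrite cpairsE Hc Hd /=; apply: contra Hcl => /eqP->; rewrite inE eqxx.
Qed.

Lemma strength_ge votes z c l : l != [::] ->
  (z <= strength votes c l)%R = all (fun e => (z <= D votes e.1 e.2)%R) (edges c l).
Proof.
elim: l c => [|d l IH] c // _; case: l IH => [|d' l] IH; first by rewrite /= andbT.
rewrite [strength _ _ _]/= le_min [edges _ _]/= [all _ _]/= IH //.
Qed.

Lemma strength_mem votes c l : l != [::] ->
  exists2 e, e \in edges c l & strength votes c l = D votes e.1 e.2.
Proof.
elim: l c => [|d l IH] c // _; case: l IH => [|d' l] IH.
  by exists (c, d); rewrite //= inE eqxx.
have [//|e He E] := IH d; rewrite [strength _ _ _]/=.
case: (leP (D votes c d)) => _; first by exists (c, d); rewrite //= inE eqxx.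
by exists e => //; rewrite [edges _ _]/= inE He orbT.
Qed.

(** A minimum is attained on some edge. The right-hand side consists of comparisons of single edges,
    which can be read off the order of the counts. *)
Lemma strength_le votes c l c' l' : l != [::] -> l' != [::] ->
  (strength votes c' l' <= strength votes c l)%R =
  has (fun e' => all (fun e => (D votes e'.1 e'.2 <= D votes e.1 e.2)%R) (edges c l)) (edges c' l').
Proof.
move=> Hl Hl'; apply/idP/hasP.
- move=> H; have [e He E] := strength_mem votes c' Hl'; exists e => //.
  by rewrite -strength_ge // -E.
- case=> e He; rewrite -strength_ge //; apply: le_trans.
  by have := lexx (strength votes c' l'); rewrite strength_ge // => /allP /(_ e He).
Qed.

Definition uniqb (s : seq nat) : bool :=
  (foldl (fun (st : bool * seq nat) x => (st.1 && ~~ (x \in st.2), x :: st.2)) (true, [::]) s).1.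

Lemma uniqbE s : uniqb s = uniq s.
Proof.
rewrite /uniqb; suff H b r : (foldl (fun (st : bool * seq nat) x =>
    (st.1 && ~~ (x \in st.2), x :: st.2)) (b, r) s).1 = b && (uniq s && ~~ has (mem r) s).
  by rewrite H (@eq_has _ _ pred0) // has_pred0 andbT.
elim: s b r => [|x s IH] b r /=; first by rewrite andbT.
rewrite IH (@eq_has _ (mem (x :: r)) (predU (pred1 x) (mem r))); last by move=> y; rewrite /= inE.
rewrite has_predU has_pred1 -/(x \in r); case: (x \in r); case: (x \in s); case: b; case: (uniq s) => //=.
Qed.

Definition paths m c d : seq (seq nat) :=
  [seq l <- flatten [seq words (iota 0 m) n | n <- iota 0 m.+1] |
    [&& ~~ (l == [::]), last c l == d & uniqb (c :: l)]].

(** A simple path repeats no candidate, so its length is bounded by [m] and all of them can be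
    enumerated. *)
Lemma pathsP m c d l : c < m -> l \in paths m c d <-> spath m c d l.
Proof.
move=> Hc; rewrite mem_filter uniqbE /spath; split.
- case/andP => /and3P[H1 /eqP H2 H3] /flattenP[_ /mapP[n _ ->]].
  rewrite wordsP => /andP[_ H4]; split => //; split => //; split => //=; rewrite Hc.
  by apply: sub_all H4 => x; rewrite /= mem_iota.
- case=> H1 [H2 [H3 H4]]; have {}H4 : all (fun x => x < m) l by case/andP: H4.
  rewrite H1 H2 eqxx H3 andbT.
  have Hall : all (mem (iota 0 m)) l by apply: sub_all H4 => x; rewrite /= mem_iota.
  apply/flattenP; exists (words (iota 0 m) (size l)); last by rewrite wordsP eqxx.
  apply/mapP; exists (size l) => //; rewrite mem_iota /= add0n ltnS.
  rewrite -[leqRHS](size_iota 0 m); apply: uniq_leq_size; first by case/andP: H3.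
  exact/allP.
Qed.

Definition schulzeb m (L : seq (npair * npair)) c : bool :=
  (c < m) && all (fun d => (d == c) || has (fun l => all (fun l' =>
    has (fun e' => all (fun e => (e', e) \in L) (edges c l)) (edges d l'))
    (paths m d c)) (paths m c d)) (iota 0 m).

Lemma schulzebP m votes L c : all (valid_vote m) votes -> LEspec m votes L ->
  schulze_winner m votes c <-> schulzeb m L c.
Proof.
move=> Hv HL; rewrite /schulze_winner /schulzeb.
case: (ltnP c m) => Hc; last by split=> [[]|].
have Hst d l l' : spath m c d l -> spath m d c l' ->
  (strength votes d l' <= strength votes c l)%R =
  has (fun e' => all (fun e => (e', e) \in L) (edges c l)) (edges d l').
  move=> [H1 [_ [H2 H3]]] [K1 [_ [K2 K3]]]; rewrite strength_le //.
  apply: eq_in_has => e' /(edges_ok K3 K2)/andP[E1 E2].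
  apply: eq_in_all => e /(edges_ok H3 H2)/andP[F1 F2].
  by rewrite HL // (D_le Hv).
split.
- case=> _ H; apply/allP => d; rewrite mem_iota /= add0n => Hd.
  case: eqP => //= /(H d Hd)[l [Hl Hl']]; apply/hasP; exists l; first exact/pathsP.
  by apply/allP => l' /(pathsP _ _ Hd) Hp; rewrite -Hst //; apply: Hl'.
- move=> /allP H; split => // d Hd Hdc; have := H d; rewrite mem_iota /= add0n => /(_ Hd).
  case: eqP => // _ /hasP[l /(pathsP _ _ Hc) Hl /allP Hl']; exists l; split => // l' Hp.
  by rewrite (Hst d) //; apply/Hl'/pathsP.
Qed.

(** * Ranked pairs through comparisons of counts *)

Definition isort (T : Type) (r : T -> T -> bool) (s : seq T) : seq T :=
  foldl (fun acc x => [seq y <- acc | r y x] ++ x :: [seq y <- acc | ~~ r y x]) [::] s.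

(** Both results are sorted permutations of [s], and by antisymmetry there is only one. The order
    axioms are assumed on [P] alone because a tie-breaking order is linear only on genuine pairs of
    candidates. Insertion sort is a fold, a form for which computability is automatic. *)
Lemma isort_sort (T : eqType) (P : pred T) (r : rel T) (s : seq T) :
  {in P &, total r} -> {in P & &, transitive r} -> {in P &, antisymmetric r} ->
  all P s -> sort r s = isort r s.
Proof.
move=> Htot Htr Has Hs.
have H acc s' : all P acc -> all P s' -> pairwise r acc ->
  let t := foldl (fun acc x => [seq y <- acc | r y x] ++ x :: [seq y <- acc | ~~ r y x]) acc s' in
  [/\ all P t, pairwise r t & perm_eq t (s' ++ acc)].
  elim: s' acc => [|x s' IH] acc Ha /= Hs' Hp; first by [].
  case/andP: Hs' => Hx Hs'; have HP y : y \in acc -> P y by apply: (allP Ha).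
  have [||K1 K2 K3] := IH ([seq y <- acc | r y x] ++ x :: [seq y <- acc | ~~ r y x]) _ Hs'.
  - apply/allP => y; rewrite mem_cat inE !mem_filter.
    by case/or3P=> [/andP[_ /HP]|/eqP->|/andP[_ /HP]].
  - rewrite pairwise_cat /= !pairwise_filter // !andbT; apply/andP; split.
      apply/allrelP => y z; rewrite mem_filter inE mem_filter => /andP[Hy Hya].
      case/orP=> [/eqP->//|/andP[Hz Hza]].
      apply: (Htr x) => //; rewrite ?HP //; try exact: HP.
      by have := Htot x z Hx (HP _ Hza); rewrite (negbTE Hz) orbF.
    apply/allP => z; rewrite mem_filter => /andP[Hz Hza].
    by have := Htot x z Hx (HP _ Hza); rewrite (negbTE Hz) orbF.
  split => //; apply: perm_trans K3 _.
  have HA : perm_eq ([seq y <- acc | r y x] ++ x :: [seq y <- acc | ~~ r y x]) (x :: acc).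
    by rewrite -[x :: filter _ _]cat1s perm_catCA /= perm_cons perm_filterC.
  apply: (@perm_trans _ (s' ++ x :: acc)); first by rewrite perm_cat2l.
  by rewrite -[x :: acc]cat1s perm_catCA.
have [K1 K2 K3] := H [::] s isT Hs isT; rewrite cats0 in K3.
have Hm y : y \in s -> P y by apply: (allP Hs).
apply: (@sorted_eq_in _ r).
- by move=> x y z; rewrite !mem_sort => /Hm Hx /Hm Hy /Hm Hz; apply: Htr.
- by move=> x y; rewrite !mem_sort => /Hm Hx /Hm Hy; apply: Has.
- exact: (sort_sorted_in Htot).
- exact: pairwise_sorted.
- by rewrite perm_sort perm_sym.
Qed.

(** The orientation of the pair that attains the maximum in [pair_weight]. *)
Definition topp (L : seq (npair * npair)) (P : npair) : npair :=
  if ((P.2, P.1), P) \in L then P else (P.2, P.1).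

Definition beforeb (tpb : npair -> npair -> bool) (L : seq (npair * npair)) (P Q : npair) : bool :=
  ~~ ((topp L P, topp L Q) \in L) ||
  (((topp L Q, topp L P) \in L) && ((P == Q) || tpb P Q)).

Definition orientb (tcb : nat -> nat -> bool) (L : seq (npair * npair)) (P : npair) : npair :=
  if ~~ ((P, (P.2, P.1)) \in L) then P
  else if ~~ (((P.2, P.1), P) \in L) then (P.2, P.1)
  else if tcb P.1 P.2 then P else (P.2, P.1).

(** Whereas [reach] branches forward from [x], here the set of all points from which [y] can be
    reached grows by iteration, a form covered by the closure lemmas. *)
Definition reachb (E : seq npair) f x y : bool :=
  x \in iter f (fun X => [seq e.1 | e <- E & (e.2 == y) || (e.2 \in X)]) [::].

Definition fixedb (tcb : nat -> nat -> bool) (tpb : npair -> npair -> bool) m (L : seq (npair * npair)) : seq npair :=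
  foldl (fun E P => if reachb E m (orientb tcb L P).1 (orientb tcb L P).2
                    || reachb E m (orientb tcb L P).2 (orientb tcb L P).1
                    then E else orientb tcb L P :: E)
    [::] (isort (beforeb tpb L) [seq P <- cpairs m | P.1 < P.2]).

Definition rpb (tcb : nat -> nat -> bool) (tpb : npair -> npair -> bool) m (L : seq (npair * npair)) c : bool :=
  (c < m) && all (fun d => (d == c) || reachb (fixedb tcb tpb m L) m c d) (iota 0 m).

Lemma reachbE E f x y : reach E f x y = reachb E f x y.
Proof.
elim: f x => //= f IH x; rewrite /reachb iterS; apply/orP/mapP.
- case=> [H|/hasP[e He /andP[/eqP <- H]]].
    by exists (x, y); rewrite // mem_filter eqxx.
  by exists e; rewrite // mem_filter He -/(reachb E f e.2 y) -IH H orbT.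
- case=> e; rewrite mem_filter -/(reachb E f e.2 y) -IH => /andP[/orP[/eqP Hy|Hr] He] Ex.
    by left; rewrite Ex -Hy; case: e {Ex Hy} He.
  by right; apply/hasP; exists e => //; rewrite Ex eqxx.
Qed.

Lemma upair_all m : all_upairs m = [seq P <- cpairs m | P.1 < P.2].
Proof.
apply/eq_in_filter => P; rewrite cpairsE => /andP[_ H].
by rewrite /upair H andbT.
Qed.

Section RankedPairs.
Variables (tc : cand_tiebreak) (tp : pair_tiebreak).
Variables (tcb : nat -> nat -> nat -> bool) (tpb : nat -> npair -> npair -> bool).
Hypothesis Htp : forall m, strict_linear (upair m) (tp m).
Hypothesis Etc : forall m a b, a < m -> b < m -> tc m a b = tcb m a b.
Hypothesis Etp : forall m P Q, upair m P -> upair m Q -> tp m P Q = tpb m P Q.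
Variables (m : nat) (votes : seq vote) (L : seq (npair * npair)).
Hypotheses (Hv : all (valid_vote m) votes) (HL : LEspec m votes L).

Lemma upairP P : upair m P -> [/\ P \in cpairs m, (P.2, P.1) \in cpairs m, P.1 != P.2 & P.2 != P.1].
Proof.
case: P => a b /andP[/= H1 H2]; rewrite !cpairsE /= H2 (ltn_trans H1 H2).
by rewrite eq_sym (gtn_eqF H1).
Qed.

Lemma toppP P : upair m P -> [/\ topp L P \in cpairs m, (topp L P).1 != (topp L P).2 &
  pair_weight votes P = D votes (topp L P).1 (topp L P).2].
Proof.
move=> HP; have [H1 H2 H3 H4] := upairP HP.
rewrite /topp /pair_weight HL // -(D_le Hv) //.
case: (leP (D votes P.2 P.1) (D votes P.1 P.2)) => H /=; split => //.
Qed.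

Lemma weight_le P Q : upair m P -> upair m Q ->
  (pair_weight votes P <= pair_weight votes Q)%R = ((topp L P, topp L Q) \in L).
Proof.
move=> /toppP[H1 H2 ->] /toppP[H3 H4 ->]; by rewrite (D_le Hv) // HL.
Qed.

Lemma beforeE P Q : upair m P -> upair m Q ->
  rp_before tp m votes P Q = beforeb (tpb m) L P Q.
Proof.
move=> HP HQ; rewrite /rp_before /beforeb -!weight_le // Etp //.
by case: (ltgtP (pair_weight votes P) (pair_weight votes Q)).
Qed.

Lemma before_total : {in upair m &, total (rp_before tp m votes)}.
Proof.
move=> P Q HP HQ; rewrite /rp_before; have [_ [_ Ht]] := Htp m.
case: ltgtP => //= _; rewrite (eq_sym Q P); case: eqP => //= /eqP H.
by apply: Ht.
Qed.

Lemma before_trans : {in upair m & &, transitive (rp_before tp m votes)}.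
Proof.
move=> Q P R HQ HP HR; rewrite /rp_before; have [_ [Ht _]] := Htp m.
case: (ltgtP (pair_weight votes Q) (pair_weight votes P)) => //= H1.
  move=> _ /orP[H2|/andP[/eqP <- _]]; last by rewrite H1.
  by rewrite (lt_trans H2 H1).
move=> H2; rewrite H1; case: ltgtP => //= _.
case/orP: H2 => [/eqP-> //|H2] /orP[/eqP <-|H3]; rewrite ?H2 ?orbT //.
by rewrite (Ht _ _ _ HP HQ HR) ?orbT.
Qed.

Lemma before_anti : {in upair m &, antisymmetric (rp_before tp m votes)}.
Proof.
move=> P Q HP HQ; rewrite /rp_before; have [Hi [Ht _]] := Htp m.
case: ltgtP => //= _; rewrite (eq_sym Q P); case: eqP => //= _ /andP[H1 H2].
by have := Hi _ HP; rewrite (Ht _ _ _ HP HQ HP H1 H2).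
Qed.

Lemma all_upairsP P : P \in all_upairs m -> upair m P.
Proof. by rewrite mem_filter => /andP[]. Qed.

Lemma orientE P : upair m P -> rp_orient tc m votes P = orientb (tcb m) L P.
Proof.
move=> HP; have [H1 H2 H3 H4] := upairP HP.
rewrite /orientb !HL // -!(D_le Hv) // -!ltNge -Etc; last 2 first.
- by move: H1; rewrite cpairsE => /andP[].
- by move: H1; rewrite cpairsE => /andP[].
case: P {HP H1 H2 H3 H4} => a b; rewrite /rp_orient /=.
have -> : (0 < D votes a b)%R = (D votes b a < D votes a b)%R by rewrite /D; lia.
by have -> : (0 < D votes b a)%R = (D votes a b < D votes b a)%R by rewrite /D; lia.
Qed.

(** The given comparison and orientation agree with their counterparts only on the pairs of
    [all_upairs m]. Hence the replacement passes through the insertion sort with the invariant that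
    the accumulator contains only such pairs. *)
Lemma fixedE : rp_fixed tc tp m votes = fixedb (tcb m) (tpb m) m L.
Proof.
have Hall : all (upair m) (all_upairs m) by apply/allP => P /all_upairsP.
rewrite /rp_fixed (isort_sort before_total before_trans before_anti Hall) /fixedb -upair_all.
have Hfold (T S : eqType) (f g : S -> T -> S) s z : (forall z x, x \in s -> f z x = g z x) ->
  foldl f z s = foldl g z s.
  elim: s z => //= x s IH z H; rewrite H ?inE ?eqxx // IH // => z' y Hy.
  by rewrite H // inE Hy orbT.
have Hperm : perm_eq (isort (rp_before tp m votes) (all_upairs m)) (all_upairs m).
  by rewrite -(isort_sort before_total before_trans before_anti Hall) perm_sort.
have Ei : isort (rp_before tp m votes) (all_upairs m) = isort (beforeb (tpb m) L) (all_upairs m).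
  rewrite /isort; have : all (upair m) [::] by [].
  elim: (all_upairs m) Hall [::] => //= P s IH /andP[HP Hs] acc Hacc.
  have E : filter (fun y => rp_before tp m votes y P) acc = filter (fun y => beforeb (tpb m) L y P) acc.
    by apply/eq_in_filter => y /(allP Hacc) Hy; apply: beforeE.
  have E' : filter (fun y => ~~ rp_before tp m votes y P) acc = filter (fun y => ~~ beforeb (tpb m) L y P) acc.
    by apply/eq_in_filter => y /(allP Hacc) Hy; rewrite beforeE.
  rewrite E E'; apply: IH => //; apply/allP => y; rewrite mem_cat inE !mem_filter.
  by case/or3P=> [/andP[_ /(allP Hacc)]|/eqP->|/andP[_ /(allP Hacc)]].
rewrite -Ei; apply: Hfold => E P; rewrite (perm_mem Hperm) => /all_upairsP HP.
by rewrite -orientE // -!reachbE; case: (rp_orient tc m votes P).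
Qed.

Lemma rpbP c : rp_winner tc tp m votes c <-> rpb (tcb m) (tpb m) m L c.
Proof.
rewrite /rp_winner /rpb fixedE; case: (ltnP c m) => Hc; last by split=> [[]|].
split.
- case=> _ H; apply/allP => d; rewrite mem_iota /= add0n => Hd.
  by case: eqP => //= /eqP Hdc; rewrite -reachbE; apply: H.
- move=> /allP H; split => // d Hd Hdc; have := H d; rewrite mem_iota /= add0n => /(_ Hd).
  by rewrite (negbTE Hdc) reachbE.
Qed.
End RankedPairs.

Definition winsb (uniqm : bool) (rb : nat -> bool) m p : bool :=
  rb p && (~~ uniqm || all (fun d => ~~ rb d || (d == p)) (iota 0 m)).

Lemma winsbP uniqm (R : rule) (rb : nat -> bool) m votes p : (forall c, R m votes c <-> rb c) ->
  (forall c, rb c -> c < m) -> wins uniqm R m votes p <-> winsb uniqm rb m p.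
Proof.
move=> HR Hm; rewrite /wins /winsb; case: uniqm => /=; last by rewrite andbT.
split.
- case=> /HR -> H; apply/allP => d _; case E: (rb d) => //=; apply/eqP/H; exact/HR.
- case/andP => /HR H1 /allP H2; split => // d /HR Hd.
  have := H2 d; rewrite mem_iota (Hm _ Hd) /= Hd /= => /(_ isT) /eqP; done.
Qed.

(** * Control as a system of linear inequalities *)

(** All words of length [m], hence more than the linear orders. A word that is no linear order has
    count 0 in [W], so the constraint x_t <= w_t admits no added vote of that type. *)
Definition vtypes m : seq vote := words (iota 0 m) m.

Lemma words_uniq (T : eqType) (s : seq T) n : uniq s -> uniq (words s n).
Proof.
move=> Hs; elim: n => //= n IH; apply: allpairs_uniq => //.
by move=> [a b] [c d] _ _ /= [-> ->].
Qed.

Lemma vtypes_uniq m : uniq (vtypes m).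
Proof. exact/words_uniq/iota_uniq. Qed.

Lemma valid_vtypes m v : valid_vote m v -> v \in vtypes m.
Proof.
move=> H; rewrite wordsP (perm_size H) size_iota eqxx /=.
by apply/allP => x; rewrite (perm_mem H).
Qed.

Section Sums.
Variable (T : eqType).
Implicit Types (s : seq T) (f g : T -> nat).

Lemma dot_map f g s : dot (map f s) (map g s) = sumn [seq f t * g t | t <- s].
Proof. by rewrite /dot; elim: s => //= t s ->. Qed.

Lemma sumn_eq0 s g t : t \notin s -> sumn [seq (x == t) * g x | x <- s] = 0.
Proof.
elim: s => //= x s IH; rewrite inE negb_or eq_sym => /andP[/negbTE-> /IH->].
by [].
Qed.

Lemma sumn_eq1 s g t : uniq s -> t \in s -> sumn [seq (x == t) * g x | x <- s] = g t.
Proof.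
elim: s => //= x s IH /andP[Hx Hu]; rewrite inE (eq_sym t).
case: (x =P t) => [E|_] /=; first by subst x; rewrite sumn_eq0 // mul1n addn0.
by rewrite mul0n add0n => /(IH Hu).
Qed.

Lemma sumn_add s f g h : sumn [seq h t * (f t + g t) | t <- s] =
  sumn [seq h t * f t | t <- s] + sumn [seq h t * g t | t <- s].
Proof. by elim: s => //= t s ->; lia. Qed.

Lemma count_sumn (a : pred T) s ts : uniq ts -> all (mem ts) s ->
  count a s = sumn [seq a t * count_mem t s | t <- ts].
Proof.
move=> Hu; elim: s => [|y s IH] /=.
  move=> _; symmetry; elim: (ts) => //= t l ->; by rewrite muln0.
case/andP => Hy /IH ->; rewrite -(sumn_eq1 (fun t => nat_of_bool (a t)) Hu Hy).
elim: (ts) => //= t l <-; rewrite (eq_sym y); lia.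
Qed.
End Sums.

Definition prefvec m (P : npair) : seq nat := [seq nat_of_bool (prefers t P.1 P.2) | t <- vtypes m].
Definition constvec m n : seq nat := [seq n | t <- vtypes m].
Definition unitvec m (t0 : vote) : seq nat := [seq nat_of_bool (t == t0) | t <- vtypes m].

(* Coordinates: the counts in V, the counts in W, the bound k, the counts of the added votes. *)
Definition forms_bound m : seq lform :=
  rcons [seq (constvec m 0 ++ unitvec m t ++ 0 :: constvec m 0,
              constvec m 0 ++ constvec m 0 ++ 0 :: unitvec m t) | t <- vtypes m]
    (constvec m 0 ++ constvec m 0 ++ 1 :: constvec m 0,
     constvec m 0 ++ constvec m 0 ++ 0 :: constvec m 1).

Definition cpairs2 m : seq (npair * npair) := [seq (P, Q) | P <- cpairs m, Q <- cpairs m].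

(** For z = (P, Q) this is the form N(Q) - N(P) taken over [V] and the added votes. *)
Definition forms_pref m : seq lform :=
  [seq (prefvec m z.2 ++ constvec m 0 ++ 0 :: prefvec m z.2,
        prefvec m z.1 ++ constvec m 0 ++ 0 :: prefvec m z.1) | z <- cpairs2 m].

Definition forms m := forms_bound m ++ forms_pref m.

Definition kbound (FL : seq lform) : nat := sumn [seq sumn f.1 + sumn f.2 | f <- FL].

Lemma kboundP FL : all (fun f : lform => (sumn f.1 <= kbound FL) && (sumn f.2 <= kbound FL)) FL.
Proof.
rewrite /kbound; elim: FL => //= f FL IH; apply/andP; split; first by lia.
by apply: sub_all IH => g; lia.
Qed.

Definition vec4 m (v w : vote -> nat) k (x : vote -> nat) : seq nat :=
  map v (vtypes m) ++ map w (vtypes m) ++ k :: map x (vtypes m).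

Lemma dot_vec4 m a b c d v w k x :
  dot (map a (vtypes m) ++ map b (vtypes m) ++ c :: map d (vtypes m)) (vec4 m v w k x) =
  sumn [seq a t * v t | t <- vtypes m] + sumn [seq b t * w t | t <- vtypes m] + c * k +
  sumn [seq d t * x t | t <- vtypes m].
Proof.
rewrite /vec4 !dot_cat ?size_map // -![_ :: map _ _]cat1s dot_cat // !dot_map.
by rewrite /dot /= addn0 !addnA.
Qed.

Lemma sumn0 (T : eqType) (s : seq T) f : sumn [seq 0 * f t | t <- s] = 0.
Proof. by elim: s. Qed.

Definition sgn (u : seq nat) (f : lform) : bool := dot f.2 u <= dot f.1 u.

Lemma sgn_bound m v w k x : all id (map (sgn (vec4 m v w k x)) (forms_bound m)) =
  all (fun t => x t <= w t) (vtypes m) && (sumn (map x (vtypes m)) <= k).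
Proof.
rewrite all_map /forms_bound all_rcons andbC all_map; congr (_ && _).
- apply: eq_in_all => t Ht; rewrite /= /sgn !dot_vec4 !sumn0 !sumn_eq1 ?vtypes_uniq //.
  by rewrite mul0n !addn0 !add0n.
- rewrite /= /sgn !dot_vec4 !sumn0 mul0n mul1n !addn0 !add0n; congr (sumn _ <= _).
  by apply: eq_map => t; rewrite mul1n.
Qed.

Lemma sgn_pref m v w k x z :
  sgn (vec4 m v w k x) (prefvec m z.2 ++ constvec m 0 ++ 0 :: prefvec m z.2,
        prefvec m z.1 ++ constvec m 0 ++ 0 :: prefvec m z.1) =
  (sumn [seq prefers t z.1.1 z.1.2 * (v t + x t) | t <- vtypes m] <=
   sumn [seq prefers t z.2.1 z.2.2 * (v t + x t) | t <- vtypes m]).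
Proof. by rewrite /sgn !dot_vec4 !sumn0 !sumn_add !addn0. Qed.

Definition true_pairs m (g : seq bool) : seq (npair * npair) :=
  [seq z.1 | z <- zip (cpairs2 m) (drop (size (forms_bound m)) g) & z.2].

(** The first part of the sign pattern must be nonnegative throughout, which makes the added votes
    admissible; the second part is decoded to the relation from which the winners are determined.
    Destructive control is the same test with the opposite value. *)
Definition accg (rb : nat -> seq (npair * npair) -> nat -> bool) uniqm constr m (g : seq bool) p : bool :=
  all id (take (size (forms_bound m)) g) &&
  (winsb uniqm (rb m (true_pairs m g)) m p == constr).

Lemma zip_map_filter (T : Type) (s : seq T) (f : T -> bool) :
  [seq z.1 | z <- zip s (map f s) & z.2] = filter f s.
Proof. by elim: s => //= t s IH; case: (f t); rewrite /= IH. Qed.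

Lemma true_pairsE m u : true_pairs m (map (sgn u) (forms m)) =
  [seq z <- cpairs2 m | sgn u (prefvec m z.2 ++ constvec m 0 ++ 0 :: prefvec m z.2,
        prefvec m z.1 ++ constvec m 0 ++ 0 :: prefvec m z.1)].
Proof.
by rewrite /true_pairs map_cat drop_size_cat ?size_map // -map_comp zip_map_filter.
Qed.

Lemma map_nth_index (T : eqType) (s : seq T) (x : seq nat) : uniq s -> size x = size s ->
  map (fun t => nth 0 x (index t s)) s = x.
Proof.
move=> Hu Hs; apply: (@eq_from_nth _ 0) => [|i]; rewrite size_map // => Hi.
case: s Hu Hs Hi => // t0 s Hu Hs Hi.
by rewrite (nth_map t0) // index_uniq.
Qed.

Section Control.
Variables (R : rule) (rb : nat -> seq (npair * npair) -> nat -> bool).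
Hypothesis HR : forall m votes L, all (valid_vote m) votes -> LEspec m votes L ->
  forall c, R m votes c <-> rb m L c.
Hypothesis Hrb : forall m L c, rb m L c -> c < m.

Definition nfa_accepts uniqm constr m p fuel cnts :=
  exists2 c, c \in (runS (trans_table (forms m) (kbound (forms m)) (2 * size (vtypes m)).+1 (size (vtypes m)))
      [:: nseq (size (forms m)) (kbound (forms m))] cnts fuel).1 &
    accg rb uniqm constr m (map (leq (kbound (forms m))) c) p.

Lemma bval_lt b : bval b <= (2 ^ size b).-1.
Proof. by elim: b => //= x b IH; apply: pow2_pred_lin => //; apply: leq_b1. Qed.

(** Only the multiplicities of the votes in [Q] matter. A solution [Q] gives the vector of its
    multiplicities; conversely a vector bounded by the multiplicities in [W] is realised by a
    subsequence of [W]. In both directions the signs of the preference forms satisfy [LEspec] for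
    [V ++ Q]. *)
Theorem control_nfa uniqm constr m V W p k fuel cnts :
  all (valid_vote m) V -> all (valid_vote m) W ->
  map bval cnts = map (fun t => count_mem t V) (vtypes m) ++ map (fun t => count_mem t W) (vtypes m) ++ [:: k] ->
  all (fun b => size b <= size fuel) cnts ->
  control_yes R uniqm constr (NInst m V W p k) <-> nfa_accepts uniqm constr m p fuel cnts.
Proof.
move=> HV HW Hc Hb; set N := size (vtypes m).
have Hsize : size cnts = (2 * N).+1.
  rewrite -(size_map bval) Hc !size_cat !size_map /= -/N; by rewrite addn1 addnS addnn mul2n.
have Hnfa g : (exists2 c, c \in (runS (trans_table (forms m) (kbound (forms m)) (2 * N).+1 N)
      [:: nseq (size (forms m)) (kbound (forms m))] cnts fuel).1 &
      map (leq (kbound (forms m))) c = g) <->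
   exists x : vote -> nat, all (fun t => x t <= (2 ^ size fuel).-1) (vtypes m) /\
    map (sgn (vec4 m (fun t => count_mem t V) (fun t => count_mem t W) k x)) (forms m) = g.
  apply: (iff_trans (nfaP N (kboundP (forms m)) g Hsize Hb)); split.
  - case=> x [Hx1 Hx2 Hg]; exists (fun t => nth 0 x (index t (vtypes m))); split.
      apply/allP => t Ht; apply: (allP Hx2); apply: mem_nth.
      by rewrite Hx1 index_mem.
    by rewrite -Hg /sgn /vec4 map_nth_index ?vtypes_uniq // Hc -!catA.
  - case=> x [Hx <-]; exists (map x (vtypes m)); rewrite size_map all_map; split => //.
    by rewrite Hc -!catA.
(* The fuel offers enough bits for the unknowns: they are bounded by the counts in [W], and these
   are among the numbers read. *)
have Hpos : all (fun t => count_mem t W <= (2 ^ size fuel).-1) (vtypes m).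
  apply/allP => t Ht; have : count_mem t W \in map bval cnts.
    by rewrite Hc !mem_cat (map_f (fun t => count_mem t W)) ?orbT.
  case/mapP => b Hbb ->; apply: leq_trans (bval_lt b) _.
  have := allP Hb _ Hbb; rewrite /= => Hle.
  by have := leq_pexp2l (isT : 0 < 2) Hle; lia.
have Hwin x Q : all (valid_vote m) Q -> (forall t, t \in vtypes m -> count_mem t Q = x t) ->
  forall c, R m (V ++ Q) c <-> rb m (true_pairs m
    (map (sgn (vec4 m (fun t => count_mem t V) (fun t => count_mem t W) k x)) (forms m))) c.
  move=> HQ Hx; apply: HR; first by rewrite all_cat HV.
  move=> P P' HP HP'; rewrite true_pairsE mem_filter sgn_pref /=.
  have -> : (P, P') \in cpairs2 m by apply/allpairsP; exists (P, P').
  rewrite andbT.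
  have HVQ : all (mem (vtypes m)) (V ++ Q).
    apply/allP => v Hv; apply: valid_vtypes.
    by move: Hv; rewrite mem_cat => /orP[/(allP HV)|/(allP HQ)].
  rewrite /Npref !(count_sumn _ (vtypes_uniq m) HVQ).
  congr (sumn _ <= sumn _); apply/eq_in_map => t Ht; by rewrite count_cat Hx.
have Hyes x Q : all (valid_vote m) Q -> (forall t, t \in vtypes m -> count_mem t Q = x t) ->
  (if constr then wins uniqm R m (V ++ Q) p else ~ wins uniqm R m (V ++ Q) p) <->
  winsb uniqm (rb m (true_pairs m
    (map (sgn (vec4 m (fun t => count_mem t V) (fun t => count_mem t W) k x)) (forms m)))) m p == constr.
  move=> HQ Hx; have Hw := winsbP uniqm p (Hwin x Q HQ Hx) (fun c => Hrb (c := c)).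
  case: constr; rewrite Hw; case: winsb => //; split => // /(_ isT); done.
have Htake x : take (size (forms_bound m)) (map (sgn x) (forms m)) = map (sgn x) (forms_bound m).
  by rewrite map_cat take_size_cat ?size_map.
rewrite /nfa_accepts -/N; split.
- case=> Q /= [HQ [Hk HQw]].
  have HQv : all (valid_vote m) Q by apply/allP => v /(mem_subseq HQ) /(allP HW).
  have [c Hc1 Hc2] : exists2 c, c \in (runS (trans_table (forms m) (kbound (forms m)) (2 * N).+1 N)
      [:: nseq (size (forms m)) (kbound (forms m))] cnts fuel).1 &
      map (leq (kbound (forms m))) c = map (sgn (vec4 m (fun t => count_mem t V) (fun t => count_mem t W) k (fun t => count_mem t Q))) (forms m).
    apply/Hnfa; exists (fun t => count_mem t Q); split => //.
    apply/allP => t Ht; apply: leq_trans (allP Hpos _ Ht); exact: leq_count_subseq.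
  exists c => //; rewrite Hc2 /accg Htake sgn_bound.
  have -> /= : all (fun t => count_mem t Q <= count_mem t W) (vtypes m).
    by apply/allP => t _; apply: leq_count_subseq.
  have -> /= : sumn [seq count_mem t Q | t <- vtypes m] <= k.
    have HQt : all (mem (vtypes m)) Q by apply/allP => v /(allP HQv) /valid_vtypes.
    apply: leq_trans Hk; rewrite -(count_predT Q) (count_sumn predT (vtypes_uniq m) HQt).
    by rewrite leq_eqVlt; apply/orP; left; apply/eqP; congr sumn; apply: eq_map => t; rewrite mul1n.
  exact/(Hyes _ Q HQv).
- case=> c Hc1 Hc2.
  have [x [Hx1 Hx2]] : exists x : vote -> nat, all (fun t => x t <= (2 ^ size fuel).-1) (vtypes m) /\
    map (sgn (vec4 m (fun t => count_mem t V) (fun t => count_mem t W) k x)) (forms m) = map (leq (kbound (forms m))) c.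
    by apply/Hnfa; exists c.
  move: Hc2; rewrite -Hx2 /accg Htake sgn_bound => /andP[/andP[/allP Hle Hk] Hw].
  (* A list with the prescribed multiplicities. [count_subseqP] rearranges it into a subsequence of
     [W]. *)
  pose s := flatten [seq nseq (x t) t | t <- vtypes m].
  have Hcs t : count_mem t s = (t \in vtypes m) * x t.
    rewrite /s count_flatten -map_comp.
    rewrite (eq_map (g := fun t' => (t' == t) * x t')) /=; last by move=> t'; rewrite /= count_nseq.
    case Ht: (t \in vtypes m); first by rewrite sumn_eq1 ?vtypes_uniq ?mul1n.
    by rewrite sumn_eq0 ?Ht.
  have /count_subseqP[Q HQ Hperm] : forall t, count_mem t s <= count_mem t W.
    by move=> t; rewrite Hcs; case Ht: (t \in vtypes m) => //=; rewrite mul1n; apply: Hle.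
  have HQv : all (valid_vote m) Q by apply/allP => v /(mem_subseq HQ) /(allP HW).
  have HQx t : t \in vtypes m -> count_mem t Q = x t.
    by move=> Ht; move/permP: Hperm => /(_ (pred1 t)) <-; rewrite Hcs Ht mul1n.
  exists Q; split => //; split; last by apply/(Hyes x Q HQv HQx).
  rewrite /= -(perm_size Hperm) /s size_flatten /shape -map_comp.
  by rewrite (eq_map (g := x)) // => t; rewrite /= size_nseq.
Qed.
End Control.

(** * The table attached to the number of candidates is computable *)

Section Basic.
Context (A B : Type) {eA : Enc A} {eB : Enc B}.

Lemma FC_nat_of_bool p (f : A -> bool) : FC p f -> FC p (fun a => nat_of_bool (f a)).
Proof. by move=> H; apply: (FC_comp (g := nat_of_bool) H); apply: FC_coerce => -[]. Qed.

Lemma FC_idf p (f : A -> B) : FC p f -> FC p (fun a => id (f a)).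
Proof. by []. Qed.

Lemma FC_app1 p (C : Type) {eC : Enc C} (F : B -> C) (f : A -> B) :
  FC p F -> FC p f -> FC p (fun a => F (f a)).
Proof. by move=> HF Hf; apply: FC_comp Hf HF. Qed.

End Basic.

Lemma bits_eq n : bits n = if n == 0 then [::] else odd n :: bits n./2.
Proof.
have H f1 f2 k : k <= f1 -> k <= f2 -> bits_aux f1 k = bits_aux f2 k.
  elim: f1 f2 k => [|f1 IH] [|f2] [|k] //= H1 H2; congr (_ :: _); apply: IH; lia.
rewrite {1}/bits; case: n => [|n] //=; congr (_ :: _); apply: H; lia.
Qed.

Lemma FC_bits A {eA : Enc A} (f : A -> nat) : FC false f -> FC false (fun a => bits (f a)).
Proof.
move=> Hf; pose st (x : seq bool * nat) := if x.2 == 0 then x else (odd x.2 :: x.1, x.2./2).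
apply: (FC_eq (f := fun a => rev (iter (f a) st ([::], f a)).1)); last by fc.
move=> a; suff H k n acc : n <= k -> rev (iter k st (acc, n)).1 = rev acc ++ bits n.
  exact: (H _ _ [::]).
elim: k n acc => [|k IH] n acc Hn.
  have -> : n = 0 by lia.
  by rewrite /= cats0.
rewrite iterSr {2}/st /= bits_eq; case: eqP => [->|H0]; first by rewrite IH // cats0.
by rewrite IH ?rev_cons ?cat_rcons //; lia.
Qed.

Section Dot.
Context (A : Type) {eA : Enc A}.

Lemma FC_index (f : A -> nat) (s : A -> seq nat) : FC false f -> FC false s ->
  FC false (fun a => index (f a) (s a)).
Proof.
move=> Hf Hs; apply: (FC_eq (f := fun a => (foldl (fun (x : bool * nat) y =>
   if x.1 then x else if y == f a then (true, x.2) else (false, x.2.+1)) (false, 0) (s a)).2)).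
  move=> a; have H s' n : (foldl (fun (x : bool * nat) y =>
    if x.1 then x else if y == f a then (true, x.2) else (false, x.2.+1)) (true, n) s').2 = n.
    by elim: s'.
  rewrite -[RHS]add0n; elim: (s a) 0 => [|y l IH] n /=; first by rewrite addn0.
  by case: eqP => _; [rewrite H addn0|rewrite IH addSnnS].
fc; by apply: (FC_comp _ Hf); fc.
Qed.

End Dot.

Lemma FC3 p A B C D S {eA : Enc A} {eB : Enc B} {eC : Enc C} {eD : Enc D} {eS : Enc S}
  (F : B -> C -> D -> S) (f : A -> B) (g : A -> C) (h : A -> D) :
  FC p (fun x : B * C * D => F x.1.1 x.1.2 x.2) -> FC p f -> FC p g -> FC p h ->
  FC p (fun a => F (f a) (g a) (h a)).
Proof. by move=> HF Hf Hg Hh; apply: (FC_comp (FC_pair (FC_pair Hf Hg) Hh) HF). Qed.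

Section Take.
Context (A B : Type) {eA : Enc A} {eB : Enc B}.

Lemma FC_drop (n : A -> nat) (f : A -> seq B) : FC false n -> FC false f ->
  FC false (fun a => drop (n a) (f a)).
Proof.
move=> Hn Hf; apply: (FC_eq (f := fun a => iter (n a) behead (f a))); last by fc.
move=> a; elim: (n a) (f a) => [|m IH] s; first by rewrite drop0.
by rewrite iterSr IH; case: s.
Qed.
End Take.

Lemma FC_take A B {eA : Enc A} {eB : Enc B} (n : A -> nat) (f : A -> seq B) :
  FC false n -> FC false f -> FC false (fun a => take (n a) (f a)).
Proof.
move=> Hn Hf; apply: (FC_eq (f := fun a => rev (drop (size (f a) - n a) (rev (f a))))).
  move=> a; rewrite drop_rev revK; case: (leqP (n a) (size (f a))) => H; first by rewrite subKn.
  by rewrite (eqP (ltnW H : _ - _ == 0)) subn0 !take_oversize // ltnW.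
by fc; apply: FC_drop; fc.
Qed.

Ltac fc_ext3 := match goal with
  | |- FC _ (fun a => take (@?n a) (@?f a)) => apply (@FC_take _ _ _ _ n f)
  | |- FC _ (fun a => drop (@?n a) (@?f a)) => apply (@FC_drop _ _ _ _ n f)
  | |- FC _ (fun a => nat_of_bool (@?f a)) => apply (@FC_nat_of_bool _ _ _ f)
  | |- FC _ (fun a => id (@?f a)) => apply (@FC_idf _ _ _ _ _ f)
  | |- FC _ (fun a => bits (@?f a)) => apply (@FC_bits _ _ f)
  | |- FC _ (fun a => @zip _ _ (@?f a) (@?g a)) => apply (@FC_zip _ _ _ _ _ _ f g)
  | |- FC _ (fun a => index (@?f a) (@?g a)) => apply (@FC_index _ _ f g)
  | |- FC _ (fun a => words (@?f a) (@?g a)) => apply (@FC_words _ _ _ _ f g)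
  | |- FC _ (fun a => nth ?x (@?f a) (@?g a)) => apply (@FC_nth _ _ _ _ x f g)
  | H : FC ?p ?F |- FC ?p (fun a => ?F (@?g a)) => apply (@FC_app1 _ _ _ _ _ _ _ F g H)
  | H : FC ?p (fun x => ?F x.1 x.2) |- FC ?p (fun a => ?F (@?f a) (@?g a)) =>
      apply (@FC2 _ _ _ _ _ _ _ _ _ f g F H)
  | H : FC ?p (fun x => ?F x.1.1 x.1.2 x.2) |- FC ?p (fun a => ?F (@?f a) (@?g a) (@?h a)) =>
      apply (@FC3 _ _ _ _ _ _ _ _ _ _ _ F f g h H)
  | _ => fc_ext2
  end.
Ltac fc_ext ::= fc_ext3.

Lemma FC_vtypes : FC false vtypes.
Proof. by rewrite /vtypes; fc. Qed.

Lemma FC_dot : FC false (fun x : seq nat * seq nat => dot x.1 x.2).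
Proof. by rewrite /dot; fc. Qed.

Lemma FC_cpairs : FC false cpairs.
Proof. by rewrite /cpairs; fc. Qed.

Lemma FC_cpairs2 : FC false cpairs2.
Proof. by have H := FC_cpairs; rewrite /cpairs2; fc. Qed.

Lemma FC_prefvec : FC false (fun x : nat * npair => prefvec x.1 x.2).
Proof. by have H := FC_vtypes; rewrite /prefvec /prefers; fc. Qed.

Lemma FC_constvec : FC false (fun x : nat * nat => constvec x.1 x.2).
Proof. by have H := FC_vtypes; rewrite /constvec; fc. Qed.

Lemma FC_unitvec : FC false (fun x : nat * vote => unitvec x.1 x.2).
Proof. by have H := FC_vtypes; rewrite /unitvec; fc. Qed.

Lemma FC_forms_bound : FC false forms_bound.
Proof.
have H := FC_vtypes; have H1 := FC_constvec; have H2 := FC_unitvec.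
rewrite /forms_bound; apply: (FC_eq (fun m => cats1 _ _)); fc.
Qed.

Lemma FC_forms_pref : FC false forms_pref.
Proof.
have H := FC_cpairs2; have H1 := FC_constvec; have H2 := FC_prefvec.
by rewrite /forms_pref; fc.
Qed.

Lemma FC_forms : FC false forms.
Proof. by have H := FC_forms_bound; have H1 := FC_forms_pref; rewrite /forms; fc. Qed.

Lemma FC_kbound : FC false kbound.
Proof. by rewrite /kbound; fc. Qed.

Lemma FC_nxt : FC false (fun x : seq lform * nat * (seq nat * seq nat) => nxt x.1.1 x.1.2 x.2.1 x.2.2).
Proof. by have H := FC_dot; rewrite /nxt; fc. Qed.

Lemma FC_trans_table : FC false (fun x : seq lform * nat * (nat * nat) =>
  trans_table x.1.1 x.1.2 x.2.1 x.2.2).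
Proof.
rewrite /trans_table /bitn; fc.
apply: (FC_comp (f := fun x : seq lform * nat * (nat * nat) * seq nat * (seq bool * seq bool) =>
  ((x.1.1.1.1, x.1.1.1.2), (x.1.2, map nat_of_bool x.2.1 ++ map nat_of_bool x.2.2))) _ FC_nxt).
by fc.
Qed.

Definition Lrel := seq (npair * npair).

Lemma FC_true_pairs : FC false (fun x : nat * seq bool => true_pairs x.1 x.2).
Proof.
have H := FC_cpairs2; have H1 := FC_forms_bound.
by rewrite /true_pairs; fc.
Qed.

Section Rule.
Variable rb : nat -> Lrel -> nat -> bool.
Hypothesis Hrb : FC false (fun x : nat * Lrel * nat => rb x.1.1 x.1.2 x.2).
Variables (uniqm constr : bool).

Lemma FC_winsb : FC false (fun x : nat * Lrel * nat => winsb uniqm (rb x.1.1 x.1.2) x.1.1 x.2).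
Proof. by rewrite /winsb; fc. Qed.

Lemma FC_accg : FC false (fun x : nat * seq bool * nat => accg rb uniqm constr x.1.1 x.1.2 x.2).
Proof.
have H1 := FC_forms_bound; have H2 := FC_true_pairs.
have H : FC false (fun x : nat * seq bool * nat =>
  winsb uniqm (rb x.1.1 (true_pairs x.1.1 x.1.2)) x.1.1 x.2).
  apply: (FC_comp (f := fun x : nat * seq bool * nat =>
    ((x.1.1, true_pairs x.1.1 x.1.2), x.2)) _ FC_winsb); fc.
by rewrite /accg; fc.
Qed.

Definition table := (seq (seq (seq bool)) * seq nat * seq transition * seq (seq nat * seq bool))%type.

(** Vote types and candidates are stored with binary digits, as the parser delivers them, so the
    polynomial part only compares codes. The components are the vote types, the initial carries, the
    transitions, and the accepting pairs of final carries and distinguished candidate. *)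
Definition mktable m : table :=
  let FL := forms m in let K := kbound FL in let N := size (vtypes m) in
  ([seq map bits t | t <- vtypes m],
   nseq (size FL) K,
   trans_table FL K (2 * N).+1 N,
   [seq (z.1, bits z.2) | z <- [seq (c, p) | c <- words (iota 0 (2 * K).+1) (size FL), p <- iota 0 m]
      & accg rb uniqm constr m (map (leq K) z.1) z.2]).

Lemma FC_mktable : FC false mktable.
Proof.
have H := FC_vtypes; have H1 := FC_forms; have H2 := FC_kbound; have H3 := FC_accg.
rewrite /mktable /=; fc.
apply: (FC_comp (f := fun m => ((forms m, kbound (forms m)), ((2 * size (vtypes m)).+1, size (vtypes m)))) _ FC_trans_table).
by fc.
Qed.
End Rule.

Lemma FC_last : FC false (fun x : nat * seq nat => last x.1 x.2).
Proof.
apply: (FC_eq (f := fun x : nat * seq nat => foldl (fun _ y => y) x.1 x.2)); last by fc.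
by case=> c l /=; elim: l c => //=.
Qed.

Lemma FC_edges : FC false (fun x : nat * seq nat => edges x.1 x.2).
Proof. by rewrite /edges; fc. Qed.

Lemma FC_uniqb : FC false uniqb.
Proof. by rewrite /uniqb; fc. Qed.

Lemma FC_paths : FC false (fun x : nat * nat * nat => paths x.1.1 x.1.2 x.2).
Proof. by have H := FC_last; have H1 := FC_uniqb; rewrite /paths; fc. Qed.

Lemma FC_schulzeb : FC false (fun x : nat * Lrel * nat => schulzeb x.1.1 x.1.2 x.2).
Proof. by have H := FC_edges; have H1 := FC_paths; rewrite /schulzeb; fc. Qed.

Lemma FC_reachb : FC false (fun x : seq npair * nat * (nat * nat) => reachb x.1.1 x.1.2 x.2.1 x.2.2).
Proof. by rewrite /reachb; fc. Qed.

Section RP.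
Variables (tcb : nat -> nat -> nat -> bool) (tpb : nat -> npair -> npair -> bool).
Hypothesis Htc : FC false (fun x : nat * nat * nat => tcb x.1.1 x.1.2 x.2).
Hypothesis Htp : FC false (fun x : nat * npair * npair => tpb x.1.1 x.1.2 x.2).

Lemma FC_orientb : FC false (fun x : nat * Lrel * npair => orientb (tcb x.1.1) x.1.2 x.2).
Proof. by rewrite /orientb; fc. Qed.

Lemma FC_order : FC false (fun x : nat * Lrel =>
  isort (beforeb (tpb x.1) x.2) [seq P <- cpairs x.1 | P.1 < P.2]).
Proof.
by have H := FC_cpairs; rewrite /isort; fc.
Qed.

Lemma FC_rpb : FC false (fun x : nat * Lrel * nat => rpb (tcb x.1.1) (tpb x.1.1) x.1.1 x.1.2 x.2).
Proof.
have Hf : FC false (fun x : nat * Lrel => fixedb (tcb x.1) (tpb x.1) x.1 x.2).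
  have Ho : FC false (fun x : nat * Lrel * seq npair * npair => orientb (tcb x.1.1.1) x.1.1.2 x.2).
    apply: (FC_comp (f := fun x : nat * Lrel * seq npair * npair =>
      ((x.1.1.1, x.1.1.2), x.2)) _ FC_orientb); fc.
  rewrite /fixedb; fc.
  + apply: (FC_comp (f := fun x : nat * Lrel * seq npair * npair =>
     ((x.1.2, x.1.1.1), ((orientb (tcb x.1.1.1) x.1.1.2 x.2).1, (orientb (tcb x.1.1.1) x.1.1.2 x.2).2))) _ FC_reachb); fc.
  + apply: (FC_comp (f := fun x : nat * Lrel * seq npair * npair =>
     ((x.1.2, x.1.1.1), ((orientb (tcb x.1.1.1) x.1.1.2 x.2).2, (orientb (tcb x.1.1.1) x.1.1.2 x.2).1))) _ FC_reachb); fc.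
  + exact: FC_order.
rewrite /rpb; fc.
apply: (FC_comp (f := fun x : nat * Lrel * nat * nat =>
   ((fixedb (tcb x.1.1.1) (tpb x.1.1.1) x.1.1.1 x.1.1.2, x.1.1.1), (x.1.2, x.2))) _ FC_reachb); fc.
by apply: (FC_comp (f := fun x : nat * Lrel * nat * nat => (x.1.1.1, x.1.1.2)) _ Hf); fc.
Qed.
End RP.

(** * Running the tie-breaking machines *)

#[global] Instance enc_sym : Enc sym.
Proof.
exists (fun s => match s with S0 => Lf | S1 => Nd Lf Lf | Blank => Nd Lf (Nd Lf Lf) end).
by case; case.
Defined.

Section Machine.
Variable M : TM.
Hypothesis HM : tm_wf M.

Definition mv_code (d : move) : nat := match d with MoveL => 0 | MoveR => 1 | Stay => 2 end.

(** [tm_delta] is an arbitrary function, which need not be computable as a whole. Well-formedness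
    confines a run to finitely many states, so a finite table replaces it. *)
Definition delta_table : seq ((nat * sym) * (nat * sym * nat)) :=
  [seq ((q, s), ((tm_delta M q s).1, mv_code (tm_delta M q s).2))
    | q <- iota 0 (tm_states M), s <- [:: S0; S1; Blank]].

Definition lookup (k : nat * sym) : nat * sym * nat :=
  foldl (fun a r => if r.1 == k then r.2 else a) (0, Blank, 0) delta_table.

Definition stepn (c : config) : config :=
  if (c.1.1.1 == 1) || (c.1.1.1 == 2) then c else
  let t := lookup (c.1.1.1, c.1.2) in
  if t.2 == 0 then (t.1.1, behead c.1.1.2, head Blank c.1.1.2, t.1.2 :: c.2)
  else if t.2 == 1 then (t.1.1, t.1.2 :: c.1.1.2, head Blank c.2, behead c.2)
  else (t.1.1, c.1.1.2, t.1.2, c.2).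

Lemma lookupE q s : q < tm_states M -> lookup (q, s) = ((tm_delta M q s).1, mv_code (tm_delta M q s).2).
Proof.
move=> Hq; rewrite /lookup.
have H (T U : eqType) (f : T -> U) (l : seq T) k a : k \in l ->
    foldl (fun a (r : T * U) => if r.1 == k then r.2 else a) a [seq (x, f x) | x <- l] = f k.
  move=> Hk; suff G b : foldl (fun a (r : T * U) => if r.1 == k then r.2 else a) b [seq (x, f x) | x <- l]
      = if k \in l then f k else b by rewrite G Hk.
  elim: l b {Hk} => //= x l IH b; rewrite IH inE (eq_sym k x).
  by case: eqP => [->|_] //=; case: ifP.
have -> : delta_table = [seq (x, ((tm_delta M x.1 x.2).1, mv_code (tm_delta M x.1 x.2).2)) |
    x <- [seq (q, s) | q <- iota 0 (tm_states M), s <- [:: S0; S1; Blank]]].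
  by rewrite /delta_table map_flatten -map_comp; congr flatten; apply: eq_map => x; rewrite /= -map_comp.
rewrite (H _ _ (fun x => ((tm_delta M x.1 x.2).1, mv_code (tm_delta M x.1 x.2).2))) //.
by apply/allpairsP; exists (q, s); rewrite mem_iota /= Hq; split => //; case: (s).
Qed.

Lemma stepnE c : cstate c < tm_states M -> step M c = stepn c /\ cstate (step M c) < tm_states M.
Proof.
case: c => [[[q l] h] r]; rewrite {1}/cstate /= => Hq; rewrite /step /stepn /halted /cstate /=.
case: ifP => // _; rewrite lookupE //.
have := HM.2 q h Hq; case: (tm_delta M q h) => [[q' s'] []] /=.
- by case: l.
- by case: r.
- by [].
Qed.

Lemma runE t w : run M t w = iter t stepn (init w).
Proof.
rewrite /run; suff [-> _] : iter t (step M) (init w) = iter t stepn (init w) /\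
  cstate (iter t (step M) (init w)) < tm_states M by [].
elim: t => [|t [IH1 IH2]].
  by split => //; rewrite /init; case: map => [|x s]; apply: leq_trans HM.1.
have [H1 H2] := stepnE IH2; split; last exact: H2.
by rewrite !iterS -IH1 H1.
Qed.

Lemma FC_stepn : FC false stepn.
Proof.
have H : FC false lookup by rewrite /lookup; fc.
by rewrite /stepn /=; fc.
Qed.
End Machine.

Lemma FC_enc_nat : FC false enc_nat.
Proof. by rewrite /enc_nat; fc. Qed.

Lemma FC_init : FC false init.
Proof.
apply: (FC_eq (f := fun w => (0, [::], head Blank (map (fun b : bool => if b then S1 else S0) w),
   behead (map (fun b : bool => if b then S1 else S0) w)) : config)); first by case.
by fc.
Qed.

Lemma FC_tm (M : TM) c : tm_wf M -> FC false (fun x : nat * seq bool =>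
  cstate (run M (x.1.+1 ^ c) x.2) == 1).
Proof.
move=> HM; have H := FC_stepn M; have H1 := FC_init.
apply: (FC_eq (f := fun x : nat * seq bool => (iter (x.1.+1 ^ c) (stepn M) (init x.2)).1.1.1 == 1)).
  by move=> x; rewrite runE.
by fc.
Qed.

(** The machine is simulated for its whole time bound. Out of range its verdict is arbitrary, which
    is why agreement is claimed for candidates only. *)
Lemma feasible_tc tc : feasible_cand_tiebreak tc -> exists tcb : nat -> nat -> nat -> bool,
  FC false (fun x : nat * nat * nat => tcb x.1.1 x.1.2 x.2) /\
  forall m a b, a < m -> b < m -> tc m a b = tcb m a b.
Proof.
case=> _ [M [c [HM Hrun]]].
exists (fun m a b => cstate (run M (m.+1 ^ c) (enc_nat m ++ enc_nat a ++ enc_nat b)) == 1); split.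
  have H := FC_enc_nat.
  apply: (FC_comp (f := fun x : nat * nat * nat =>
    (x.1.1, enc_nat x.1.1 ++ enc_nat x.1.2 ++ enc_nat x.2)) _ (FC_tm c HM)); fc.
by move=> m a b Ha Hb; rewrite Hrun //; case: (tc m a b).
Qed.

Lemma feasible_tp tp : feasible_pair_tiebreak tp -> exists tpb : nat -> npair -> npair -> bool,
  FC false (fun x : nat * npair * npair => tpb x.1.1 x.1.2 x.2) /\
  forall m P Q, upair m P -> upair m Q -> tp m P Q = tpb m P Q.
Proof.
case=> _ [M [c [HM Hrun]]].
exists (fun m P Q => cstate (run M (m.+1 ^ c) (enc_nat m ++ enc_nat P.1 ++ enc_nat P.2 ++
   enc_nat Q.1 ++ enc_nat Q.2)) == 1); split.
  have H := FC_enc_nat.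
  apply: (FC_comp (f := fun x : nat * npair * npair =>
    (x.1.1, enc_nat x.1.1 ++ enc_nat x.1.2.1 ++ enc_nat x.1.2.2 ++ enc_nat x.2.1 ++ enc_nat x.2.2))
    _ (FC_tm c HM)); fc.
by move=> m P Q HP HQ; rewrite Hrun //; case: (tp m P Q).
Qed.

(** * Parsing the input in polynomial time *)

Lemma sz_bits_le (s : seq bool) : sz s <= 4 * size s + 1.
Proof. by elim: s => //= b s IH; rewrite sz_cons; case: b; rewrite /sz /= -/(sz s) in IH *; lia. Qed.

Lemma sz_catrev_eq A {eA : Enc A} (s t : seq A) : (sz (catrev s t)).+1 = sz s + sz t.
Proof. by elim: s t => [|b s IH] t //=; rewrite IH !sz_cons; lia. Qed.

Lemma sz_rev A {eA : Enc A} (s : seq A) : sz (rev s) = sz s.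
Proof. by rewrite /rev; apply: succn_inj; rewrite sz_catrev_eq sz_nil addn1. Qed.

Definition pn_step (st : bool * seq bool * seq bool) : bool * seq bool * seq bool :=
  if st.1.1 then st else
  if (head false st.2 == head false (behead st.2)) && ~~ (st.2 == [::])
  then (false, head false st.2 :: st.1.2, behead (behead st.2))
  else (true, st.1.2, behead (behead st.2)).

(** The input serves twice: as the text to be read and as a clock with enough rounds. The flag stops
    the reading at the terminator. *)
Definition parse_nat (s : seq bool) : seq bool * seq bool :=
  let st := foldl (fun st _ => pn_step st) (false, [::], s) s in (rev st.1.2, st.2).
Arguments parse_nat : simpl never.

Lemma pn_inv (f : seq bool) st : let st' := foldl (fun st _ => pn_step st) st f in
  size st'.1.2 + size st'.2 <= size st.1.2 + size st.2 /\ size st'.2 <= size st.2.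
Proof.
elim: f st => [|b f IH] st //=; have [H1 H2] := IH (pn_step st).
suff [K1 K2] : size (pn_step st).1.2 + size (pn_step st).2 <= size st.1.2 + size st.2 /\
   size (pn_step st).2 <= size st.2 by split; [exact: leq_trans H1 K1|exact: leq_trans H2 K2].
rewrite /pn_step; case: ifP => // _; case: ifP => [/andP[_]|_] /=; rewrite !size_behead; last by lia.
by case: (st.2) => //= x r _; lia.
Qed.

Lemma parse_nat_size s : size (parse_nat s).1 + size (parse_nat s).2 <= size s.
Proof. by have [H _] := pn_inv s (false, [::], s); rewrite /parse_nat /= size_rev. Qed.

Lemma parse_nat_lt s : s != [::] -> size (parse_nat s).2 < size s.
Proof.
case: s => // b s _; rewrite /parse_nat /=; set st := pn_step _.
have [_ H] := pn_inv s st; apply: leq_ltn_trans H _.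
by rewrite /st /pn_step /=; case: ifP => _ /=; rewrite size_behead; lia.
Qed.

Lemma parse_natE n r : parse_nat (enc_nat n ++ r) = (bits n, r).
Proof.
have Hd (f : seq bool) acc t : foldl (fun st _ => pn_step st) (true, acc, t) f = (true, acc, t).
  by elim: f.
have H bs (f : seq bool) acc : size bs < size f -> foldl (fun st _ => pn_step st)
    (false, acc, flatten [seq [:: b; b] | b <- bs] ++ [:: false; true] ++ r) f = (true, catrev bs acc, r).
  elim: bs f acc => [|b bs IH] [|x f] acc //= Hs; first by rewrite {2}/pn_step /= Hd.
  by rewrite {2}/pn_step /= eqxx /= IH.
have Hf : size (flatten [seq [:: b; b] | b <- bits n]) = 2 * size (bits n).
  by elim: (bits n) => //= b bs ->; lia.
rewrite /parse_nat /enc_nat -catA H /=; first by rewrite catrevE cats0 revK.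
by rewrite !size_cat Hf /=; lia.
Qed.

Fixpoint incr (b : seq bool) : seq bool :=
  match b with [::] => [:: true] | false :: b' => true :: b' | true :: b' => false :: incr b' end.

Definition inc (b : seq bool) : seq bool :=
  let st := foldl (fun (st : bool * seq bool) x => (st.1 && x, (st.1 (+) x) :: st.2)) (true, [::]) b in
  rev (if st.1 then true :: st.2 else st.2).

Lemma incE b : inc b = incr b.
Proof.
rewrite /inc.
have H0 s acc : foldl (fun (st : bool * seq bool) x => (st.1 && x, (st.1 (+) x) :: st.2)) (false, acc) s =
  (false, catrev s acc) by elim: s acc => //= x s IH acc; rewrite IH.
have H1 s acc : rev (let st := foldl (fun (st : bool * seq bool) x => (st.1 && x, (st.1 (+) x) :: st.2)) (true, acc) s in
   if st.1 then true :: st.2 else st.2) = rev acc ++ incr s.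
  elim: s acc => [|x s IH] acc /=; first by rewrite rev_cons cats1.
  case: x => /=; first by rewrite IH rev_cons cat_rcons.
  by rewrite H0 /= catrevE rev_cat revK rev_cons cat_rcons.
exact: (H1 b [::]).
Qed.

Lemma incr_bits n : incr (bits n) = bits n.+1.
Proof.
elim/ltn_ind: n => -[|n] IH //; rewrite (bits_eq n.+1) (bits_eq n.+2) /= negbK.
have Hu := uphalf_half n; case Ho: (odd n) Hu => /= Hu; first by rewrite Hu.
by rewrite IH ?Hu // ltnS; lia.
Qed.

Lemma size_incr b : size (incr b) <= (size b).+1.
Proof. by elim: b => [|[] b IH]. Qed.

Lemma bval_bits n : bval (bits n) = n.
Proof.
elim/ltn_ind: n => n IH; rewrite bits_eq; case: eqP => [->//|H0] /=.
by rewrite IH ?odd_double_half //; lia.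
Qed.

Lemma bits_inj : injective bits.
Proof. by move=> a b E; rewrite -(bval_bits a) E bval_bits. Qed.

Lemma size_bits n : size (bits n) <= n.
Proof.
elim/ltn_ind: n => n IH; rewrite bits_eq; case: eqP => [->//|H0] /=.
by apply: leq_ltn_trans (IH n./2 _) _; lia.
Qed.

Definition parser B := seq bool -> B * seq bool.

(** The length of a list is announced in binary, so a binary counter is raised up to it. The test
    for an empty rest keeps the result small on malformed input too, where the announced length may
    be exponential. *)
Definition pl_step B (p : parser B) (n : seq bool) (st : seq bool * seq B * seq bool) :=
  if (st.1.1 == n) || (st.2 == [::]) then st
  else (inc st.1.1, (p st.2).1 :: st.1.2, (p st.2).2).

Definition parse_list B (p : parser B) : parser (seq B) := fun s =>
  let st := foldl (fun st _ => pl_step p (parse_nat s).1 st) ([::], [::], (parse_nat s).2) s in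
  (rev st.1.2, st.2).
Arguments parse_list : simpl never.

(* Every nonempty input is consumed at least in part, and the output is linear in the consumed part. *)
Definition linear_parser B {eB : Enc B} C (p : parser B) := forall s,
  [/\ size (p s).2 <= size s, sz (p s).1 <= C * (size s - size (p s).2) + C &
      s != [::] -> size (p s).2 < size s].

Lemma parse_nat_linear : linear_parser 4 parse_nat.
Proof.
move=> s; have H := parse_nat_size s; split; last exact: parse_nat_lt.
  by apply: leq_trans H; apply: leq_addl.
by apply: leq_trans (sz_bits_le _) _; lia.
Qed.

Section ParseList.
Context (B : Type) {eB : Enc B} (C : nat) (p : parser B).
Hypothesis Hp : linear_parser C p.

(** An element that consumes d > 0 bits adds at most C d + C + 1 <= (2 C + 1) d to the size of the
    result. The counter grows by at most one bit per element, hence by no more than is consumed. *)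
Lemma pl_inv (f : seq bool) n r0 st : size st.2 <= r0 ->
  sz st.1.2 <= (2 * C + 1) * (r0 - size st.2) + 1 -> size st.1.1 <= r0 - size st.2 ->
  let st' := foldl (fun st _ => pl_step p n st) st f in
  [/\ size st'.2 <= r0, sz st'.1.2 <= (2 * C + 1) * (r0 - size st'.2) + 1 &
    size st'.1.1 <= r0 - size st'.2].
Proof.
elim: f st => [|b f IH] st //= H1 H2 H3; apply: IH; rewrite /pl_step; case: ifP => // /norP[_ Hr] /=.
- by have [K _ _] := Hp st.2; apply: leq_trans K H1.
- have [K1 K2 /(_ Hr) K3] := Hp st.2; rewrite sz_cons.
  have -> : r0 - size (p st.2).2 = (r0 - size st.2) + (size st.2 - size (p st.2).2) by lia.
  have : 0 < size st.2 - size (p st.2).2 by rewrite subn_gt0.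
  move: (size st.2 - _) K2 H2 => d K2 H2 Hd; rewrite mulnDr; nia.
- have [K1 K2 /(_ Hr) K3] := Hp st.2; rewrite incE.
  by apply: leq_trans (size_incr _) _; lia.
Qed.

Lemma parse_list_linear : linear_parser (2 * C + 1) (parse_list p).
Proof.
move=> s; have Hn := parse_nat_size s.
have [||H1 H2 _] := @pl_inv s (parse_nat s).1 (size (parse_nat s).2) ([::], [::], (parse_nat s).2) (leqnn _).
- by rewrite /= sz_nil; lia.
- by [].
have H3 : size (parse_list p s).2 <= size (parse_nat s).2 by exact: H1.
split.
- by apply: leq_trans H3 _; lia.
- rewrite /parse_list sz_rev; apply: leq_trans H2 _.
  apply: leq_add; last by lia.
  by rewrite leq_mul2l; apply/orP; right; rewrite leq_sub2r //; lia.
- by move=> Hs; apply: leq_ltn_trans H3 (parse_nat_lt Hs).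
Qed.

Lemma parse_listE (X : Type) (P : pred X) (e : X -> seq bool) (g : X -> B) xs r :
  (forall x r, P x -> p (e x ++ r) = (g x, r)) -> (forall x, P x -> 0 < size (e x)) ->
  all P xs -> parse_list p (enc_list e xs ++ r) = (map g xs, r).
Proof.
move=> Hpe He Hxs.
have Hend (f : seq bool) n acc t : foldl (fun st _ => pl_step p n st) (n, acc, t) f = (n, acc, t).
  by elim: f => //= _ f IH; rewrite {2}/pl_step eqxx IH.
have H (f : seq bool) i ys acc : size ys <= size f -> all P ys ->
    foldl (fun st _ => pl_step p (bits (i + size ys)) st) (bits i, acc, flatten (map e ys) ++ r) f =
    (bits (i + size ys), catrev (map g ys) acc, r).
  elim: ys i f acc => [|y ys IH] i f acc; first by rewrite /= addn0 Hend.
  case: f => [|b f] //= Hs /andP[Hy Hys]; rewrite {2}/pl_step /= (inj_eq bits_inj) -catA.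
  rewrite -[X in X == _ + _]addn0 eqn_add2l /=.
  have -> : (e y ++ flatten (map e ys) ++ r == [::]) = false.
    by apply/eqP => E; have := He y Hy; move: E; case: (e y).
  by rewrite Hpe //= incE incr_bits -addSnnS IH.
rewrite /parse_list /enc_list -catA parse_natE.
have := H (enc_nat (size xs) ++ flatten (map e xs) ++ r) 0 xs [::] _ Hxs; rewrite add0n => -> //=.
  by rewrite catrevE cats0 revK.
rewrite !size_cat; apply: leq_trans (leq_addl _ _); apply: leq_trans (leq_addr _ _).
elim: xs Hxs {H} => //= x xs IH /andP[Hx /IH]; rewrite size_cat; have := He x Hx; lia.
Qed.
End ParseList.

Lemma FC_parse_nat : FC true parse_nat.
Proof.
have H : FC true (fun s : seq bool => foldl (fun st _ => pn_step st) (false, [::], s) s).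
  apply: (@FC_foldl true _ _ _ _ _ _ (fun _ st _ => pn_step st)); [by fc|by fc|by fc|].
  move=> _; exists (fun s : seq bool => 8 * sz s + 10); first by pb.
  move=> s k; have := pn_inv (take k s) (false, [::], s); set st := foldl _ _ _.
  case: st => [[d acc] t] /= [H _]; rewrite !sz_pair.
  have H1 := sz_bits_le acc; have H2 := sz_bits_le t.
  have H3 : size s <= sz s by apply: size_sz.
  have H4 : sz d <= 3 by case: (d).
  lia.
by rewrite /parse_nat; fc.
Qed.

Lemma FC_inc : FC true inc.
Proof.
rewrite /inc.
have H : FC true (fun b : seq bool => foldl (fun (st : bool * seq bool) x =>
   (st.1 && x, (st.1 (+) x) :: st.2)) (true, [::]) b).
  apply: (@FC_foldl true _ _ _ _ _ _ (fun _ (st : bool * seq bool) x =>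
    (st.1 && x, (st.1 (+) x) :: st.2))); [by fc|by fc|by fc|].
  move=> _; exists (fun s : seq bool => 4 * sz s + 10); first by pb.
  move=> s k; have Hs : size (take k s) <= sz s.
    by apply: leq_trans (size_sz s); rewrite size_take_min geq_minr.
  have Hf l st : size (foldl (fun (st : bool * seq bool) x => (st.1 && x, (st.1 (+) x) :: st.2)) st l).2
     = size l + size st.2 by elim: l st => //= x l IH st; rewrite IH /= addnS.
  have := Hf (take k s) (true, [::]); set st := foldl _ _ _.
  case: st => [d acc] /= Hacc; rewrite sz_pair.
  have H1 := sz_bits_le acc; have H4 : sz d <= 3 by case: (d).
  lia.
by fc.
Qed.

Lemma FC_parse_list B {eB : Enc B} C (p : parser B) : linear_parser C p -> FC true p ->
  FC true (parse_list p).
Proof.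
move=> Hp HF; have HN := FC_parse_nat; have HI := FC_inc.
have H : FC true (fun s => foldl (fun st _ => pl_step p (parse_nat s).1 st) ([::], [::], (parse_nat s).2) s).
  apply: (@FC_foldl true _ _ _ _ _ _ (fun s st _ => pl_step p (parse_nat s).1 st)); [|by fc|by fc|].
    by rewrite /pl_step; fc.
  move=> _; exists (fun s : seq bool => (2 * C + 1) * sz s + 8 * sz s + 10); first by pb.
  move=> s k; have Hn := parse_nat_size s.
  have [|||] := @pl_inv B _ C p Hp (take k s) (parse_nat s).1 (size s) ([::], [::], (parse_nat s).2).
  - by apply: leq_trans Hn; apply: leq_addl.
  - by apply: leq_addl.
  - by [].
  set st := foldl _ _ _; case: st => [[cnt acc] r] H1 H2 H3; simpl in H1, H2, H3.
  have Hs : size s <= sz s by apply: size_sz.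
  have K1 := sz_bits_le cnt; have K2 := sz_bits_le r.
  have H2' : (2 * C + 1) * (size s - size r) <= (2 * C + 1) * sz s.
    by rewrite leq_mul2l; apply/orP; right; lia.
  rewrite !sz_pair; move: ((2 * C + 1) * sz s) H2' => M H2'; lia.
by rewrite /parse_list; fc.
Qed.

(** * Evaluating the automaton on the input in polynomial time *)

Section Decide.
Variable succ : bool.

Definition pvote : parser (seq (seq bool)) := parse_list parse_nat.

(** Both input models deliver pairs of a vote and a binary multiplicity; a vote listed individually
    gets multiplicity 1. *)
Definition pentry : parser (seq (seq bool) * seq bool) := fun s =>
  if succ then ((pvote s).1, (parse_nat (pvote s).2).1, (parse_nat (pvote s).2).2)
  else ((pvote s).1, [:: true], (pvote s).2).

Lemma pvote_linear : linear_parser 9 pvote.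
Proof. exact: (parse_list_linear parse_nat_linear). Qed.

Lemma pentry_linear : linear_parser 20 pentry.
Proof.
move=> s; have := pvote_linear s; have := parse_nat_linear (pvote s).2; rewrite /pentry.
case: (pvote s) => v r1 /=; case: (parse_nat r1) => b r2 /= [K1 K2 _] [H1 H2 H3].
case: succ => /=; split => //; rewrite ?sz_pair.
- exact: leq_trans K1 H1.
- lia.
- by move/H3; apply: leq_ltn_trans.
- have -> : sz [:: true] = 5 by [].
  lia.
Qed.

Lemma FC_pvote : FC true pvote.
Proof. exact: FC_parse_list parse_nat_linear FC_parse_nat. Qed.

Lemma FC_pentry : FC true pentry.
Proof. by have H := FC_pvote; have H1 := FC_parse_nat; rewrite /pentry; case: succ; fc. Qed.

Definition agg (es : seq (seq (seq bool) * seq bool)) (c : seq (seq bool)) : seq bool :=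
  foldl (fun acc e => if e.1 == c then (if succ then e.2 else inc acc) else acc) [::] es.

(** In the nonsuccinct model a matching entry lengthens the counter by at most one bit, in the
    succinct model the result is part of an entry. Either way the entry just read pays for the
    growth. *)
Lemma agg_sz es c : sz (agg es c) <= 4 * sz es + 1.
Proof.
have H : forall acc : seq bool, sz (foldl (fun acc e => if e.1 == c then (if succ then e.2 else inc acc) else acc) acc es)
   <= maxn (sz acc) (4 * size acc + 1) + 4 * sz es; last first.
  by rewrite /agg; apply: leq_trans (H [::]) _; rewrite sz_nil addnC.
elim: es => [|e es IH] acc /=; first by lia.
apply: leq_trans (IH _) _; rewrite sz_cons; case: e => t b /=; rewrite sz_pair.
case: eqP => _; last by lia.
have Hi : size (inc acc) <= (size acc).+1 by rewrite incE size_incr.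
have H1 := sz_bits_le (inc acc); have H2 : size b <= sz b by apply: size_sz.
by case: (succ); lia.
Qed.

Lemma FC_agg : FC true (fun x : seq (seq (seq bool) * seq bool) * seq (seq bool) => agg x.1 x.2).
Proof.
have HI := FC_inc.
apply: (@FC_foldl true _ _ _ _ _ _ (fun x acc (e : seq (seq bool) * seq bool) =>
   if e.1 == x.2 then (if succ then e.2 else inc acc) else acc) (fun _ => [::]) (fun x => x.1)).
- by case: succ; fc.
- by fc.
- by fc.
- move=> _; exists (fun x : seq (seq (seq bool) * seq bool) * seq (seq bool) => 4 * sz x + 1); first by pb.
  move=> [es c] k; apply: leq_trans (agg_sz _ _) _.
  rewrite sz_pair leq_add2r leq_mul2l /=; apply: leq_trans (sz_take _ _) _ => /=.
  by rewrite -addnS leq_addr.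
Qed.

Lemma sz_map_le A {eA : Enc A} B {eB : Enc B} (f : A -> B) l : (forall a, sz (f a) <= sz a) -> sz (map f l) <= sz l.
Proof. by move=> H; elim: l => //= a l IH; rewrite !sz_cons ltnS leq_add. Qed.

Lemma sz_behead A {eA : Enc A} (l : seq A) : sz (behead l) <= sz l.
Proof. by case: l => //= a l; rewrite sz_cons; lia. Qed.

(** State sets are lists with repetitions; as each is selected afresh from the transitions,
    repetitions cannot pile up over the rounds. *)
Lemma stepS_sz tt S e : sz (stepS tt S e) <= sz tt.
Proof.
apply: leq_trans (sz_map_le _ _) (sz_filter _ _) => x.
by rewrite (surjective_pairing x) sz_pair /= -addnS -addSnnS leq_addl.
Qed.

Lemma runS_sz M N tt (l : seq bool) (st : seq (seq nat) * seq (seq bool)) : sz tt <= M ->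
  sz st.1 <= M -> sz st.2 <= N ->
  let st' := foldl (fun st (_ : bool) => (stepS tt st.1 (map (head false) st.2), map behead st.2)) st l in
  sz st'.1 <= M /\ sz st'.2 <= N.
Proof.
move=> Ht; elim: l st => [|b l IH] st //= H1 H2; apply: IH => /=.
  by apply: leq_trans (stepS_sz _ _ _) Ht.
apply: leq_trans H2; apply: sz_map_le => s; exact: sz_behead.
Qed.

Definition runarg := (seq transition * seq (seq nat) * seq (seq bool) * seq bool)%type.

Lemma FC_runS : FC true (fun x : runarg => runS x.1.1.1 x.1.1.2 x.1.2 x.2).
Proof.
rewrite /runS.
apply: (@FC_foldl true _ _ _ _ _ _ (fun (x : runarg) (st : seq (seq nat) * seq (seq bool)) (_ : bool) =>
  (stepS x.1.1.1 st.1 (map (head false) st.2), map behead st.2)) (fun x => (x.1.1.2, x.1.2)) (fun x => x.2)).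
- by rewrite /stepS; fc.
- by fc.
- by fc.
move=> _; exists (fun x : runarg => 3 * sz x); first by pb.
move=> [[[tt S] cnts] f] k /=; rewrite !sz_pair.
have [||] := @runS_sz (sz S + sz tt) (sz cnts) tt (take k f) (S, cnts) (leq_addl _ _).
- exact: leq_addr.
- exact: leqnn.
by case: foldl => S' c' /=; rewrite sz_pair; lia.
Qed.

Definition counts (T : table) (raw : seq bool) : seq (seq bool) * seq bool :=
  let qV := parse_list pentry raw in let qW := parse_list pentry qV.2 in
  let qp := parse_nat qW.2 in let qk := parse_nat qp.2 in
  (map (agg qV.1) T.1.1.1 ++ map (agg qW.1) T.1.1.1 ++ [:: qk.1], qp.1).

(** The raw input acts as fuel, since no count, and no number written in a valid input, has more
    bits than it. *)
Definition decide (x : table * seq bool) : bool :=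
  let q := counts x.1 x.2 in
  has (fun c => (c, q.2) \in x.1.2) (runS x.1.1.2 [:: x.1.1.1.2] q.1 x.2).1.

Lemma FC_decide : FC true decide.
Proof.
have HL := FC_parse_list pentry_linear FC_pentry; have HN := FC_parse_nat; have HA := FC_agg.
have HC : FC true (fun x : table * seq bool => counts x.1 x.2) by rewrite /counts; cbv zeta; fc.
rewrite /decide; cbv zeta; fc.
apply: (FC_comp (f := fun x : table * seq bool =>
  ((x.1.1.2, [:: x.1.1.1.2]), (counts x.1 x.2).1, x.2) : runarg) _ FC_runS).
by fc.
Qed.
End Decide.

(** * Correctness of the evaluation for both input models *)

Arguments enc_nat : simpl never.
Arguments enc_list : simpl never.

Lemma stepS_ok FL K n1 n2 S e : all (fun f : lform => (sumn f.1 <= K) && (sumn f.2 <= K)) FL ->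
  all (okc FL K) (stepS (trans_table FL K n1 n2) S e).
Proof.
move=> HK; apply/allP => c1 /mapP[t]; rewrite mem_filter => /andP[_].
case/allpairsP => -[c [e1 e2]] /= [Hc _ ->] ->.
by rewrite /bitn -map_cat; apply: okc_nxt => //; rewrite -okc_words.
Qed.

(** Reachable carries stay in range, so the list of accepting carries, which contains only vectors
    in range, misses none of them. *)
Lemma runS_ok FL K n1 n2 S cnts fuel : all (fun f : lform => (sumn f.1 <= K) && (sumn f.2 <= K)) FL ->
  all (okc FL K) S -> all (okc FL K) (runS (trans_table FL K n1 n2) S cnts fuel).1.
Proof.
move=> HK; rewrite /runS; elim: fuel S cnts => //= b fuel IH S cnts _; apply: IH.
exact: stepS_ok.
Qed.

Lemma okc0 FL K : okc FL K (nseq (size FL) K).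
Proof.
by rewrite /okc size_nseq eqxx; apply/allP => y; rewrite mem_nseq => /andP[_ /eqP->]; lia.
Qed.

Lemma enc_nat_inj : injective enc_nat.
Proof.
move=> a b Hab; apply: bits_inj; have := parse_natE a [::].
by rewrite Hab parse_natE => -[->].
Qed.

Lemma size_enc_nat n : size (bits n) <= size (enc_nat n).
Proof.
rewrite /enc_nat size_cat; apply: leq_trans (leq_addr _ _).
by elim: (bits n) => //= b s IH; lia.
Qed.

Lemma enc_nat_gt0 n : 0 < size (enc_nat n).
Proof. by rewrite /enc_nat size_cat addn2. Qed.

Lemma pvoteE v r : pvote (enc_vote v ++ r) = (map bits v, r).
Proof.
apply: (@parse_listE _ parse_nat nat predT) => //.
- by move=> x s _; apply: parse_natE.
- by move=> x _; apply: enc_nat_gt0.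
- exact: all_predT.
Qed.

Lemma enc_list_gt0 T (e : T -> seq bool) s : 0 < size (enc_list e s).
Proof. by rewrite /enc_list size_cat; have := enc_nat_gt0 (size s); lia. Qed.

Lemma size_enc_list T (e : T -> seq bool) s : (forall x, 0 < size (e x)) -> size s <= size (enc_list e s).
Proof.
move=> H; rewrite /enc_list size_cat; apply: leq_trans (leq_addl _ _).
by elim: s => //= x s IH; rewrite size_cat; have := H x; lia.
Qed.

Lemma size_enc_elt (T : eqType) (e : T -> seq bool) s x : x \in s -> size (e x) <= size (enc_list e s).
Proof.
move=> H; rewrite /enc_list size_cat; apply: leq_trans (leq_addl _ _).
elim: s H => //= y s IH; rewrite inE size_cat => /orP[/eqP->|/IH]; lia.
Qed.

Section Correct.
Variables (R : rule) (rb : nat -> seq (npair * npair) -> nat -> bool).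
Hypothesis HR : forall m votes L, all (valid_vote m) votes -> LEspec m votes L ->
  forall c, R m votes c <-> rb m L c.
Hypothesis Hrb : forall m L c, rb m L c -> c < m.
Variables (uniqm constr succ : bool).

Lemma decide_nfa m V W p k raw : all (valid_vote m) V -> all (valid_vote m) W -> p < m ->
  let q := counts succ (mktable rb uniqm constr m) raw in
  map bval q.1 = map (fun t => count_mem t V) (vtypes m) ++ map (fun t => count_mem t W) (vtypes m) ++ [:: k] ->
  all (fun b => size b <= size raw) q.1 -> q.2 = bits p ->
  decide succ (mktable rb uniqm constr m, raw) <-> control_yes R uniqm constr (NInst m V W p k).
Proof.
move=> HV HW Hp q H1 H2 H3; rewrite (control_nfa HR Hrb uniqm constr p HV HW H1 H2).
have Hacc c : ((c, bits p) \in (mktable rb uniqm constr m).2) =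
    okc (forms m) (kbound (forms m)) c && accg rb uniqm constr m (map (leq (kbound (forms m))) c) p.
  rewrite /mktable /=; apply/mapP/andP.
  - case=> -[c' p']; rewrite mem_filter => /andP[/= Ha Hin] [-> /bits_inj ->]; split => //.
    by case/allpairsP: Hin => -[c1 p1] /= [Hc1 _ [-> _]]; rewrite -okc_words.
  - case=> Hc Ha; exists (c, p) => //; rewrite mem_filter Ha /=.
    by apply/allpairsP; exists (c, p); rewrite mem_iota /= Hp okc_words.
rewrite /decide; split.
- by case/hasP => c Hc; rewrite H3 Hacc => /andP[_ Ha]; exists c.
- case=> c Hc Ha; apply/hasP; exists c => //; rewrite H3 Hacc Ha andbT.
  by apply: (allP (runS_ok _ _ _ _ (kboundP _) _) _ Hc); rewrite /= okc0.
Qed.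
End Correct.

Lemma agg_countsn V t : agg false [seq (map bits v, [:: true]) | v <- V] (map bits t) = bits (count_mem t V).
Proof.
rewrite /agg; suff H i : foldl (fun acc (e : seq (seq bool) * seq bool) =>
   if e.1 == map bits t then inc acc else acc) (bits i)
   [seq (map bits v, [:: true]) | v <- V] = bits (i + count_mem t V) by exact: (H 0).
elim: V i => [|v V IH] i /=; first by rewrite addn0.
rewrite (inj_eq (inj_map bits_inj)); case: eqP => _ /=; last exact: IH.
by rewrite incE incr_bits IH addnA addn1.
Qed.

(** As the listed votes are distinct, a type matches at most one entry, and overwriting the
    accumulator amounts to summing the multiplicities. *)
Lemma agg_countss (s : seq (vote * nat)) t : uniq (map fst s) ->
  bval (agg true [seq (map bits e.1, bits e.2) | e <- s] (map bits t)) = count_mem t (expand s).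
Proof.
rewrite /agg => Hu; suff H acc : bval (foldl (fun acc (e : seq (seq bool) * seq bool) =>
   if e.1 == map bits t then e.2 else acc) acc
   [seq (map bits e.1, bits e.2) | e <- s]) =
   if t \in map fst s then count_mem t (expand s) else bval acc.
  rewrite H; case: ifP => // Ht; symmetry; apply/eqP; rewrite -leqn0 leqNgt -has_count has_pred1.
  apply/negP => /flattenP[_ /mapP[[v n] Hv ->]]; rewrite mem_nseq => /andP[_ /eqP E].
  by case/negP: Ht; subst t; apply/mapP; exists (v, n).
elim: s Hu acc => [|[v n] s IH] //= /andP[Hv Hu] acc.
rewrite /expand /= count_cat count_nseq /= (inj_eq (inj_map bits_inj)) IH // inE (eq_sym t v).
case: eqP => [E|_] /=; last by rewrite add0n.
subst t; rewrite (negbTE Hv) bval_bits mul1n -[LHS]addn0; congr (_ + _).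
apply/eqP; rewrite eq_sym -leqn0 leqNgt -has_count has_pred1.
apply/negP => /flattenP[_ /mapP[[v' n'] Hv' ->]]; rewrite mem_nseq => /andP[_ /eqP E].
by case/negP: Hv; rewrite E; apply/mapP; exists (v', n').
Qed.

Definition body_n (x : ninst) : seq bool :=
  enc_list enc_vote (n_V x) ++ enc_list enc_vote (n_W x) ++ enc_nat (n_p x) ++ enc_nat (n_k x).

Definition body_s (x : sinst) : seq bool :=
  enc_list enc_vn (s_V x) ++ enc_list enc_vn (s_W x) ++ enc_nat (s_p x) ++ enc_nat (s_k x).

Lemma enc_vote_gt0 v : 0 < size (enc_vote v).
Proof. exact: enc_list_gt0. Qed.

Lemma enc_vn_gt0 v : 0 < size (enc_vn v).
Proof. by rewrite /enc_vn size_cat; have := enc_vote_gt0 v.1; lia. Qed.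

Lemma parse_votes_n V r : parse_list (pentry false) (enc_list enc_vote V ++ r) =
  ([seq (map bits v, [:: true]) | v <- V], r).
Proof.
apply: (@parse_listE _ _ _ predT) => //.
- by move=> x s _; rewrite /pentry pvoteE.
- by move=> x _; apply: enc_vote_gt0.
- exact: all_predT.
Qed.

Lemma parse_votes_s V r : parse_list (pentry true) (enc_list enc_vn V ++ r) =
  ([seq (map bits e.1, bits e.2) | e <- V], r).
Proof.
apply: (@parse_listE _ _ _ predT) => //.
- by move=> x s _; rewrite /pentry /enc_vn -catA pvoteE parse_natE.
- by move=> x _; apply: enc_vn_gt0.
- exact: all_predT.
Qed.

Lemma parse_nat_enc n : parse_nat (enc_nat n) = (bits n, [::]).
Proof. by have := parse_natE n [::]; rewrite cats0. Qed.

Lemma counts_n T x : counts false T (body_n x) =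
  (map (agg false [seq (map bits v, [:: true]) | v <- n_V x]) T.1.1.1 ++
   map (agg false [seq (map bits v, [:: true]) | v <- n_W x]) T.1.1.1 ++ [:: bits (n_k x)], bits (n_p x)).
Proof.
rewrite /counts /body_n parse_votes_n; cbn [fst snd]; rewrite parse_votes_n; cbn [fst snd].
rewrite parse_natE; cbn [fst snd].
by rewrite parse_nat_enc.
Qed.

Lemma counts_s T x : counts true T (body_s x) =
  (map (agg true [seq (map bits e.1, bits e.2) | e <- s_V x]) T.1.1.1 ++
   map (agg true [seq (map bits e.1, bits e.2) | e <- s_W x]) T.1.1.1 ++ [:: bits (s_k x)], bits (s_p x)).
Proof.
rewrite /counts /body_s parse_votes_s; cbn [fst snd]; rewrite parse_votes_s; cbn [fst snd].
rewrite parse_natE; cbn [fst snd].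
by rewrite parse_nat_enc.
Qed.

Lemma agg_s_size (s : seq (vote * nat)) c :
  size (agg true [seq (map bits e.1, bits e.2) | e <- s] c) <= size (enc_list enc_vn s).
Proof.
rewrite /agg; have H acc l : all (fun e => size (bits e.2) <= size (enc_list enc_vn s)) l ->
   size acc <= size (enc_list enc_vn s) ->
   size (foldl (fun acc (e : seq (seq bool) * seq bool) => if e.1 == c then e.2 else acc) acc
   [seq (map bits e.1, bits e.2) | e <- l]) <= size (enc_list enc_vn s).
  by elim: l acc => //= e l IH acc /andP[He Hl] Ha; apply: IH => //; case: ifP.
apply: H => //; apply/allP => e He; apply: leq_trans (size_enc_elt enc_vn He).
rewrite /enc_vn size_cat; apply: leq_trans (size_enc_nat _) _; exact: leq_addl.
Qed.

Lemma valid_expand m s : valid_succ_list m s -> all (valid_vote m) (expand s).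
Proof.
case=> /allP H _; apply/allP => v /flattenP[_ /mapP[[u n] Hu ->]]; rewrite mem_nseq => /andP[_ /eqP->].
by have /andP[] := H _ Hu.
Qed.

Section Correct2.
Variables (R : rule) (rb : nat -> seq (npair * npair) -> nat -> bool).
Hypothesis HR : forall m votes L, all (valid_vote m) votes -> LEspec m votes L ->
  forall c, R m votes c <-> rb m L c.
Hypothesis Hrb : forall m L c, rb m L c -> c < m.
Variables (uniqm constr : bool).

Lemma decide_n x : valid_ninst x ->
  decide false (mktable rb uniqm constr (n_m x), body_n x) <-> control_yes R uniqm constr x.
Proof.
case=> HV [HW Hp].
have -> : control_yes R uniqm constr x = control_yes R uniqm constr (NInst (n_m x) (n_V x) (n_W x) (n_p x) (n_k x)).
  by case: x {HV HW Hp}.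
have HsV : size (n_V x) <= size (body_n x).
  by rewrite size_cat; apply: leq_trans (size_enc_list _ enc_vote_gt0) _; apply: leq_addr.
have HsW : size (n_W x) <= size (body_n x).
  rewrite 2!size_cat; apply: leq_trans (size_enc_list _ enc_vote_gt0) _; lia.
apply: (decide_nfa HR Hrb) => //; rewrite counts_n //=.
- rewrite !map_cat -!map_comp /= bval_bits; congr (_ ++ _ ++ _).
  + by apply: eq_map => t; rewrite /= agg_countsn bval_bits.
  + by apply: eq_map => t; rewrite /= agg_countsn bval_bits.
- rewrite !all_cat !all_map /= andbT; apply/and3P; split.
  + apply/allP => t _; rewrite /= agg_countsn.
    by apply: leq_trans (size_bits _) _; apply: leq_trans (count_size _ _) _.
  + apply/allP => t _; rewrite /= agg_countsn.
    by apply: leq_trans (size_bits _) _; apply: leq_trans (count_size _ _) _.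
  + by rewrite /body_n 3!size_cat; apply: leq_trans (size_enc_nat _) _; rewrite !addnA leq_addl.
Qed.

Lemma decide_s x : valid_sinst x ->
  decide true (mktable rb uniqm constr (s_m x), body_s x) <-> control_yes R uniqm constr (expand_inst x).
Proof.
case=> HV [HW Hp]; rewrite /expand_inst.
apply: (decide_nfa HR Hrb) => //; try exact: valid_expand; rewrite counts_s //=.
- rewrite !map_cat -!map_comp /= bval_bits; congr (_ ++ _ ++ _).
  + by apply: eq_map => t; rewrite /= agg_countss //; case: HV.
  + by apply: eq_map => t; rewrite /= agg_countss //; case: HW.
- rewrite !all_cat !all_map /= andbT; apply/and3P; split.
  + apply/allP => t _; apply: leq_trans (agg_s_size (s_V x) (map bits t)) _.
    by rewrite /body_s size_cat leq_addr.
  + apply/allP => t _; apply: leq_trans (agg_s_size (s_W x) (map bits t)) _.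
    by rewrite /body_s 2!size_cat addnCA leq_addr.
  + by rewrite /body_s 3!size_cat; apply: leq_trans (size_enc_nat _) _; rewrite !addnA leq_addl.
Qed.
End Correct2.

(** * From stack programs to fixed-parameter tractability *)

(** The code of a list starts with that of its first element, so prepending a known bit is a fixed
    sequence of pushes. *)
Definition consb j (b : bool) := pushes j (true :: code (E b)).

Definition tconsb (b : bool) := (2 * size (true :: code (E b))).+1.

Lemma exec_consb j b (l : seq bool) s : s j = code (E l) ->
  exec (consb j b) s (upd s j (code (E (b :: l)))) (tconsb b).
Proof.
move=> Hs; apply: (exec_to (exec_pushes _ _ _)); rewrite Hs.
by congr upd; rewrite /= -catA.
Qed.

Lemma tconsb_le b : tconsb b <= 9.
Proof. by case: b. Qed.

(* Reads a doubled-digit number on stack 0; stack 2 is nonempty as long as the terminator has not been read. *)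
Definition read_body := Case 0
  (Case 0 (CSeq (consb 1 false) (Push 2 true)) Skip Skip)
  (Case 0 Skip (CSeq (consb 1 true) (Push 2 true)) Skip) Skip.

Definition read_nat := CSeq (Push 1 false) (CSeq (Push 2 true) (Loop 2 Skip read_body)).

Lemma exec_read_loop bs (acc : seq bool) : exists t, forall r s, s 1 = code (E acc) -> s 2 = [:: true] ->
  s 0 = flatten [seq [:: b; b] | b <- bs] ++ [:: false; true] ++ r ->
  exec (Loop 2 Skip read_body) s (upd (upd (upd s 0 r) 1 (code (E (catrev bs acc)))) 2 [::]) t.
Proof.
elim: bs acc => [|b bs IH] acc.
  exists (3 + 1).+1 => r s H1 H2 H0.
  apply: (@ex_loop _ _ _ _ (upd (upd s 2 [::]) 0 r) _ _ _ true [::]) => //.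
    apply: (@ex_case _ _ _ _ _ _ _ false (true :: r)); first by rd; rewrite H0.
    apply: (@ex_case _ _ _ _ _ _ _ true r); first by rd.
    by apply: (exec_to (ex_skip _)); st.
  by apply: (exec_conv (@ex_loop0 2 _ _ (upd (upd s 2 [::]) 0 r) _)); rewrite /= ?H1; [rd| |st].
have [t {}IH] := IH (b :: acc).
exists (((tconsb b + 1).+3) + t).+1 => r s H1 H2 H0.
apply: (@ex_loop _ _ _ _ (upd (upd s 0 (flatten [seq [:: b; b] | b <- bs] ++ [:: false; true] ++ r))
    1 (code (E (b :: acc)))) _ _ _ true [::]) => //.
  set u := flatten _ ++ _; have Hb : exec (CSeq (consb 1 b) (Push 2 true)) (upd (upd s 2 [::]) 0 u)
    (upd (upd s 0 u) 1 (code (E (b :: acc)))) (tconsb b + 1).+1.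
    apply: ex_seq; first by apply: (@exec_consb 1 b acc); rd.
    by apply: (exec_to (ex_push _ _ _)); rd; st; rewrite H2.
  clear IH; case: b H0 Hb => H0 Hb.
  - apply: (@ex_case _ _ _ _ _ _ _ true (true :: u)); first by rd; rewrite H0.
    apply: (@ex_case _ _ _ _ _ _ _ true u); first by rd.
    by apply: (exec_conv Hb) => //; st.
  - apply: (@ex_case _ _ _ _ _ _ _ false (false :: u)); first by rd; rewrite H0.
    apply: (@ex_case _ _ _ _ _ _ _ false u); first by rd.
    by apply: (exec_conv Hb) => //; st.
by apply: (exec_to (IH r _ _ _ _)); [rd|rd|rd|st].
Qed.

(** Horner's rule: the reading loop delivers the digits reversed, most significant first. *)
Definition ofbits (bs : seq bool) : nat := foldl (fun u b => u + u + nat_of_bool b) 0 bs.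

Lemma ofbits_bits n : ofbits (rev (bits n)) = n.
Proof.
rewrite /ofbits foldl_rev -[RHS]bval_bits.
by elim: (bits n) => //= b s ->; rewrite addnn addnC.
Qed.

Lemma FC_ofbits : FC false ofbits.
Proof. by rewrite /ofbits; fc. Qed.

Section Table.
Context (X : Type) {eX : Enc X} (T : nat -> X).
Hypothesis HT : FC false T.

(** The time [t] is fixed before the rest [r] of the input, so it is a function of the number of
    candidates; this is the s(m) of the time bound. *)
Lemma table_prog : exists A, forall m, exists t, forall r,
  exec A (upd (fun => [::]) 0 (enc_nat m ++ r)) (upd (upd (fun => [::]) 0 r) 1 (code (E (T m)))) t.
Proof.
have H : FC false (fun bs => T (ofbits bs)) by have H := FC_ofbits; fc.
have [bd [[P HP] _]] := H; exists (CSeq read_nat (P 1)) => m.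
have [t1 H1] := exec_read_loop (bits m) [::].
have [t2 _ H2] := HP (rev (bits m)).
exists ((1 + (1 + t1).+1).+1 + t2).+1 => r.
apply: (@ex_seq _ _ _ (upd (upd (fun => [::]) 0 r) 1 (code (E (rev (bits m)))))).
  apply: ex_seq; first exact: ex_push.
  apply: ex_seq; first exact: ex_push.
  apply: (exec_to (H1 r _ _ _ _)); [by rd|by rd|by rd; rewrite /enc_nat -catA|].
  by rewrite catrevE cats0; st.
apply: (exec_to (H2 1 _ _ _)); first by rd.
  by move=> j Hj; rewrite !upd_neq //; lia.
by rewrite ofbits_bits; st.
Qed.
End Table.

Definition raw_loop := Loop 2 (consb 3 false) (consb 3 true).

Lemma exec_raw_loop u (l : seq bool) : exists2 t, t <= 10 * size u + 1 & forall s,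
  s 2 = u -> s 3 = code (E l) ->
  exec raw_loop s (upd (upd s 2 [::]) 3 (code (E (catrev u l)))) t.
Proof.
elim: u l => [|b u IH] l.
  by exists 1 => // s H2 H3; apply: (exec_conv (ex_loop0 _ _ H2)) => //; rewrite /= -H3 -H2; st.
have [t Ht {}IH] := IH (b :: l); exists (tconsb b + t).+1.
  by have := tconsb_le b; rewrite /=; lia.
move=> s H2 H3; apply: (@ex_loop _ _ _ _ (upd (upd s 2 u) 3 (code (E (b :: l)))) _ _ _ b u) => //.
  by case: b {H2 IH}; apply: (@exec_consb 3 _ l); rd.
by apply: (exec_to (IH _ _ _)); [rd|rd|st].
Qed.

(* From a raw string on stack 0 and an encoded x on stack 1 to the encoded value of g (x, string) on stack 3. *)
Definition decide_cmd (Q : nat -> cmd) :=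
  CSeq (mv 0 2) (CSeq (Push 3 false) (CSeq raw_loop (CSeq (app 1 3 2) (CSeq (Push 3 true) (Q 3))))).

Lemma decide_prog (X : Type) {eX : Enc X} (g : X * seq bool -> bool) bd : ccomp g bd ->
  exists B, forall x r, exists2 t, t <= bd (x, r) + 12 * size r + 4 * sz x + 20 &
    exec B (upd (upd (fun => [::]) 0 r) 1 (code (E x))) (upd (fun => [::]) 3 (code (E (g (x, r))))) t.
Proof.
case=> Q HQ; exists (decide_cmd Q) => x r.
have [t1 L1 H1] := exec_raw_loop (rev r) [::]; have [t2 L2 H2] := HQ (x, r).
rewrite size_rev in L1.
eexists; last first.
  apply: (@ex_seq _ _ _ (upd (upd (fun => [::]) 2 (rev r)) 1 (code (E x))) _ (2 * size r).+1).
    by apply: (exec_tot (exec_mv _ _)) => //; rd; rewrite ?cats0; st.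
  apply: (@ex_seq _ _ _ (upd (upd (upd (fun => [::]) 2 (rev r)) 1 (code (E x))) 3 [:: false])).
    by apply: (exec_to (ex_push _ _ _)); rd.
  apply: (@ex_seq _ _ _ (upd (upd (fun => [::]) 1 (code (E x))) 3 (code (E r)))).
    apply: (exec_to (H1 _ _ _)); [by rd|by rd|].
    by rewrite catrevE cats0 revK; st.
  apply: (@ex_seq _ _ _ (upd (fun => [::]) 3 (code (E x) ++ code (E r))) _ (4 * sz x + 3)).
    by apply: (exec_tot (exec_app _ _ _ _)) => //; rd => //; st.
  apply: (@ex_seq _ _ _ (upd (fun => [::]) 3 (code (E (x, r))))).
    by apply: (exec_to (ex_push _ _ _)); rd; st.
  apply: (exec_to (H2 3 _ _ _)); first by rd.
    by move=> j Hj; rewrite upd_neq //; lia.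
  by st.
by lia.
Qed.

Definition final j := Case j (Halt false) (Halt true) (Halt false).

(** The three additional steps are the two sequencings and the final [Case]. *)
Lemma prog_run A B s s1 s2 t1 t2 b : exec A s s1 t1 -> exec B s1 s2 t2 -> s2 3 = code (E b) ->
  fin (Go (iter (t1 + t2 + 3) kstep ([:: CSeq A (CSeq B (final 3))], s)).1) = Some b.
Proof.
move=> HA HB Hb.
have -> : t1 + t2 + 3 = (1 + (t2 + (1 + (t1 + 1)))) by lia.
rewrite iterD (iterD t2) (iterD 1) (iterD t1) [iter 1 kstep ([:: CSeq _ _], _)]/=.
rewrite (exec_kstep HA) [iter 1 kstep (CSeq _ _ :: _, _)]/= (exec_kstep HB) /= Hb.
by case: b Hb.
Qed.

(** Pushing the bits [true], [false] in front of a unary code is the successor, so a stack of ticks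
    is turned into a number. *)
Lemma exec_ticks kt n s m : kt <> 1 -> s kt = nseq n true -> s 1 = code (E m) ->
  exists t, exec (Loop kt Skip (pushes 1 [:: true; false])) s (upd (upd s kt [::]) 1 (code (E (n + m)))) t.
Proof.
move=> Hk; elim: n s m => [|n IH] s m Hn Hm.
  by exists 1; apply: (exec_conv (ex_loop0 _ _ Hn)) => //; rewrite add0n -Hm -[[::]]Hn; st.
have [||t H] := IH (upd (upd s kt (nseq n true)) 1 (code (E m.+1))) m.+1; [by rd|by rd|].
exists (5 + t).+1; apply: (@ex_loop _ _ _ _ (upd (upd s kt (nseq n true)) 1 (code (E m.+1))) _ _ _ true (nseq n true)) => //.
  by apply: (exec_to (exec_pushes _ _ _)); rd; rewrite Hm.
by apply: (exec_to H); rewrite addnS; st.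
Qed.

Lemma FC_pow2 : FC false (fun n => 2 ^ n).
Proof.
apply: (FC_eq (f := fun n => iter n (fun x => x + x) 1)); last by fc.
by elim=> //= n ->; rewrite expnS mul2n addnn.
Qed.

Lemma halted_case q (b : bool) : halted q -> (q == 1) = b -> q = if b then 1 else 2.
Proof. by rewrite /halted => /orP[] /eqP-> <-. Qed.

(* The ticked program leaves f m bits on a stack; hence the graph of m |-> 2 ^ f m is decidable although f itself has no closed form. *)
Lemma time_computable A (f : nat -> nat) (g : nat -> seq bool) :
  (forall m r, exec A (upd (fun => [::]) 0 (enc_nat m ++ r)) (upd (upd (fun => [::]) 0 r) 1 (g m)) (f m)) ->
  computable (fun m => 2 ^ f m).
Proof.
move=> HA; have HF := FC_pow2; have HE := FC_enc_nat.
have [bd [Hg _]] : FC false (fun x : nat * seq bool => x.2 == enc_nat (2 ^ x.1)) by fc.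
have [B HB] := decide_prog Hg.
(* A stack that [A] does not touch, different from 0 and 1. *)
set kt := (width A).+4.
(* [A] is run only for its length: its result on stack 1 is erased and replaced by the number of
   ticks. *)
set P := CSeq (tick kt A) (CSeq (clr 1) (CSeq (Push 1 false) (Loop kt Skip (pushes 1 [:: true; false])))).
set W := (width (CSeq P (CSeq B (final 3)))).+1.
exists (mach (CSeq P (CSeq B (final 3))) W); split; first exact: mach_wf.
move=> n y; have Hk : width A <= kt by rewrite /kt; lia.
have [t1 H1] := exec_tick (HA n (enc_nat y)) Hk [::].
have [t2 _ H2] := HB (f n) (enc_nat y).
set s := upd _ 0 _ in H1.
have Es : upd s kt [::] = s by rewrite /s; st.
rewrite Es cats0 in H1; set s1 := upd _ kt _ in H1.
have [t3 H3] : exists t, exec P s (upd (upd (fun => [::]) 0 (enc_nat y)) 1 (code (E (f n)))) t.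
  have Hkt : kt <> 1 by rewrite /kt; lia.
  have K1 : upd (upd s1 1 [::]) 1 [:: false] kt = nseq (f n) true by rewrite /s1; rd.
  have [t3 H3] := @exec_ticks kt (f n) _ 0 Hkt K1 (upd_eq _ _ _).
  have [t4 H4] : exists t, exec (clr 1) s1 (upd s1 1 [::]) t by eexists; apply: exec_clr.
  exists (t1 + (t4 + (1 + t3).+1).+1).+1.
  apply: (ex_seq H1); apply: (ex_seq H4).
  apply: (@ex_seq _ _ _ (upd (upd s1 1 [::]) 1 [:: false])).
    by apply: (exec_to (ex_push _ _ _)); rd.
  by apply: (exec_to H3); rewrite addn0 /s1; move: Hkt => Hkt; st.
have Hrun := prog_run H3 H2 (upd_eq _ _ _).
have HW : width (CSeq P (CSeq B (final 3))) <= W by exact: leqnSn.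
have [Hh Hq] := @mach_run _ _ HW _ _ _ isT Hrun _ (ltnSn _).
(* [y] is never decoded; its code is compared with that of the power. *)
have -> : (2 ^ f n == y) = (enc_nat y == enc_nat (2 ^ f n)) by rewrite (inj_eq enc_nat_inj) eq_sym.
by eexists; apply: halted_case Hh Hq.
Qed.

(** With q the quotient of t by the exponent, t + 2 is at most 2 ^ (constant + q), because it is at
    most a constant times q + 1. Raising this to the exponent turns q into at most t. *)
Lemma poly_exp c : exists C, forall t, (t + 2) ^ c <= 2 ^ (C + t).
Proof.
case: c => [|c]; first by exists 0 => t; rewrite expn0 expn_gt0.
exists (c.+3 * c.+1) => t; set q := t %/ c.+1.
have H : t + 2 <= 2 ^ (c.+3 + q).
  have Hq : q.+1 <= 2 ^ q by apply: ltn_expl.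
  have Hc : c.+3 <= 2 ^ c.+3 by apply/ltnW/ltn_expl.
  have Ht : t < q.+1 * c.+1 by apply: ltn_ceil.
  rewrite expnD; apply: leq_trans (leq_mul Hc Hq); nia.
apply: (@leq_trans ((2 ^ (c.+3 + q)) ^ c.+1)); first by rewrite leq_exp2r.
rewrite -expnM leq_exp2l // mulnDl leq_add2l; exact: leq_trunc_div.
Qed.

(** Put Z = t1 + n + 2. The programs take at most Z ^ (3 c + 7) steps and their one-tape simulation
    fewer than Z ^ d. Now Z <= (t1 + 2) (n + 1), the power (t1 + 2) ^ d is at most 2 ^ (C + t1), and
    2 ^ C is absorbed by (n + 1) ^ C since n > 0. The term 4 n comes from coding a list of bits with
    at most four cells per bit. *)
Lemma time_bound c W n t1 t2 C d : (forall t, (t + 2) ^ d <= 2 ^ (C + t)) ->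
  d = 2 * (3 * c + 7) + W + 7 -> 0 < n ->
  t2 <= (t1 + 4 * n + 4) ^ c + 12 * n + 4 * t1 + 20 ->
  (t1 + t2 + 3) * (4 * (n + W + (t1 + t2 + 3)) + 6) < 2 ^ t1 * n.+1 ^ (d + C).
Proof.
move=> HC Hd n1 Ht2; set Z := t1 + n + 2; set t := t1 + t2 + 3.
have Z2 : 2 <= Z by rewrite /Z; lia.
have pw k l : k <= l -> Z ^ k <= Z ^ l by apply: leq_pexp2l; lia.
have Zp k : 0 < Z ^ k by rewrite expn_gt0; lia.
have two k : 2 ^ k <= Z ^ k by case: k => // k; rewrite leq_exp2r.
have Z1 : Z = Z ^ 1 by rewrite expn1.
have H4 : t1 + 4 * n + 4 <= Z ^ 3.
  by have := two 2; rewrite (expnD Z 2 1) expn1 /Z => H; apply: leq_trans (leq_mul H (leqnn _)); rewrite -/Z /Z; lia.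
have H24 : t1 + 12 * n + 4 * t1 + 23 <= Z ^ 6.
  by have := two 5; rewrite (expnD Z 5 1) expn1 /Z => H; apply: leq_trans (leq_mul H (leqnn _)); rewrite -/Z /Z; lia.
have Ht : t <= Z ^ (3 * c + 7).
  have Hc : (t1 + 4 * n + 4) ^ c <= Z ^ (3 * c + 6).
    apply: leq_trans (pw (3 * c) _ _); last by lia.
    by rewrite expnM; case: (c) => // k; rewrite leq_exp2r.
  have H6 : Z ^ 6 <= Z ^ (3 * c + 6) by apply: pw; lia.
  have -> : 3 * c + 7 = (3 * c + 6).+1 by lia.
  rewrite expnS /t; apply: (@leq_trans (2 * Z ^ (3 * c + 6))); last by rewrite leq_mul2r Z2 orbT.
  lia.
have HZ : Z ^ d <= 2 ^ t1 * n.+1 ^ (d + C).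
  apply: (@leq_trans ((t1 + 2) ^ d * n.+1 ^ d)).
    by rewrite -expnMn; case: (d) => // k; rewrite leq_exp2r // /Z; nia.
  have HC2 : 2 ^ C <= n.+1 ^ C by case: (C) => // k; rewrite leq_exp2r.
  apply: (@leq_trans (2 ^ (C + t1) * n.+1 ^ d)); first by rewrite leq_mul2r HC orbT.
  by rewrite !expnD -mulnA [leqRHS]mulnA mulnC leq_mul2l HC2 orbT.
apply: leq_trans HZ; rewrite Hd.
set e := 3 * c + 7 in Ht *.
have -> : 2 * e + W + 7 = (e + (e + W + 6)).+1 by lia.
rewrite expnS expnD.
have Hin : 4 * (n + W + t) + 6 <= Z ^ (e + W + 6).
  have HW : W <= Z ^ (e + W) by apply: leq_trans (pw W _ _); [apply: leq_trans (two W); exact/ltnW/ltn_expl|lia].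
  have Hn : n <= Z ^ (e + W).
    by apply: leq_trans (pw 1 _ _); [rewrite expn1 /Z; lia|rewrite /e; lia].
  have Hte : Z ^ e <= Z ^ (e + W) by apply: pw; lia.
  have H1 : 1 <= Z ^ (e + W) by apply: Zp.
  rewrite (expnD _ _ 6); have := two 6; move: (Z ^ (e + W)) (Z ^ 6) HW Hn Hte H1 => u v HW Hn Hte H1 Hv.
  have : u * 2 ^ 6 <= u * v by rewrite leq_mul2l Hv orbT.
  have -> : 2 ^ 6 = 64 by []. lia.
have := leq_mul Ht Hin; have := Zp e; have := Zp (e + W + 6); move: (Z ^ e) (Z ^ _) => u v Hv Hu Huv.
apply: leq_ltn_trans Huv _; nia.
Qed.

Theorem FPT_by_table (I : Type) (enc : I -> seq bool) (valid : I -> Prop) (kappa : I -> nat)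
    (yes : I -> Prop) (body : I -> seq bool) (X : Type) {eX : Enc X} (T : nat -> X)
    (dec : X * seq bool -> bool) :
  (forall x, enc x = enc_nat (kappa x) ++ body x) ->
  FC false T -> FC true dec ->
  (forall x, valid x -> dec (T (kappa x), body x) <-> yes x) ->
  FPT enc valid kappa yes.
Proof.
move=> Henc HT [bd [Hdec Hbd]] Hyes; have [c0 Hc0] := Hbd isT.
(* [f m] is the exact time of the table program for [m] candidates; it has no closed form, so it is
   named by choice. *)
have [A HA] := table_prog HT; have [f {}HA] := functional_choice _ HA.
have [B HB] := decide_prog Hdec.
set P := CSeq A (CSeq B (final 3)); set W := (width P).+1.
set a := 3 * c0 + 7; set d := 2 * a + W + 7.
have [C HC] := poly_exp d.
exists (mach P W), (fun m => 2 ^ f m), (d + C); split; first by apply: mach_wf.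
split; first exact: time_computable HA.
move=> x Hx; set n := size (enc x).
have [t2 L2 H2] := HB (T (kappa x)) (body x).
have Hrun := prog_run (HA (kappa x) (body x)) H2 (upd_eq _ _ _).
set t1 := f (kappa x) in Hrun *.
have Hr : size (body x) <= n by rewrite /n Henc size_cat leq_addl.
have Hs : sz (T (kappa x)) <= t1.
  have := exec_size (HA (kappa x) (body x)) 1; rewrite upd_eq upd_neq //.
have Hb : bd (T (kappa x), body x) <= (t1 + 4 * n + 4) ^ c0.
  apply: leq_trans (Hc0 _) _; case: (c0) => // c1; rewrite leq_exp2r // sz_pair.
  have := sz_bits_le (body x); lia.
have n1 : 0 < n by rewrite /n Henc size_cat; have := enc_nat_gt0 (kappa x); lia.
have HW : width P <= W by exact: leqnSn.
set t := t1 + t2 + 3 in Hrun.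
have Ht : t * (4 * (n + W + t) + 6) < 2 ^ t1 * n.+1 ^ (d + C).
  apply: (time_bound HC) => //; apply: leq_trans L2 _.
  by rewrite !leq_add2r; apply: leq_add => //; [apply: leq_add => //; rewrite leq_mul2l Hr|rewrite leq_mul2l Hs].
rewrite -Henc in Hrun; have [Hh Hq] := @mach_run _ _ HW _ _ _ isT Hrun _ Ht.
rewrite /=; split => //; rewrite -(Hyes x Hx) -Hq; split=> [->|/eqP] //.
Qed.

Lemma control_FPT_by_counts (R : rule) (rb : nat -> Lrel -> nat -> bool) uniqm constructive succinct :
  (forall m votes L, all (valid_vote m) votes -> LEspec m votes L ->
     forall c, R m votes c <-> rb m L c) ->
  (forall m L c, rb m L c -> c < m) ->
  FC false (fun x : nat * Lrel * nat => rb x.1.1 x.1.2 x.2) ->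
  control_FPT R uniqm constructive succinct.
Proof.
move=> HR Hrb HF; have HT := FC_mktable HF uniqm constructive.
have HD := FC_decide succinct; rewrite /control_FPT; case: succinct HD => HD.
- apply: (FPT_by_table (body := body_s) _ HT HD) => // x; exact: decide_s.
- apply: (FPT_by_table (body := body_n) _ HT HD) => // x; exact: decide_n.
Qed.

Theorem theorem3 :
  forall uniqm constructive succinct : bool,
    control_FPT schulze_winner uniqm constructive succinct /\
    (forall (tc : cand_tiebreak) (tp : pair_tiebreak),
       feasible_cand_tiebreak tc -> feasible_pair_tiebreak tp ->
       control_FPT (rp_winner tc tp) uniqm constructive succinct).
Proof.
move=> uniqm constructive succinct; split.
- apply: (@control_FPT_by_counts _ schulzeb).
  + by move=> m votes L Hv HL c; apply: schulzebP.
  + by move=> m L c /andP[].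
  + exact: FC_schulzeb.
- move=> tc tp Htc Htp.
  have [tcb [Ftc Etc]] := feasible_tc Htc; have [tpb [Ftp Etp]] := feasible_tp Htp.
  apply: (@control_FPT_by_counts _ (fun m => rpb (tcb m) (tpb m) m)).
  + by move=> m votes L Hv HL c; apply: (rpbP Htp.1 Etc Etp Hv HL).
  + by move=> m L c /andP[].
  + exact: FC_rpb Ftc Ftp.
Qed.
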